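(* Let $p$ be a strongly irreducible transition kernel on $\mathbb{Z}^d\times\{1,\dots,N\}$ which is $\mathbb{Z}^d$-invariant, such that the set $D=\{u\in\mathcal F:\lambda(u)\le1\}$ is compact and such that the minimum of the function $\lambda$ is strictly smaller than $1$. Let $(y_n)$ be a sequence in $\mathbb{Z}^d$ converging to $\tilde y\in\partial\mathbb{Z}^d$, and let $u=\varphi(\tilde y)\in H$. Then for every $x\in\mathbb{Z}^d$ and all $k,j\in\{1,\dots,N\}$, $K_{k,j}(x,y_n)$ converges to $$\frac{C(u)_k}{C(u)_{k_0}}\,\mathrm{e}^{u\cdot(x-x_0)}.$$
   Context: Let $d,N\ge1$. A $\mathbb{Z}^d$-invariant transition kernel on $\mathbb{Z}^d\times\{1,\dots,N\}$ is a family $p((x,k),(y,j))=p_{k,j}(x,y)\ge0$ with $p_{k,j}(x,y)=p_{k,j}(0,y-x)$ and finite mass $\sum_{y,j}p_{k,j}(x,y)<\infty$ (total mass is not assumed to be $1$). $p^{(n)}$ is its $n$th convolution power ($p^{(0)}$ is the identity kernel). It is strongly irreducible if for all $k,j$ and $x,y$ there is $n_0$ such that $p^{(n)}_{k,j}(x,y)>0$ for all $n\ge n_0$. $F(u)$ is the $N\times N$ matrix with entries $F_{k,j}(u)=\sum_{x\in\mathbb{Z}^d}p_{k,j}(0,x)\mathrm{e}^{u\cdot x}\in[0,\infty]$, and $\mathcal F$ is the interior of the set of $u\in\mathbb{R}^d$ for which all entries of $F(u)$ are finite. When $F(u)$ is finite, it has a dominant (Perron–Frobenius) eigenvalue $\lambda(u)>0$,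 simple and strictly larger than the modulus of any other eigenvalue; $\lambda$ is analytic on $\mathcal F$ and $\nabla\lambda$ is its gradient. $H=\{u\in\mathcal F:\lambda(u)=1\}$. $C(u)$ is a right eigenvector of $F(u)$ for $\lambda(u)$ with positive coordinates $C(u)_k$. Under the two assumptions of the statement, $\nabla\lambda\neq0$ on $H$ and $u\in H\mapsto\nabla\lambda(u)/\|\nabla\lambda(u)\|\in\mathbb{S}^{d-1}$ is a homeomorphism. The boundary $\partial\mathbb{Z}^d$ is identified with $\mathbb{S}^{d-1}$: $(y_n)$ converges to $\tilde y\in\mathbb{S}^{d-1}$ if $\|y_n\|\to\infty$ and $y_n/\|y_n\|\to\tilde y$. The map $\varphi:\partial\mathbb{Z}^d\to H$ sends $\tilde y$ to the unique $u\in H$ with $\nabla\lambda(u)/\|\nabla\lambda(u)\|=\tilde y$. The Green function is $G_{k,j}(x,y)=\sum_{n\ge0}p^{(n)}_{k,j}(x,y)$ (finite under the assumptions). A base point $(x_0,k_0)\in\mathbb{Z}^d\times\{1,\dots,N\}$ is fixed, and the Martin kernel is $K_{k,j}(x,y)=G_{k,j}(x,y)/G_{k_0,j}(x_0,y)$. *)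

(* Defs.v *)
From HB Require Import structures.
From mathcomp Require Import all_boot all_order all_algebra.
From mathcomp Require Import complex.
From mathcomp Require Import all_classical all_reals all_analysis.

Set Implicit Arguments.
Unset Strict Implicit.
Unset Printing Implicit Defensive.

Import Order.TTheory GRing.Theory Num.Theory.
Import numFieldNormedType.Exports.

Local Open Scope classical_set_scope.
Local Open Scope ring_scope.

(* The library norm on 'rV[R]_d is the sup norm (which induces the usual
   topology); the sphere and the directions below need the Euclidean norm. *)
Definition dot (R : realType) (d : nat) (u v : 'rV[R]_d) : R :=
  \sum_(i < d) u 0 i * v 0 i.

Definition enorm (R : realType) (d : nat) (u : 'rV[R]_d) : R :=
  Num.sqrt (dot u u).

Definition direction (R : realType) (d : nat) (u : 'rV[R]_d) : 'rV[R]_d :=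
  (enorm u)^-1 *: u.

Definition of_lattice (R : realType) (d : nat) (x : 'rV[int]_d) : 'rV[R]_d :=
  map_mx intr x.

(* [p k j x y] is p_{k,j}(x,y) = p((x,k),(y,j)). *)
Definition kernel_on (R : realType) (d N : nat) : Type :=
  'I_N -> 'I_N -> 'rV[int]_d -> 'rV[int]_d -> R.

Record invariant_kernel (R : realType) (d N : nat) (p : kernel_on R d N) :
    Prop := InvariantKernel {
  kernel_ge0 : forall k j x y, 0 <= p k j x y ;
  kernel_invariant : forall k j x y, p k j x y = p k j 0 (y - x) ;
  kernel_finite_mass : forall k x,
    (\sum_(j < N) \esum_(y in [set: 'rV[int]_d]) (p k j x y)%:E < +oo)%E }.

Fixpoint kernel_pow (R : realType) (d N : nat) (p : kernel_on R d N) (n : nat)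
    (k j : 'I_N) (x y : 'rV[int]_d) : \bar R :=
  if n is m.+1 then
    (\sum_(i < N) \esum_(z in [set: 'rV[int]_d])
        ((p k i x z)%:E * kernel_pow p m i j z y))%E
  else ((((x == y) && (k == j))%:R : R)%:E).

Definition strongly_irreducible (R : realType) (d N : nat)
    (p : kernel_on R d N) : Prop :=
  forall (k j : 'I_N) (x y : 'rV[int]_d),
    exists n0 : nat, forall n : nat, (n0 <= n)%N ->
      (0 < kernel_pow p n k j x y)%E.

Definition Fent (R : realType) (d N : nat) (p : kernel_on R d N)
    (u : 'rV[R]_d) (k j : 'I_N) : \bar R :=
  (\esum_(x in [set: 'rV[int]_d])
     (p k j 0 x * expR (dot u (of_lattice R x)))%:E)%E.

(* Meaningful only where all entries are finite. *)
Definition Fmx (R : realType) (d N : nat) (p : kernel_on R d N)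
    (u : 'rV[R]_d) : 'M[R]_N :=
  \matrix_(k, j) fine (Fent p u k j).

Definition Fdom (R : realType) (d N : nat) (p : kernel_on R d N) :
    set 'rV[R]_d :=
  interior [set u | forall k j, (Fent p u k j < +oo)%E].

(* [eigenvalue] refers to row (left) eigenvectors; the spectrum is the same.
   "Simple" is a root of multiplicity one of the characteristic polynomial, and
   the other eigenvalues are taken over the complex numbers R[i]. *)
Definition dominant_eigenvalue (R : realType) (N : nat) (A : 'M[R]_N) (l : R) :
    Prop :=
  [/\ 0 < l, eigenvalue A l, mup l (char_poly A) = 1%N &
      forall z : R[i], eigenvalue (map_mx (@real_complex R) A) z ->
        z != real_complex R l -> `|z| < real_complex R l].

(* There is at most one dominant eigenvalue; 0 is the value when there is
   none, which does not occur at points where F is finite. *)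
Definition lambda (R : realType) (d N : nat) (p : kernel_on R d N)
    (u : 'rV[R]_d) : R :=
  xget 0 [set l | dominant_eigenvalue (Fmx p u) l].

Definition grad (R : realType) (d : nat) (f : 'rV[R]_d -> R) (u : 'rV[R]_d) :
    'rV[R]_d :=
  \row_(i < d) derive f u (delta_mx 0 i).

Definition Dset (R : realType) (d N : nat) (p : kernel_on R d N) :
    set 'rV[R]_d :=
  [set u | Fdom p u /\ lambda p u <= 1].

Definition Hset (R : realType) (d N : nat) (p : kernel_on R d N) :
    set 'rV[R]_d :=
  [set u | Fdom p u /\ lambda p u = 1].

(* The set below is a singleton when |v| = 1, under the assumptions of the
   theorem. *)
Definition phi (R : realType) (d N : nat) (p : kernel_on R d N)
    (v : 'rV[R]_d) : 'rV[R]_d :=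
  xget 0 [set u | Hset p u /\ direction (grad (lambda p) u) = v].

Definition positive_right_eigenvector (R : realType) (d N : nat)
    (p : kernel_on R d N) (u : 'rV[R]_d) (C : 'cV[R]_N) : Prop :=
  Fmx p u *m C = lambda p u *: C /\ forall k, 0 < C k 0.

Definition cvg_to_boundary (R : realType) (d : nat) (y : nat -> 'rV[int]_d)
    (v : 'rV[R]_d) : Prop :=
  [/\ enorm v = 1,
      enorm (of_lattice R (y n)) @[n --> \oo] --> +oo &
      direction (of_lattice R (y n)) @[n --> \oo] --> v].

Definition green (R : realType) (d N : nat) (p : kernel_on R d N)
    (k j : 'I_N) (x y : 'rV[int]_d) : \bar R :=
  (\sum_(0 <= n <oo) kernel_pow p n k j x y)%E.

(* [fine] loses nothing: the Green function is finite under the assumptions of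
   the theorem. *)
Definition martin (R : realType) (d N : nat) (p : kernel_on R d N)
    (x0 : 'rV[int]_d) (k0 : 'I_N) (k j : 'I_N) (x y : 'rV[int]_d) : R :=
  fine (green p k j x y) / fine (green p k0 j x0 y).

(* Main.v *)
Require Import Defs.
From HB Require Import structures.
From mathcomp Require Import all_boot all_order all_algebra.
From mathcomp Require Import complex ring lra zify.
From mathcomp Require Import all_classical all_reals all_analysis.

(* Write P for the matrix over the convolution semiring of functions
   Z^d -> [0, +oo] that represents the kernel, so that p^(n) is P^n, and put
   T(y) = sum_n tr P^n(y).  Fix m and a, b, x with c = (P^m)_ab(x) > 0, and
   mark the steps of P^m from a to b with increment x.  By cyclicity of the
   trace, summing over the position of a marked step among q factors P^m gives
     q c (P^n)_ba(y - x)
   for n = m (q - 1) + t: this is the total weight of the closed paths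
   contributing to tr P^(mq+t)(y), each counted with its number of marked
   steps.  By Chernoff's bound at u = phi(ytilde), where F(u) C = C and
   pi F(u) = pi, that number is q mu up to a factor 1 +- eps, with
   mu = c e^(u.x) pi_a C_b, outside paths of total weight
   O(e^(-(u + k ytilde).y)) for some k > 0.  On the other hand T(y_n) is not
   smaller than e^(-u.y_n - o(|y_n|)): the drift of the Doob transform of the
   kernel at u is grad lambda(u), which points to ytilde, so a law of large
   numbers brings the path within o(|y_n|) of y_n, and irreducibility does the
   rest.  Hence G_ba(0, y_n - x) / T(y_n) --> e^(u.x) pi_a C_b, and the limit of
   the Martin kernel is a quotient of two such limits. *)

Set Implicit Arguments.
Unset Strict Implicit.
Unset Printing Implicit Defensive.

Import Order.TTheory GRing.Theory Num.Theory.
Import numFieldNormedType.Exports.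

Local Open Scope classical_set_scope.
Local Open Scope ring_scope.

(** * Perron-Frobenius theory *)

(** The function [T] is bounded from below only up to a factor exp(-o(|y|)), so every error must be
    exponentially smaller than e^(-u.y). This is why Chernoff's bound is taken at the tilted point u
    + k ytilde and not at u: a strict inequality between exponential rates survives a small tilt,
    the tilt gains e^(-k ytilde.y), and this beats the loss in [T]. The same strictness gives
    geometric decay in n, so that the errors can be summed over n. All rates, and the gradient of
    lambda itself, come from one first-order perturbation of the positive eigenvector, read through
    Collatz-Wielandt bounds. The marked factor is a power P^m because irreducibility makes a given
    entry positive only for large exponents; the remainder t < m lets blocks of length m reach every
    n. Values in [0, +oo] allow all sums to be rearranged freely, at the price of having no
    subtraction. *)

Section PF.
Variables (R : realType) (N : nat).
Implicit Types (A : 'M[R]_N) (v r : 'rV[R]_N).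

Definition nneg_mx A := forall i j, 0 <= A i j.
Definition primitive_mx A := exists m, forall i j, 0 < (A ^+ m.+1) i j.

(** The product of the truncations min(1, f i) serves as the bound; unlike a minimum it makes sense
    for an empty index type. *)
Lemma pos_lower_bound (I : finType) (f : I -> R) :
  (forall i, 0 < f i) -> exists2 e, 0 < e & forall i, e <= f i.
Proof.
move=> f0.
have h i : 0 <= Order.min 1 (f i) <= 1.
  by rewrite ge_min lexx/= andbT le_min ler01 ltW.
exists (\prod_i (Order.min 1 (f i))).
  by apply: prodr_gt0 => i _; rewrite lt_min ltr01 f0.
move=> i; rewrite (bigD1 i)//=.
rewrite -[leRHS]mulr1 ler_pM// ?ge_min ?lexx ?orbT//; first by case/andP: (h i).
  by apply: prodr_ge0 => j _; case/andP: (h j).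
exact: prodr_ile1.
Qed.

Lemma mulmx_pos A v : (forall i j, 0 < A i j) -> (forall i, 0 <= v 0 i) ->
  v != 0 -> forall j, 0 < (v *m A) 0 j.
Proof.
move=> A0 v0 vn0 j; have [i vi] : exists i, v 0 i != 0.
  by apply/rV0Pn.
rewrite !mxE (bigD1 i)//= ltr_pwDl//; first by rewrite mulr_gt0// lt_def vi v0.
by apply: sumr_ge0 => k _; rewrite mulr_ge0// ltW.
Qed.

Lemma eigen_exp A (l : R) v n : v *m A = l *: v -> v *m (A ^+ n) = l ^+ n *: v.
Proof.
move=> vA; elim: n => [|n IH]; first by rewrite !expr0 mulmx1 scale1r.
by rewrite exprS -[A * _]/(A *m _) mulmxA vA -scalemxAl IH scalerA exprS.
Qed.

(* Collatz-Wielandt: [l] is the largest [t] with [t x <= x A] for some [x] in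
   the simplex; a strict inequality would be improved by [x A^m]. *)
Lemma PF_left A : (0 < N)%N -> nneg_mx A -> primitive_mx A ->
  exists l v, [/\ 0 < l, forall i, 0 < v 0 i & v *m A = l *: v].
Proof.
move=> N0 A0 [m Am].
(* Summing [t * v 0 j <= (v *m A) 0 j] over [j] bounds [t] by the sum of all entries of [A], which
   makes the set [E] below compact. *)
pose B := \sum_i \sum_j A i j.
pose bx := [set v : 'rV[R]_N | forall i, `[0, 1]%classic (v 0 i)].
pose E := [set z : 'rV[R]_N * R | [/\ (bx `*` `[0, B]%classic) z,
  \sum_i z.1 0 i = 1 & forall j, z.2 * z.1 0 j <= (z.1 *m A) 0 j]].
have cfst i : continuous (fun z : 'rV[R]_N * R => z.1 0 i).
  move=> z; apply: (@continuous_comp _ _ _ fst (fun M : 'rV[R]_N => M 0 i)).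
    exact: cvg_fst.
  exact: coord_continuous.
have csum (f : 'I_N -> R) :
    continuous (fun z : 'rV[R]_N * R => \sum_i z.1 0 i * f i).
  move=> z; apply: cvg_big => [|i _]; first exact: add_continuous.
  by apply: cvgM; [exact: cfst|exact: cvg_cst].
have cbx : compact (bx `*` `[0, B]%classic).
  apply: compact_setX; last exact: segment_compact.
  by apply: (@rV_compact _ _ (fun=> _)) => i; exact: segment_compact.
have cE : compact E.
  apply: (@subclosed_compact _ _ (bx `*` `[0, B]%classic)) => //; last first.
    by move=> z [].
  have -> : E = (bx `*` `[0, B]%classic) `&`
     ((fun z : 'rV[R]_N * R => \sum_i z.1 0 i * 1) @^-1` [set x | x = 1] `&`
     \bigcap_(j in setT) (fun z : 'rV[R]_N * R =>
        (\sum_i z.1 0 i * A i j) - z.2 * z.1 0 j) @^-1` [set x | 0 <= x]).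
    apply/seteqP; split=> z /=.
      move=> [? h1 h2]; split=> //; split=> [|j _ /=].
        by rewrite -[RHS]h1; apply: eq_bigr => i _; rewrite mulr1.
      by rewrite subr_ge0; have := h2 j; rewrite mxE.
    move=> [? [h1 h2]]; split=> [//||j].
      by rewrite -[RHS]h1; apply: eq_bigr => i _; rewrite mulr1.
    by have := h2 j Logic.I; rewrite /= subr_ge0 mxE.
  apply: closedI.
    apply: compact_closed; last exact: cbx.
    exact: norm_hausdorff.
  apply: closedI.
    by move/continuous_closedP: (csum (fun=> 1)); apply; exact: closed_eq.
  apply: closed_bigI => j _.
  have : continuous (fun z : 'rV[R]_N * R =>
      (\sum_i z.1 0 i * A i j) - z.2 * z.1 0 j).
    move=> z; apply: cvgB; first exact: csum.
    by apply: cvgM; [exact: cvg_snd|exact: cfst].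
  by move/continuous_closedP; apply; exact: closed_ge.
have simplex_le v : (forall i, 0 <= v 0 i) -> \sum_i v 0 i = 1 ->
    forall i, v 0 i <= 1.
  move=> v0 v1 i; rewrite -v1 (bigD1 i)//= lerDl.
  by apply: sumr_ge0.
have inE t v : (forall i, 0 <= v 0 i) -> \sum_i v 0 i = 1 ->
    0 <= t -> (forall j, t * v 0 j <= (v *m A) 0 j) -> E (v, t).
  move=> v0 v1 t0 tv; split=> //; split=> /=.
    by move=> i /=; rewrite in_itv/= v0 simplex_le.
  rewrite in_itv/= t0 -[t]mulr1 -v1 mulr_sumr (@le_trans _ _ (\sum_j (v *m A) 0 j))//.
    by apply: ler_sum.
  rewrite /B exchange_big/=; apply: ler_sum => j _; rewrite mxE.
  by apply: ler_sum => i _; rewrite ler_piMl ?simplex_le.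
have E0 : E !=set0.
  exists (const_mx N%:R^-1, 0); apply: inE => //.
  - by move=> i; rewrite mxE invr_ge0.
  - under eq_bigr do rewrite mxE.
    by rewrite sumr_const card_ord -[_ *+ _]mulr_natl divff// pnatr_eq0 -lt0n.
  - move=> j; rewrite mul0r mxE; apply: sumr_ge0 => i _.
    by rewrite mulr_ge0// mxE invr_ge0.
have csnd : {within E, continuous (snd : 'rV[R]_N * R -> R)}.
  by apply: continuous_subspaceT => z; exact: cvg_snd.
have [[v l] /set_mem Ev max] := compact_EVT_max E0 cE csnd.
case: Ev => -[/= vbx lB] v1 vA.
have v0 i : 0 <= v 0 i by have := vbx i; rewrite /= in_itv/= => /andP[].
have vn0 : v != 0.
  apply/eqP => vz; move: v1; rewrite vz big1 => [/eqP|i _]; last by rewrite mxE.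
  by rewrite eq_sym oner_eq0.
have l0 : 0 <= l by move: lB; rewrite /= in_itv/= => /andP[].
have [y0|yn0] := eqVneq (v *m A - l *: v) 0.
  have vAE : v *m A = l *: v by apply/eqP; rewrite -subr_eq0 y0.
  (* The positive vector v A^(m+1) equals l^(m+1) v, which forces both [l] and [v] to be
     positive. *)
  have h i : 0 < l ^+ m.+1 * v 0 i.
    have := mulmx_pos Am v0 vn0 i.
    by rewrite (eigen_exp _ vAE) mxE.
  exists l, v; split => // [|i].
    rewrite lt_def l0 andbT; apply/eqP => lz.
    by have := h (Ordinal N0); rewrite lz exprS !mul0r ltxx.
  rewrite lt_def v0 andbT; apply/eqP => vz.
  by have := h i; rewrite vz mulr0 ltxx.
exfalso.
pose w := v *m (A ^+ m.+1).
have w0 i : 0 < w 0 i by exact: mulmx_pos.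
pose y := (v *m A - l *: v) *m (A ^+ m.+1).
have y0 i : 0 < y 0 i.
  by apply: mulmx_pos => // j; rewrite !mxE subr_ge0; have := vA j; rewrite mxE.
have yE : y = w *m A - l *: w.
  rewrite /y mulmxBl -scalemxAl -!mulmxA; congr (_ *m _ - _).
  by rewrite !mulmxE -exprS -exprSr.
have [e e0 ele] : exists2 e, 0 < e & forall i, e <= y 0 i / w 0 i.
  by apply: pos_lower_bound => i; rewrite divr_gt0.
pose s := \sum_i w 0 i.
have s0 : 0 < s.
  rewrite /s (bigD1 (Ordinal N0))//= ltr_pwDl//.
  by apply: sumr_ge0 => k _; rewrite ltW.
have : E (s^-1 *: w, l + e).
  apply: inE => [i|||j].
  - by rewrite mxE mulr_ge0 ?invr_ge0 // ltW.
  - by under eq_bigr do rewrite mxE; rewrite -mulr_sumr mulVf// gt_eqF.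
  - by rewrite addr_ge0// ltW.
  - rewrite -scalemxAl [leRHS]mxE [X in _ * X]mxE mulrCA.
    rewrite ler_wpM2l ?invr_ge0 ?(ltW s0)//.
    have := ele j; rewrite ler_pdivlMr// yE !mxE.
    by rewrite lerBrDl mulrDl.
by move=> /mem_set /max /=; rewrite gerDl leNgt e0.
Qed.

End PF.

Section PF2.
Variables (R : realType) (N : nat).
Implicit Types (A : 'M[R]_N) (v r pi : 'rV[R]_N) (C : 'cV[R]_N).

Lemma trmx_exp A n : (A ^+ n)^T = A^T ^+ n.
Proof.
elim: n => [|n IH]; first by rewrite !expr0 trmx1.
by rewrite exprS -mulmxE trmx_mul IH mulmxE -exprSr.
Qed.

Lemma dot_gt0 pi C : (0 < N)%N -> (forall i, 0 < pi 0 i) ->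
  (forall i, 0 < C i 0) -> 0 < (pi *m C) 0 0.
Proof.
move=> N0 p0 C0; rewrite mxE (bigD1 (Ordinal N0))//= ltr_pwDl ?mulr_gt0//.
by apply: sumr_ge0 => i _; rewrite ltW ?mulr_gt0.
Qed.

(** The right eigenvector comes from the transposed matrix; the two eigenvalues agree because pi A C
    can be computed on either side and pi C > 0. *)
Lemma Perron_Frobenius A : (0 < N)%N -> nneg_mx A -> primitive_mx A ->
  exists l pi C, [/\ 0 < l, forall i, 0 < pi 0 i, forall i, 0 < C i 0,
    pi *m A = l *: pi & A *m C = l *: C].
Proof.
move=> N0 A0 pA.
have [l [pi [l0 pi0 piA]]] := PF_left N0 A0 pA.
have A0' : nneg_mx A^T by move=> i j; rewrite mxE.
have pA' : primitive_mx A^T.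
  by case: pA => m Am; exists m => i j; rewrite -trmx_exp mxE.
have [l' [v [l'0 v0 vA]]] := PF_left N0 A0' pA'.
have vC i : 0 < v^T i 0 by rewrite mxE.
have AC : A *m v^T = l' *: v^T by rewrite -{1}[A]trmxK -trmx_mul vA linearZ.
exists l, pi, v^T; split => //; rewrite AC; congr (_ *: _).
have h := dot_gt0 N0 pi0 vC.
have /(congr1 (fun M : 'M[R]_1 => M 0 0)) : (pi *m A) *m v^T = pi *m (A *m v^T).
  by rewrite mulmxA.
rewrite piA AC -scalemxAl -scalemxAr mxE [in RHS]mxE => /mulIf -> //.
by rewrite gt_eqF.
Qed.

(** Subtract from [r] the largest multiple of [pi] that leaves a nonnegative vector. The difference
    is an eigenvector with a zero coordinate, whereas a nonzero one would become positive under a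
    power of [A]. *)
Lemma left_eigen_unique A (l : R) pi r : (0 < N)%N -> primitive_mx A ->
  (forall i, 0 < pi 0 i) -> pi *m A = l *: pi -> r *m A = l *: r ->
  exists c, r = c *: pi.
Proof.
move=> N0 [m Am] pi0 piA rA.
pose i0 := [arg min_(i < Ordinal N0) (r 0 i / pi 0 i)]%O.
have hi0 j : r 0 i0 / pi 0 i0 <= r 0 j / pi 0 j.
  by rewrite /i0; case: arg_minP => // i _ /(_ j isT).
pose c := r 0 i0 / pi 0 i0.
exists c; apply/eqP; rewrite -subr_eq0; apply/negPn/negP => vn0.
have v0 i : 0 <= (r - c *: pi) 0 i.
  by rewrite !mxE subr_ge0 -ler_pdivlMr.
have vA : (r - c *: pi) *m A = l *: (r - c *: pi).
  by rewrite mulmxBl -scalemxAl rA piA scalerBr !scalerA mulrC.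
have := mulmx_pos Am v0 vn0 i0; rewrite (eigen_exp _ vA) !mxE.
by rewrite /c divfK ?gt_eqF// subrr mulr0 ltxx.
Qed.

(** Pairing with the positive left eigenvector turns the vector inequality into one between [l] and
    [rho]; [C] is only a trial vector, not an eigenvector. *)
Lemma Collatz_Wielandt_le A (l rho : R) pi C : (0 < N)%N ->
  (forall i, 0 < pi 0 i) -> pi *m A = l *: pi -> (forall i, 0 < C i 0) ->
  (forall i, (A *m C) i 0 <= rho * C i 0) -> l <= rho.
Proof.
move=> N0 pi0 piA C0 AC; have h := dot_gt0 N0 pi0 C0.
rewrite -(ler_pM2r h).
have -> : l * (pi *m C) 0 0 = (pi *m (A *m C)) 0 0.
  by rewrite mulmxA piA -scalemxAl [RHS]mxE.
rewrite mxE [in leRHS]mxE mulr_sumr; apply: ler_sum => i _.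
by rewrite mulrCA ler_pM2l.
Qed.

Lemma Collatz_Wielandt_ge A (l rho : R) pi C : (0 < N)%N ->
  (forall i, 0 < pi 0 i) -> pi *m A = l *: pi -> (forall i, 0 < C i 0) ->
  (forall i, rho * C i 0 <= (A *m C) i 0) -> rho <= l.
Proof.
move=> N0 pi0 piA C0 AC; have h := dot_gt0 N0 pi0 C0.
rewrite -(ler_pM2r h).
have -> : l * (pi *m C) 0 0 = (pi *m (A *m C)) 0 0.
  by rewrite mulmxA piA -scalemxAl [RHS]mxE.
rewrite mxE [in leRHS]mxE mulr_sumr; apply: ler_sum => i _.
by rewrite mulrCA ler_pM2l.
Qed.

(* Replacing row [i0] of [X - A] by [pi] divides the characteristic polynomial
   by [X - l], up to a constant; the quotient does not vanish at [l]. *)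
Lemma PF_simple A (l : R) pi C : (0 < N)%N -> primitive_mx A ->
  (forall i, 0 < pi 0 i) -> (forall i, 0 < C i 0) ->
  pi *m A = l *: pi -> A *m C = l *: C -> mup l (char_poly A) = 1%N.
Proof.
move=> N0 pA pi0 C0 piA AC; pose i0 := Ordinal N0.
pose Q : 'M[R]_N := \matrix_i (if i == i0 then pi else delta_mx 0 i).
pose M' : 'M[{poly R}]_N :=
  \matrix_i (if i == i0 then map_mx polyC pi else row i (char_poly_mx A)).
have detQ : \det Q != 0.
  apply/det0P => -[r rn0 rQ]; case/negP: rn0; apply/eqP.
  have r0 : r 0 i0 = 0.
    have := congr1 (fun M : 'rV[R]_N => M 0 i0) rQ.
    rewrite mxE (bigD1 i0)//= big1 => [|i /negPf ni]; last first.
      by rewrite !mxE ni mxE eqxx/= eq_sym ni mulr0.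
    rewrite !mxE eqxx addr0 => /eqP; rewrite mulf_eq0 (gt_eqF (pi0 i0)) orbF.
    by move/eqP.
  apply/rowP => j; have := congr1 (fun M : 'rV[R]_N => M 0 j) rQ.
  have [-> _|nj] := eqVneq j i0; first by rewrite r0 mxE.
  rewrite mxE (bigD1 j)//= big1 => [|i /negPf ni]; last first.
    rewrite !mxE; have [->|_] := eqVneq i i0; first by rewrite r0 mul0r.
    by rewrite mxE eqxx/= eq_sym ni mulr0.
  by rewrite !mxE (negPf nj) mxE !eqxx mulr1 addr0.
(* A row [r] killed by [M'] at [l] is killed after pairing with [C] except for its [pi] part, so
   [r 0 i0] vanishes. Then [r] is a left eigenvector, a multiple of [pi] with a zero coordinate,
   hence zero. *)
have rM' : ~~ root (\det M') l.
  rewrite /root -horner_evalE -det_map_mx; apply/det0P => -[r rn0 rM].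
  have rE : r 0 i0 *: pi + (\row_i (if i == i0 then 0 else r 0 i)) *m (l%:M - A) = 0.
    rewrite -[RHS]rM; apply/rowP => j; rewrite !mxE.
    rewrite [RHS](bigD1 i0)//= [X in _ + X](bigD1 i0)//= !mxE !eqxx mul0r add0r.
    rewrite horner_evalE hornerC; congr (_ + _).
    apply: eq_bigr => i /negPf ni; rewrite !mxE ni !mxE horner_evalE.
    by rewrite hornerD hornerN hornerMn hornerX hornerC.
  have r0 : r 0 i0 = 0.
    have := congr1 (fun M => (M *m C) 0 0) rE.
    rewrite mulmxDl -mulmxA mulmxBl AC mul_scalar_mx subrr mulmx0 addr0 mul0mx.
    rewrite -scalemxAl mxE [in RHS]mxE => /eqP; rewrite mulf_eq0.
    by rewrite (gt_eqF (dot_gt0 N0 pi0 C0)) orbF => /eqP.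
  have rA : r *m A = l *: r.
    move: rE; rewrite r0 scale0r add0r.
    have -> : (\row_i (if i == i0 then 0 else r 0 i)) = r.
      by apply/rowP => i; rewrite mxE; case: eqVneq => [->|].
    by rewrite mulmxBr mul_mx_scalar => /eqP; rewrite subr_eq0 => /eqP.
  have [c rc] := left_eigen_unique N0 pA pi0 piA rA.
  case/negP: rn0; rewrite rc; move: r0; rewrite rc mxE => /eqP.
  by rewrite mulf_eq0 (gt_eqF (pi0 i0)) orbF => /eqP ->; rewrite scale0r.
(* Row [i0] of [Q] times X - A is (X - l) pi because [pi] is a left eigenvector; the other rows are
   those of [M']. *)
have E : (\det Q)%:P * char_poly A = ('X - l%:P) * \det M'.
  rewrite /char_poly -det_map_mx -det_mulmx.
  have rowE' i : row i (map_mx polyC Q *m char_poly_mx A) =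
      if i == i0 then ('X - l%:P) *: map_mx polyC pi else row i (char_poly_mx A).
    rewrite row_mul -map_row rowK; case: eqP => _.
      rewrite /char_poly_mx mulmxBr -map_mxM piA mul_mx_scalar scalerBl.
      by rewrite map_mxZ.
    by rewrite map_delta_mx -rowE.
  have row'M : row' i0 M' = row' i0 (map_mx polyC Q *m char_poly_mx A).
    apply/row_matrixP => i; rewrite !row'Esub !row_rowsub rowE' rowK.
    by rewrite eq_sym (negPf (neq_lift _ _)).
  rewrite (@determinant_multilinear _ _ _ M' M' i0 ('X - l%:P) 0) ?row'M//.
    by rewrite mul0r addr0.
  by rewrite rowE' eqxx rowK eqxx scale0r addr0.
have ch0 : char_poly A != 0 by rewrite monic_neq0// char_poly_monic.
have dP : ~~ root (\det Q)%:P l by rewrite rootC.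
rewrite -(mupMr _ dP) E (mupMl _ rM').
by have := mup_XsubCX 1 l l; rewrite expr1 eqxx.
Qed.

End PF2.

Section PF3.
Variables (R : realType) (N : nat).
Implicit Types (A B : 'M[R]_N) (v r pi : 'rV[R]_N) (C : 'cV[R]_N).

Local Notation toC := (real_complex R).

Lemma real_complex_ge0 (x : R) : (0 <= toC x) = (0 <= x).
Proof. exact: (lecR 0 x). Qed.

Lemma exp_nneg A m : nneg_mx A -> nneg_mx (A ^+ m).
Proof.
move=> A0; elim: m => [|m IH] i j; first by rewrite expr0 mxE ler0n.
rewrite exprS -mulmxE mxE; apply: sumr_ge0 => k _.
by rewrite mulr_ge0// ?A0 ?IH.
Qed.

(** The moduli [r] of a complex eigenvector [w] satisfy |z| r <= r A, and pairing with [C] gives |z|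
    <= l. If |z| = l, then [r] is an eigenvector, so all triangle inequalities are equalities, [w]
    has a constant phase, and z = l. *)
Lemma PF_dominant A (l : R) pi C : (0 < N)%N -> nneg_mx A -> primitive_mx A ->
  0 < l -> (forall i, 0 < pi 0 i) -> (forall i, 0 < C i 0) ->
  pi *m A = l *: pi -> A *m C = l *: C -> dominant_eigenvalue A l.
Proof.
move=> N0 A0 pA l0 pi0 C0 piA AC; split => //.
- apply/eigenvalueP; exists pi => //; apply/rV0Pn.
  by exists (Ordinal N0); rewrite gt_eqF.
- exact: (PF_simple N0 pA pi0 C0).
move=> z /eigenvalueP[w wA wn0] zl.
pose r : 'rV[R]_N := \row_i complex.Re `|w 0 i|.
have rE i : `|w 0 i| = toC (r 0 i) by rewrite mxE RRe_real.
have r0 i : 0 <= r 0 i by rewrite -real_complex_ge0 -rE.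
pose zeta := complex.Re `|z|.
have zE : `|z| = toC zeta by rewrite RRe_real.
have rn0 : r != 0.
  case/rV0Pn: wn0 => i wi; apply/rV0Pn; exists i; apply: contra wi => /eqP ri.
  by rewrite -normr_eq0 rE ri.
have sub j : zeta * r 0 j <= (r *m A) 0 j.
  rewrite -lecR rmorphM/= -rE -zE -normrM.
  have -> : z * w 0 j = (z *: w) 0 j by rewrite mxE.
  rewrite -wA mxE; apply: le_trans (ler_norm_sum _ _ _) _.
  rewrite mxE rmorph_sum/=; apply: ler_sum => i _.
  by rewrite rmorphM/= normrM -rE [map_mx _ _ _ _]mxE [X in _ * X]ger0_norm// real_complex_ge0.
have rC : 0 < (r *m C) 0 0.
  case/rV0Pn: rn0 => i ri; rewrite mxE (bigD1 i)//= ltr_pwDl//.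
    by rewrite mulr_gt0// lt_def ri r0.
  by apply: sumr_ge0 => k _; rewrite mulr_ge0// ltW.
have rAC : ((r *m A) *m C) 0 0 = l * (r *m C) 0 0.
  by rewrite -mulmxA AC -scalemxAr mxE.
have zetal : zeta <= l.
  rewrite -(ler_pM2r rC) -rAC mxE mulr_sumr [leRHS]mxE; apply: ler_sum => i _.
  by rewrite mulrA ler_pM2r.
rewrite zE ltcR lt_def zetal andbT eq_sym; apply/negP => /eqP zetaE.
move/negP: zl; apply; apply/eqP.
have rA : r *m A = l *: r.
  have h : \sum_i ((r *m A) 0 i - l * r 0 i) * C i 0 = 0.
    under eq_bigr do rewrite mulrBl.
    rewrite sumrB; apply/eqP; rewrite subr_eq0; apply/eqP.
    move: rAC; rewrite mxE => ->; rewrite mxE mulr_sumr.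
    by apply: eq_bigr => i _; rewrite mulrA.
  apply/rowP => j; rewrite [RHS]mxE; apply/eqP; rewrite -subr_eq0.
  have /psumr_eq0P : forall i : 'I_N, true -> 0 <= ((r *m A) 0 i - l * r 0 i) * C i 0.
    by move=> i _; rewrite mulr_ge0 ?(ltW (C0 _))// subr_ge0 -zetaE.
  move=> /(_ h j isT) /eqP; rewrite mulf_eq0 (gt_eqF (C0 j)) orbF.
  by [].
have [c rc] := left_eigen_unique N0 pA pi0 piA rA.
have rpos i : 0 < r 0 i.
  rewrite lt_def r0 andbT; apply: contra rn0 => /eqP; rewrite rc mxE => /eqP.
  by rewrite mulf_eq0 (gt_eqF (pi0 i)) orbF => /eqP ->; rewrite scale0r.
case: pA => m Am.
pose Ac := map_mx toC A.
have wAm : w *m Ac ^+ m.+1 = z ^+ m.+1 *: w.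
  elim: (m.+1) => [|n IH]; first by rewrite !expr0 mulmx1 scale1r.
  by rewrite exprS -[Ac * _]/(Ac *m _) mulmxA wA -scalemxAl IH scalerA exprS.
have AcE : Ac ^+ m.+1 = map_mx toC (A ^+ m.+1) by rewrite rmorphXn.
pose j0 := Ordinal N0.
(* Equality in the triangle inequality for column [j0] of w A^(m+1). The entries of this column are
   positive, so all coordinates of [w] share the phase [t] found below. *)
have sumE : `|\sum_i w 0 i * toC ((A ^+ m.+1) i j0)| =
    \sum_i `|w 0 i * toC ((A ^+ m.+1) i j0)|.
  have -> : \sum_i w 0 i * toC ((A ^+ m.+1) i j0) = z ^+ m.+1 * w 0 j0.
    have := congr1 (fun M : 'rV[R[i]]_N => M 0 j0) wAm.
    rewrite AcE [in X in _ = X -> _]mxE => <-; rewrite [RHS]mxE.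
    by apply: eq_bigr => i _; rewrite [map_mx _ _ _ _]mxE.
  rewrite normrM normrX zE zetaE rE -rmorphXn -rmorphM/=.
  have -> : l ^+ m.+1 * r 0 j0 = (r *m A ^+ m.+1) 0 j0.
    by rewrite (eigen_exp _ rA) [RHS]mxE.
  rewrite mxE rmorph_sum/=; apply: eq_bigr => i _.
  by rewrite normrM rE rmorphM/= [X in _ = _ * X]ger0_norm// real_complex_ge0 ltW.
have [t _ tE] := normC_sum_eq sumE.
have wE i : w 0 i = toC (r 0 i) * t.
  have := tE i isT; rewrite normrM rE [X in _ * X * t]ger0_norm; last first.
    by rewrite real_complex_ge0 ltW.
  rewrite mulrAC => /mulIf; apply.
  by rewrite fmorph_eq0 gt_eqF.
have w0 : w 0 j0 != 0 by rewrite -normr_eq0 rE fmorph_eq0 gt_eqF.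
apply: (mulIf w0).
have := congr1 (fun M : 'rV[R[i]]_N => M 0 j0) wA; rewrite [RHS]mxE => <-.
rewrite mxE.
have -> : toC l * w 0 j0 = toC ((r *m A) 0 j0) * t.
  by rewrite wE mulrA -rmorphM rA /= [in RHS]mxE.
rewrite mxE rmorph_sum/= mulr_suml; apply: eq_bigr => i _.
by rewrite wE [map_mx _ _ _ _]mxE rmorphM/= mulrAC.
Qed.

Lemma dominant_unique A (l l' : R) :
  dominant_eigenvalue A l -> dominant_eigenvalue A l' -> l = l'.
Proof.
move=> [l0 e1 _ h1] [l0' e2 _ h2]; apply/eqP/negPn/negP => ne.
have em (x : R) : eigenvalue A x -> eigenvalue (map_mx toC A) (toC x).
  move=> /eigenvalueP[v vA vn0]; apply/eigenvalueP; exists (map_mx toC v).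
    by rewrite -map_mxM vA map_mxZ.
  by rewrite map_mx_eq0.
have := h1 _ (em _ e2); have := h2 _ (em _ e1).
rewrite !(inj_eq (fmorph_inj _)) ne eq_sym ne => /(_ isT) + /(_ isT).
rewrite !ger0_norm ?real_complex_ge0 ?ltW// !ltcR => h h'.
by have := lt_trans h h'; rewrite ltxx.
Qed.
End PF3.

(** * First-order perturbation of the Perron-Frobenius eigenvector *)

Section Perturb.
Variables (R : realType) (N : nat).
Implicit Types (A B : 'M[R]_N) (v r pi : 'rV[R]_N) (C g : 'cV[R]_N).

Lemma primitive_exp A m : primitive_mx A -> (0 < m)%N -> primitive_mx (A ^+ m).
Proof.
case: m => // m [k Ak] _; exists k => i j; rewrite -exprM mulnC exprM.
elim: m i j => [|m IH] i j; first by rewrite expr1.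
rewrite exprS -mulmxE mxE (bigD1 i)//= ltr_pwDl ?mulr_gt0//.
by apply: sumr_ge0 => l _; rewrite ltW ?mulr_gt0.
Qed.

(** Fredholm's alternative: the columns of the cokernel of (1 - A)^T are left fixed vectors of [A],
    hence multiples of [pi], and these annihilate [b]. *)
Lemma Fredholm_solution A pi (b : 'cV[R]_N) :
  (forall r, r *m A = r -> exists c, r = c *: pi) -> pi *m b = 0 ->
  exists g, g - A *m g = b.
Proof.
move=> uniq pib.
have : (b^T <= (1%:M - A)^T)%MS.
  rewrite submxE; apply/eqP/matrixP => i j; rewrite [RHS]mxE.
  pose y := (col j (cokermx (1%:M - A)^T))^T.
  have yA : y *m A = y.
    have := mulmx_coker (1%:M - A)^T.
    move=> /(congr1 (fun M => (col j M)^T)).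
    rewrite colE -mulmxA -colE trmx_mul trmxK -/y mulmxBr mulmx1 col0 trmx0 => /eqP.
    by rewrite subr_eq0 => /eqP.
  have [c yc] := uniq _ yA.
  have : col j (b^T *m cokermx (1%:M - A)^T) = 0.
    by rewrite colE -mulmxA -colE -[col _ _]trmxK -/y yc -trmx_mul -scalemxAl pib scaler0 trmx0.
  by move=> /(congr1 (fun M : 'cV_1 => M i 0)); rewrite !mxE.
move=> /submxP[D /(congr1 trmx)]; rewrite trmxK trmx_mul trmxK => ->.
by exists D^T; rewrite mulmxBl mul1mx.
Qed.

(* The first-order corrector [g] solves [g - A g = B C - (pi B C) C]. *)
Lemma eigen_perturb A B pi C : (0 < N)%N ->
  (forall r, r *m A = r -> exists c, r = c *: pi) ->
  A *m C = C -> (forall i, 0 < C i 0) -> (pi *m C) 0 0 = 1 ->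
  let m := (pi *m B *m C) 0 0 in
  exists g, forall e, 0 < e -> exists2 del, 0 < del & forall A' (t : R),
    `|t| <= del -> (forall i j, `|A' i j - A i j - t * B i j| <= del * `|t|) ->
    (forall i, 0 < (C + t *: g) i 0) /\
    forall i, (1 + t * m - e * `|t|) * (C + t *: g) i 0 <=
        (A' *m (C + t *: g)) i 0 <= (1 + t * m + e * `|t|) * (C + t *: g) i 0.
Proof.
move=> N0 uniq AC C0 piC m.
have [g gE] : exists g, g - A *m g = B *m C - m *: C.
  apply: (Fredholm_solution (pi := pi)) => //.
  rewrite mulmxBr -scalemxAr; apply/rowP => i; rewrite ord1 mxE [X in _ + X]mxE.
  by rewrite [X in - X]mxE piC mulr1 mulmxA subrr mxE.
exists g => e e0.
have [c0 c00 Cc0] := pos_lower_bound C0.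
pose K := 1 + \sum_i `|g i 0| + \sum_i `|C i 0| + \sum_i `|(B *m g) i 0 - m * g i 0|.
have K1 : 1 <= K.
  by rewrite /K -!addrA lerDl !addr_ge0//; apply: sumr_ge0.
have K0 : 0 < K by apply: lt_le_trans K1.
have bsum (f : 'I_N -> R) i : `|f i| <= \sum_j `|f j|.
  by rewrite (bigD1 i)//= lerDl; apply: sumr_ge0.
have sum0 (f : 'I_N -> R) : 0 <= \sum_j `|f j| by apply: sumr_ge0.
have gK i : `|g i 0| <= K.
  have := bsum (fun i => g i 0) i; have := sum0 (fun i => C i 0).
  by have := sum0 (fun i => (B *m g) i 0 - m * g i 0); rewrite /K; lra.
pose s := \sum_i `|C i 0| + \sum_i `|g i 0|.
have sK : s <= K.
  by have := sum0 (fun i => (B *m g) i 0 - m * g i 0); rewrite /K /s; lra.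
have hK i : `|(B *m g) i 0 - m * g i 0| <= K.
  have := bsum (fun i => (B *m g) i 0 - m * g i 0) i.
  by have := sum0 (fun i => C i 0); have := sum0 (fun i => g i 0); rewrite /K; lra.
(* The second bound keeps C + t g above c0 / 2; the third makes the two remainders below add up to
   at most e |t| c0 / 2. *)
pose del := Order.min 1 (Order.min (c0 / (2 * K)) (e * c0 / (4 * K))).
have del0 : 0 < del.
  by rewrite !lt_min ltr01 !divr_gt0 ?mulr_gt0.
have del1 : del <= 1 by rewrite ge_min lexx.
have del2 : del * K <= c0 / 2.
  have : del <= c0 / (2 * K) by rewrite /del ge_min ge_min lexx !orbT.
  by rewrite ler_pdivlMr ?mulr_gt0//; lra.
have del3 : 2 * (del * K) <= e * (c0 / 2).
  have : del <= e * c0 / (4 * K) by rewrite /del ge_min ge_min lexx !orbT.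
  by rewrite ler_pdivlMr ?mulr_gt0//; lra.
exists del => // A' t tdel hA'.
set v := C + t *: g.
have vlow i : c0 / 2 <= v i 0.
  rewrite /v mxE [X in _ + X]mxE.
  have h1 : `|t * g i 0| <= c0 / 2.
    by rewrite normrM; apply: le_trans del2; rewrite ler_pM.
  by move: h1 (Cc0 i); rewrite ler_norml => /andP[]; lra.
have v0 i : 0 < v i 0 by apply: lt_le_trans (vlow i); rewrite divr_gt0.
split => // i.
have vs : \sum_j `|v j 0| <= K.
  apply: le_trans sK; rewrite /s -big_split/=; apply: ler_sum => j _.
  rewrite /v mxE [X in _ + X]mxE (le_trans (ler_normD _ _))// lerD2l normrM.
  by rewrite ler_piMl// (le_trans tdel).
pose D := A' - A - t *: B.
(* By the choice of [g] the terms of order t are exactly those of (1 + t m) v; what remains is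
   quadratic in t or comes from the defect [D] of [A']. *)
have E : (A' *m v) i 0 = (1 + t * m) * v i 0 +
    (t ^+ 2 * ((B *m g) i 0 - m * g i 0) + (D *m v) i 0).
  have -> : A' = A + t *: B + D by apply/matrixP => a b; rewrite !mxE; ring.
  have mxD (X Y : 'cV[R]_N) : (X + Y) i 0 = X i 0 + Y i 0 by rewrite mxE.
  have mxN (X : 'cV[R]_N) : (- X) i 0 = - X i 0 by rewrite mxE.
  have mxZ x (X : 'cV[R]_N) : (x *: X) i 0 = x * X i 0 by rewrite mxE.
  have /(congr1 (fun M : 'cV[R]_N => M i 0)) := gE.
  rewrite !mulmxDl !mxD addrA mxN mxN mxZ -scalemxAl mxZ.
  rewrite /v !mulmxDr AC -!scalemxAr !mxD !mxZ => /eqP.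
  by rewrite subr_eq => /eqP ->; ring.
have Db : `|(D *m v) i 0| <= del * `|t| * K.
  rewrite mxE (le_trans (ler_norm_sum _ _ _))//.
  rewrite (@le_trans _ _ (del * `|t| * \sum_j `|v j 0|))//.
    rewrite mulr_sumr; apply: ler_sum => j _; rewrite normrM ler_wpM2r//.
    by rewrite /D !mxE; apply: hA'.
  by rewrite ler_wpM2l// mulr_ge0// ltW.
have tb : `|t ^+ 2 * ((B *m g) i 0 - m * g i 0)| <= del * `|t| * K.
  by rewrite normrM normrX expr2 ler_pM ?mulr_ge0// ler_wpM2r.
have b : `|t ^+ 2 * ((B *m g) i 0 - m * g i 0) + (D *m v) i 0| <= e * `|t| * v i 0.
  rewrite (le_trans (ler_normD _ _))// (le_trans (lerD tb Db))//.
  rewrite (@le_trans _ _ (e * `|t| * (c0 / 2)))//.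
    rewrite (_ : _ + _ = `|t| * (2 * (del * K))); last by ring.
    by rewrite mulrAC [leRHS]mulrC ler_wpM2l.
  by rewrite ler_wpM2l// mulr_ge0// ltW.
move: b; rewrite ler_norml E => /andP[]; rewrite !mulrDl mulNr.
by move=> h1 h2; apply/andP; split; lra.
Qed.

End Perturb.

(** * Signed sums over a discrete set *)

Section EsumScale.
Variables (R : realType) (T : choiceType).
Local Open Scope ereal_scope.

Lemma esum_ge1 (a : T -> \bar R) x : (forall x, 0 <= a x) ->
  a x <= \esum_(y in [set: T]) a y.
Proof.
by move=> a0; apply: esum_ge; exists [set x]; [split|rewrite fsbig_set1].
Qed.

(** The factor may be +oo, as happens for values of convolution powers; this case is treated
    separately at the end. *)
Lemma esumZ (c : \bar R) (a : T -> \bar R) : 0 <= c -> (forall x, 0 <= a x) ->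
  \esum_(x in [set: T]) (c * a x) = c * \esum_(x in [set: T]) a x.
Proof.
move=> c0 a0.
have a0' : 0 <= \esum_(x in [set: T]) a x by exact: esum_ge0.
have le_ (r : R) (b : T -> \bar R) : (0 <= r)%R -> (forall x, 0 <= b x) ->
    \esum_(x in [set: T]) (r%:E * b x) <= r%:E * \esum_(x in [set: T]) b x.
  move=> r0 b0; apply: ge_ereal_sup => _ [X [finX _] <-].
  rewrite fsbig_finite//= -ge0_sume_distrr; last by move=> i _.
  rewrite -fsbig_finite//; apply: lee_wpmul2l; rewrite ?lee_fin//.
  by apply: ereal_sup_ubound; exists X.
move: c c0 => [c| |//] c0.
  move: c0; rewrite lee_fin le_eqVlt => /predU1P[<-|c0].
    by rewrite mul0e esum1// => i _; rewrite mul0e.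
  apply/eqP; rewrite eq_le le_ ?(ltW c0)//=.
  rewrite -lee_pdivlMl//.
  apply: le_trans (le_ _ _ _ _); last 2 first.
  - by rewrite invr_ge0 ltW.
  - by move=> x; rewrite mule_ge0// lee_fin ltW.
  by apply: le_esum => x _; rewrite muleA -EFinM mulVf ?gt_eqF// mul1e.
have [h|/existsNP[x ax]] := pselect (forall x, a x = 0).
  rewrite esum1 => [|i _]; last by rewrite h mule0.
  by rewrite esum1 ?mule0.
have axp : 0 < a x by rewrite lt_def a0 andbT; exact/eqP.
rewrite gt0_mulye; last by apply: lt_le_trans axp _; exact: esum_ge1.
apply/eqP; rewrite -leye_eq.
apply: le_trans (@esum_ge1 (fun x => +oo * a x) x _); first by rewrite gt0_mulye.
by move=> y; rewrite mule_ge0.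
Qed.
End EsumScale.

Section SignedSum.
Variables (R : realType) (T : choiceType).
Implicit Types f g h : T -> R.

Definition psum f : \bar R := (\esum_(x in [set: T]) (f x)%:E)%E.
Definition absum f : Prop := (psum (fun x => `|f x|%R) < +oo)%E.
(** Meaningful under [absum] only, since [fine] sends an infinite part to 0. *)
Definition rsum f : R :=
  fine (psum (funrpos f)) - fine (psum (funrneg f)).

Lemma psum_ge0 f : (forall x, 0 <= f x) -> (0 <= psum f)%E.
Proof. by move=> f0; apply: esum_ge0 => x _; rewrite lee_fin. Qed.

Lemma psum_le f g : (forall x, f x <= g x) -> (psum f <= psum g)%E.
Proof. by move=> fg; apply: le_esum => x _; rewrite lee_fin. Qed.

Lemma psumD f g : (forall x, 0 <= f x) -> (forall x, 0 <= g x) ->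
  psum (fun x => f x + g x) = (psum f + psum g)%E.
Proof. by move=> f0 g0; rewrite -esumD// => x _; rewrite lee_fin. Qed.

Lemma psumZ c f : 0 <= c -> (forall x, 0 <= f x) ->
  psum (fun x => c * f x) = (c%:E * psum f)%E.
Proof. by move=> c0 f0; rewrite -esumZ ?lee_fin// => x; rewrite lee_fin. Qed.

Lemma psum_fin f : (forall x, 0 <= f x) -> (psum f < +oo)%E ->
  psum f = (fine (psum f))%:E.
Proof. by move=> f0 fo; rewrite fineK// ge0_fin_numE// psum_ge0. Qed.

Lemma absum_le f g : (forall x, `|f x| <= g x) -> (psum g < +oo)%E -> absum f.
Proof. by move=> fg; apply: le_lt_trans; exact: psum_le. Qed.

Lemma absum_ge0 f : (forall x, 0 <= f x) -> absum f = (psum f < +oo)%E :> Prop.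
Proof.
move=> f0; rewrite /absum; have -> // : (fun x => `|f x|) = f.
by apply/funext => x; rewrite ger0_norm.
Qed.

Lemma absumD f g : absum f -> absum g -> absum (fun x => f x + g x).
Proof.
move=> af ag; apply: (absum_le (g := fun x => `|f x| + `|g x|)) => [x|].
  exact: ler_normD.
by rewrite psumD// lte_add_pinfty.
Qed.

Lemma absumZ c f : absum f -> absum (fun x => c * f x).
Proof.
move=> af; rewrite /absum (_ : (fun _ => _) = (fun x => `|c| * `|f x|)); last first.
  by apply/funext => x; rewrite normrM.
by rewrite psumZ// lte_mul_pinfty// lee_fin.
Qed.

(** Every splitting into nonnegative summable parts computes the sum, by cross-adding it with the
    splitting into positive and negative parts. Additivity then requires no knowledge of the signs
    of a sum. *)
Lemma rsumE f g h : (forall x, 0 <= g x) -> (forall x, 0 <= h x) ->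
  (psum g < +oo)%E -> (psum h < +oo)%E -> (forall x, f x = g x - h x) ->
  rsum f = fine (psum g) - fine (psum h).
Proof.
move=> g0 h0 gf hf fE.
have p0 x : 0 <= funrpos f x by rewrite le_max lexx orbT.
have n0 x : 0 <= funrneg f x by rewrite le_max lexx orbT.
have pf : (psum (funrpos f) < +oo)%E.
  apply: le_lt_trans gf; apply: psum_le => x.
  by rewrite ge_max g0 fE lerBlDr lerDl h0.
have nf : (psum (funrneg f) < +oo)%E.
  apply: le_lt_trans hf; apply: psum_le => x.
  by rewrite ge_max h0 fE opprB lerBlDr lerDl g0.
have : (psum (funrpos f) + psum h =
        psum (funrneg f) + psum g)%E.
  rewrite -!psumD//; congr psum; apply/funext => x.
  have := fE x; rewrite /funrpos/funrneg; case: (leP (f x) 0) => fx.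
    by rewrite max_l ?oppr_ge0// add0r => ->; rewrite opprB subrK.
  by rewrite max_r ?oppr_le0 ?ltW// add0r => ->; rewrite subrK.
rewrite (psum_fin p0)// (psum_fin h0)// (psum_fin n0)// (psum_fin g0)//.
by rewrite -!EFinD => -[]; rewrite /rsum => e; lra.
Qed.

Lemma rsum_ge0E f : (forall x, 0 <= f x) -> (psum f < +oo)%E ->
  rsum f = fine (psum f).
Proof.
move=> f0 ff.
have z : psum (fun=> 0 : R) = 0%E by apply: esum1.
by rewrite (rsumE (g := f) (h := fun=> 0)) ?z ?subr0// => x; rewrite subr0.
Qed.

Lemma absum_pos f : absum f -> (psum (funrpos f) < +oo)%E.
Proof.
by apply: le_lt_trans; apply: psum_le => x; rewrite ge_max normr_ge0 ler_norm.
Qed.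

Lemma absum_neg f : absum f -> (psum (funrneg f) < +oo)%E.
Proof.
apply: le_lt_trans; apply: psum_le => x.
by rewrite ge_max normr_ge0 -normrN ler_norm.
Qed.

Lemma funrposBneg f x : f x = funrpos f x - funrneg f x.
Proof.
rewrite /funrpos /funrneg; case: (leP (f x) 0) => h.
  by rewrite max_l ?oppr_ge0// sub0r opprK.
by rewrite max_r ?subr0// oppr_le0 ltW.
Qed.

Lemma rsumD f g : absum f -> absum g ->
  rsum (fun x => f x + g x) = rsum f + rsum g.
Proof.
move=> af ag.
have p0 (h : T -> R) x : 0 <= funrpos h x by rewrite le_max lexx orbT.
have n0 (h : T -> R) x : 0 <= funrneg h x by rewrite le_max lexx orbT.
have /psum_fin Pf := absum_pos af; have /psum_fin Nf := absum_neg af.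
have /psum_fin Pg := absum_pos ag; have /psum_fin Ng := absum_neg ag.
rewrite (rsumE (g := fun x => funrpos f x + funrpos g x)
               (h := fun x => funrneg f x + funrneg g x)).
- rewrite !psumD// Pf// Nf// Pg// Ng// -!EFinD /= /rsum; ring.
- by move=> x; rewrite addr_ge0.
- by move=> x; rewrite addr_ge0.
- by rewrite psumD// lte_add_pinfty ?absum_pos.
- by rewrite psumD// lte_add_pinfty ?absum_neg.
- by move=> x; rewrite {1}(funrposBneg f x) {1}(funrposBneg g x); ring.
Qed.

Lemma rsumZ c f : absum f -> rsum (fun x => c * f x) = c * rsum f.
Proof.
move=> af.
have p0 (h : T -> R) x : 0 <= funrpos h x by rewrite le_max lexx orbT.
have n0 (h : T -> R) x : 0 <= funrneg h x by rewrite le_max lexx orbT.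
have /psum_fin Pf := absum_pos af; have /psum_fin Nf := absum_neg af.
have [c0|/ltW c0] := leP 0 c.
  rewrite (rsumE (g := fun x => c * funrpos f x)
                 (h := fun x => c * funrneg f x)).
  - by rewrite !psumZ// Pf// Nf// -!EFinM /= /rsum; ring.
  - by move=> x; rewrite mulr_ge0.
  - by move=> x; rewrite mulr_ge0.
  - by rewrite psumZ// lte_mul_pinfty ?lee_fin// absum_pos.
  - by rewrite psumZ// lte_mul_pinfty ?lee_fin// absum_neg.
  - by move=> x; rewrite {1}(funrposBneg f x); ring.
have c0' : 0 <= - c by rewrite oppr_ge0.
rewrite (rsumE (g := fun x => - c * funrneg f x)
               (h := fun x => - c * funrpos f x)).
- by rewrite !psumZ// Pf// Nf// -!EFinM /= /rsum; ring.
- by move=> x; rewrite mulr_ge0.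
- by move=> x; rewrite mulr_ge0.
- by rewrite psumZ// lte_mul_pinfty ?lee_fin// absum_neg.
- by rewrite psumZ// lte_mul_pinfty ?lee_fin// absum_pos.
- by move=> x; rewrite {1}(funrposBneg f x); ring.
Qed.

Lemma le_rsum f g : absum f -> absum g -> (forall x, f x <= g x) ->
  rsum f <= rsum g.
Proof.
move=> af ag fg.
have ad : absum (fun x => g x + -1 * f x) by apply: absumD => //; exact: absumZ.
have d0 x : 0 <= g x + -1 * f x by rewrite mulN1r subr_ge0.
have : 0 <= rsum (fun x => g x + -1 * f x).
  rewrite rsum_ge0E//; first by rewrite fine_ge0// psum_ge0.
  by rewrite -absum_ge0.
by rewrite rsumD// ?rsumZ//; [lra|exact: absumZ].
Qed.

Lemma rsum_norm f : absum f -> `|rsum f| <= rsum (fun x => `|f x|).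
Proof.
move=> af; have aa : absum (fun x => `|f x|) by rewrite absum_ge0.
rewrite ler_norml le_rsum ?andbT//; last by move=> x; exact: ler_norm.
rewrite -mulN1r -rsumZ// le_rsum//; first exact: absumZ.
by move=> x; rewrite mulN1r lerNl -normrN ler_norm.
Qed.

Lemma absum_sum (I : Type) (s : seq I) (F : I -> T -> R) :
  (forall i, absum (F i)) -> absum (fun x => \sum_(i <- s) F i x).
Proof.
move=> aF; elim: s => [|i s IH].
  rewrite absum_ge0 => [|x]; last by rewrite big_nil.
  by rewrite /psum esum1 ?ltry// => x _; rewrite big_nil.
rewrite (_ : (fun _ => _) = (fun x => F i x + \sum_(i <- s) F i x)); last first.
  by apply/funext => x; rewrite big_cons.
exact: absumD.
Qed.

Lemma rsum_sum (I : Type) (s : seq I) (F : I -> T -> R) :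
  (forall i, absum (F i)) ->
  rsum (fun x => \sum_(i <- s) F i x) = \sum_(i <- s) rsum (F i).
Proof.
move=> aF; elim: s => [|i s IH].
  rewrite big_nil rsum_ge0E => [|x|]; rewrite /psum ?big_nil//.
    by rewrite esum1// => x _; rewrite big_nil.
  by rewrite esum1 ?ltry// => x _; rewrite big_nil.
rewrite big_cons -IH -rsumD//; last exact: absum_sum.
by congr rsum; apply/funext => x; rewrite big_cons.
Qed.

End SignedSum.

(** * The Laplace transform of the kernel *)

Section Dot.
Variables (R : realType) (d : nat).
Implicit Types u v w : 'rV[R]_d.

Lemma dotDl u v w : dot (u + v) w = dot u w + dot v w.
Proof. by rewrite /dot -big_split/=; apply: eq_bigr => i _; rewrite mxE mulrDl. Qed.

Lemma dotZl a u v : dot (a *: u) v = a * dot u v.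
Proof. by rewrite /dot mulr_sumr; apply: eq_bigr => i _; rewrite mxE mulrA. Qed.

Lemma dotNl u v : dot (- u) v = - dot u v.
Proof. by rewrite -scaleN1r dotZl mulN1r. Qed.

Lemma dotBl u v w : dot (u - v) w = dot u w - dot v w.
Proof. by rewrite dotDl dotNl. Qed.

Lemma dotC u v : dot u v = dot v u.
Proof. by apply: eq_bigr => i _; rewrite mulrC. Qed.

Lemma dotDr u v w : dot u (v + w) = dot u v + dot u w.
Proof. by rewrite dotC dotDl ![dot _ u]dotC. Qed.

Lemma dotZr a u v : dot u (a *: v) = a * dot u v.
Proof. by rewrite dotC dotZl dotC. Qed.

Lemma dotBr u v w : dot u (v - w) = dot u v - dot u w.
Proof. by rewrite dotC dotBl ![dot _ u]dotC. Qed.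

Lemma dot0r u : dot u 0 = 0.
Proof. by rewrite /dot big1// => i _; rewrite mxE mulr0. Qed.

Lemma of_latticeD (x y : 'rV[int]_d) :
  of_lattice R (x + y) = of_lattice R x + of_lattice R y.
Proof. by apply/rowP => i; rewrite !mxE rmorphD. Qed.

Lemma of_latticeB (x y : 'rV[int]_d) :
  of_lattice R (x - y) = of_lattice R x - of_lattice R y.
Proof. by apply/rowP => i; rewrite !mxE rmorphB. Qed.

Lemma of_lattice0 : of_lattice R (0 : 'rV[int]_d) = 0.
Proof. by apply/rowP => i; rewrite !mxE. Qed.

End Dot.

Section ExpBounds.
Variable R : realType.
Implicit Types z t r : R.

Lemma expR_norm_le z : expR `|z| <= expR z + expR (- z).
Proof.
by case: (ger0P z) => _; [rewrite lerDl|rewrite lerDr]; exact: expR_ge0.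
Qed.

Lemma norm_le_expR z : `|z| <= expR z + expR (- z).
Proof.
by rewrite (le_trans _ (expR_norm_le z))// (le_trans _ (expR_ge1Dx _))// lerDr.
Qed.

Lemma expR_taylor1 z : 0 <= expR z - 1 - z <= z ^+ 2 * expR `|z|.
Proof.
apply/andP; split; first by have := expR_ge1Dx z; lra.
have h : expR z - 1 <= z * expR z.
  have := expR_ge1Dx (- z); rewrite -(ler_pM2r (expR_gt0 z)).
  by rewrite [leRHS]mulrC expRxMexpNx_1; lra.
have h1 : expR z - 1 - z <= z * (expR z - 1) by lra.
have h2 := expR_ge1Dx z.
apply: le_trans h1 _; rewrite expr2 -mulrA.
case: (ger0P z) => z0; first by rewrite ler_wpM2l.
have e1 : 1 <= expR (- z) by rewrite -expR0 ler_expR oppr_ge0 ltW.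
have h3 : z * expR (- z) <= expR z - 1 by nra.
by rewrite ler_wnM2l// ltW.
Qed.

Lemma sqr_le_expR z : 0 <= z -> z ^+ 2 <= 4 * expR z.
Proof.
move=> z0; have -> : expR z = expR (z / 2) ^+ 2.
  by rewrite expr2 -expRD -splitr.
have := expR_ge1Dx (z / 2) => h.
have h2 : (z / 2) ^+ 2 <= expR (z / 2) ^+ 2.
  by rewrite ler_sqr ?nnegrE ?expR_ge0 ?divr_ge0//; lra.
by rewrite expr_div_n in h2; lra.
Qed.

End ExpBounds.

Section Laplace.
Variables (R : realType) (d N : nat) (p : kernel_on R d N).
Hypothesis p0 : forall k j x y, 0 <= p k j x y.
Implicit Types (u v w : 'rV[R]_d) (x : 'rV[int]_d).

Definition Fterm u k j x := p k j 0 x * expR (dot u (of_lattice R x)).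

Lemma Fterm_ge0 u k j x : 0 <= Fterm u k j x.
Proof. by rewrite mulr_ge0// expR_ge0. Qed.

Lemma Fdom_fin u k j : Fdom p u -> (psum (Fterm u k j) < +oo)%E.
Proof. by move=> /interior_subset; exact. Qed.

Lemma Fmx_ge0 u k j : 0 <= Fmx p u k j.
Proof. by rewrite mxE fine_ge0// psum_ge0// => x; exact: Fterm_ge0. Qed.

Lemma Fdom_line u w : Fdom p u ->
  exists2 r, 0 < r & forall t, `|t| < r -> Fdom p (u + t *: w).
Proof.
move=> uF.
have cvg : (u + t *: w) @[t --> (0 : R)] --> u.
  have {2}-> : u = u + 0 *: w by rewrite scale0r addr0.
  by apply: cvgD; [exact: cvg_cst|apply: cvgZr_tmp; exact: cvg_id].
have /cvg /nbhs_ballP [r r0 rh] : nbhs u (Fdom p).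
  by apply: open_nbhs_nbhs; split => //; exact: open_interior.
by exists r => // t tr; apply: rh; rewrite /ball/= sub0r normrN.
Qed.

(** The derivative of F at [u] along [w], taken under the sum; [Fmx_taylor] justifies the
    exchange. *)
Definition dF u w : 'M[R]_N :=
  \matrix_(k, j) rsum (fun x => Fterm u k j x * dot w (of_lattice R x)).

(** A linear factor is absorbed by exponentials, |z| <= e^z + e^(-z) with z = s w.x, and u + s w and
    u - s w still lie in the open domain. *)
Lemma absum_dF u w k j : Fdom p u ->
  absum (fun x => Fterm u k j x * dot w (of_lattice R x)).
Proof.
move=> uF; have [r r0 rF] := Fdom_line w uF.
pose s := r / 2.
have s0 : 0 < s by rewrite divr_gt0.
have sr : `|s| < r by rewrite gtr0_norm// /s; lra.
have sr' : `|- s| < r by rewrite normrN.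
apply: (absum_le (g := fun x => s^-1 * (Fterm (u + s *: w) k j x + Fterm (u + (- s) *: w) k j x))).
  move=> x; rewrite normrM ger0_norm ?Fterm_ge0// /Fterm !dotDl !dotZl !expRD.
  rewrite mulNr -mulrA -mulrDr -mulrDr [s^-1 * _]mulrCA ler_wpM2l//.
  rewrite [leRHS]mulrCA ler_wpM2l ?expR_ge0//.
  rewrite -ler_pdivrMl ?invr_gt0// invrK -{1}(gtr0_norm s0) -normrM.
  exact: norm_le_expR.
rewrite psumZ ?invr_ge0 1?ltW//; last by move=> x; rewrite addr_ge0 ?Fterm_ge0.
rewrite psumD; try by move=> x; exact: Fterm_ge0.
apply: lte_mul_pinfty; rewrite ?lee_fin ?invr_ge0 1?ltW//.
by rewrite lte_add_pinfty// Fdom_fin//; exact: rF.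
Qed.

Lemma dF_linear u w : Fdom p u ->
  dF u w = \sum_i w 0 i *: dF u (delta_mx 0 i).
Proof.
move=> uF; apply/matrixP => k j; rewrite mxE summxE.
have -> : \sum_i (w 0 i *: dF u (delta_mx 0 i)) k j = \sum_i rsum (fun x =>
    w 0 i * (Fterm u k j x * dot (delta_mx 0 i) (of_lattice R x))).
  by apply: eq_bigr => i _; rewrite !mxE rsumZ//; exact: absum_dF.
rewrite -rsum_sum; last by move=> i; apply: absumZ; exact: absum_dF.
congr rsum; apply/funext => x; rewrite {1}/dot mulr_sumr; apply: eq_bigr => i _.
rewrite mulrCA; congr (_ * (_ * _)).
rewrite /dot (bigD1 i)//= big1 ?mxE ?eqxx ?mul1r ?addr0// => l /negPf li.
by rewrite mxE eqxx li mul0r.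
Qed.

(** With tau = w.x, the remainder of the exponential is at most t^2 tau^2 e^(|t tau|). One factor
    e^(s |tau|) pays for tau^2 and another for e^(|t tau|); their product is dominated by the
    transforms at u + 2 s w and u - 2 s w, finite since 2 s < r. *)
Lemma Fmx_taylor u w : Fdom p u -> exists r K, [/\ 0 < r, 0 <= K &
  forall t, `|t| <= r -> Fdom p (u + t *: w) /\ forall k j,
   `|Fmx p (u + t *: w) k j - Fmx p u k j - t * dF u w k j| <= K * t ^+ 2].
Proof.
move=> uF; have [r r0 rF] := Fdom_line w uF.
pose s := r / 4.
have s0 : 0 < s by rewrite divr_gt0.
have sr : `|2 * s| < r by rewrite gtr0_norm /s; lra.
have sr' : `|- (2 * s)| < r by rewrite normrN.
have Fp := rF _ sr; have Fm := rF _ sr'.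
pose Q k j := fine (psum (Fterm (u + (2 * s) *: w) k j)) +
  fine (psum (Fterm (u + (- (2 * s)) *: w) k j)).
have Q0 k j : 0 <= Q k j.
  by rewrite addr_ge0// fine_ge0// psum_ge0// => x; exact: Fterm_ge0.
pose K := 4 * s^-1 ^+ 2 * \sum_k \sum_j Q k j.
exists s, K; split; [exact: s0| |move=> t ts].
  rewrite mulr_ge0 ?mulr_ge0 ?exprn_ge0 ?invr_ge0 ?(ltW s0)//.
  by apply: sumr_ge0 => k _; apply: sumr_ge0.
have tF : Fdom p (u + t *: w).
  by apply: rF; apply: le_lt_trans ts _; rewrite /s; lra.
split => // k j.
have QK : 4 * s^-1 ^+ 2 * Q k j <= K.
  rewrite ler_wpM2l ?mulr_ge0 ?exprn_ge0 ?invr_ge0 ?(ltW s0)//.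
  rewrite (bigD1 k)//= (bigD1 j)//= -addrA lerDl addr_ge0 ?sumr_ge0// => i _.
  exact: sumr_ge0.
have ab v : Fdom p v -> absum (Fterm v k j).
  by move=> vF; rewrite absum_ge0 ?Fdom_fin// => x; exact: Fterm_ge0.
have FE v : Fdom p v -> Fmx p v k j = rsum (Fterm v k j).
  by move=> vF; rewrite mxE rsum_ge0E ?Fdom_fin// => x; exact: Fterm_ge0.
rewrite (FE _ tF) (FE _ uF) mxE.
have aD := absum_dF w k j uF.
have aF : absum (fun x => -1 * Fterm u k j x) by apply: absumZ; exact: ab.
have aDt : absum (fun x => - t * (Fterm u k j x * dot w (of_lattice R x))).
  exact: absumZ.
rewrite -mulNr -rsumZ// -[- rsum _]mulN1r -rsumZ; last exact: ab.
rewrite -(rsumD (ab _ tF) aF) -(rsumD (absumD (ab _ tF) aF) aDt).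
set f := fun x : 'rV_d => _.
have af : absum f := absumD (absumD (ab _ tF) aF) aDt.
pose c := 4 * s^-1 ^+ 2 * t ^+ 2.
have c0 : 0 <= c by rewrite mulr_ge0 ?sqr_ge0// mulr_ge0 ?sqr_ge0.
have aS := absumD (ab _ Fp) (ab _ Fm).
have ag := absumZ c aS.
have gE : rsum (fun x => c * (Fterm (u + (2 * s) *: w) k j x +
     Fterm (u + (- (2 * s)) *: w) k j x)) = c * Q k j.
  rewrite (rsumZ c aS) (rsumD (ab _ Fp) (ab _ Fm)) !rsum_ge0E//.
  - by move=> x; exact: Fterm_ge0.
  - exact: (Fdom_fin k j Fm).
  - by move=> x; exact: Fterm_ge0.
  - exact: (Fdom_fin k j Fp).
apply: le_trans (rsum_norm af) _.
rewrite (@le_trans _ _ (c * Q k j))//; last first.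
  by rewrite mulrAC ler_wpM2r ?sqr_ge0.
rewrite -gE; apply: le_rsum ag _ => [|x]; first by rewrite absum_ge0.
pose tau := dot w (of_lattice R x).
have -> : f x = Fterm u k j x * (expR (t * tau) - 1 - t * tau).
  by rewrite /f /Fterm -/tau dotDl dotZl expRD; ring.
have -> : Fterm (u + (2 * s) *: w) k j x + Fterm (u + (- (2 * s)) *: w) k j x =
   Fterm u k j x * (expR (2 * s * tau) + expR (- (2 * s * tau))).
  by rewrite /Fterm !dotDl !dotZl -/tau !expRD mulNr; ring.
rewrite normrM ger0_norm ?Fterm_ge0// mulrCA ler_wpM2l ?Fterm_ge0//.
have /andP[e1 e2] := expR_taylor1 (t * tau).
rewrite ger0_norm// (le_trans e2)//.
have e3 : expR `|t * tau| <= expR (s * `|tau|).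
  by rewrite ler_expR normrM ler_wpM2r.
have e4 : (s * `|tau|) ^+ 2 <= 4 * expR (s * `|tau|).
  by apply: sqr_le_expR; rewrite mulr_ge0// ltW.
have e5 : expR (s * `|tau|) * expR (s * `|tau|) <= expR (2 * s * tau) + expR (- (2 * s * tau)).
  apply: le_trans (expR_norm_le _).
  by rewrite -expRD ler_expR normrM (gtr0_norm (_ : 0 < 2 * s)) ?mulr_gt0//; lra.
have e6 : tau ^+ 2 = s^-1 ^+ 2 * (s * `|tau|) ^+ 2.
  by rewrite -exprMn mulrA mulVf ?gt_eqF// mul1r real_normK// num_real.
rewrite exprMn e6 /c.
rewrite (@le_trans _ _ (t ^+ 2 * (s^-1 ^+ 2 * (4 * expR (s * `|tau|))) * expR (s * `|tau|)))//.
  apply: ler_pM e3; rewrite ?expR_ge0//.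
    by rewrite mulr_ge0 ?sqr_ge0// mulr_ge0 ?sqr_ge0.
  by rewrite ler_wpM2l ?sqr_ge0// ler_wpM2l ?sqr_ge0.
rewrite (_ : t ^+ 2 * _ * _ = c * (expR (s * `|tau|) * expR (s * `|tau|))); last first.
  by rewrite /c; ring.
by rewrite ler_wpM2l.
Qed.

End Laplace.

(** * Invariant kernels as matrices over a convolution semiring *)

Section EsumExtra.
Variable R : realType.
Local Open Scope ereal_scope.

Lemma exchange_esum (T T' : choiceType) (a : T -> T' -> \bar R) :
  (forall x y, 0 <= a x y) ->
  \esum_(x in [set: T]) \esum_(y in [set: T']) a x y =
  \esum_(y in [set: T']) \esum_(x in [set: T]) a x y.
Proof.
move=> a0; rewrite (esum_esum (J := fun=> setT))//.
rewrite (esum_esum (J := fun=> setT) (a := fun y x => a x y))//.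
rewrite (reindex_esum (setT `*`` (fun=> setT)) _ (fun x => (x.2, x.1)))//.
split => //=; first by move=> [x1 x2] [y1 y2] _ _ /= [-> ->].
by move=> [x1 x2] _ /=; exists (x2, x1).
Qed.

Lemma reindex_esumT (T T' : choiceType) (e : T -> T') (e' : T' -> T)
    (a : T' -> \bar R) : cancel e e' -> cancel e' e ->
  \esum_(y in [set: T']) a y = \esum_(x in [set: T]) a (e x).
Proof.
move=> ee' e'e; apply: reindex_esum; split => //.
  by move=> x y _ _ /(can_inj ee').
by move=> y _; exists (e' y).
Qed.

Lemma esum_single (T : choiceType) (a : T -> \bar R) x : 0 <= a x ->
  (forall y, y != x -> a y = 0) -> \esum_(y in [set: T]) a y = a x.
Proof.
move=> a0 az; rewrite -(esum_set1 a0) [RHS]esum_mkcond; apply: eq_esum => y _.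
by case: ifPn => //; rewrite notin_setE => h; apply: az; exact/eqP.
Qed.

End EsumExtra.

(* The commutative semiring of functions [G -> [0, +oo]] under convolution: a
   translation-invariant kernel is a matrix over it, and the powers of the
   kernel are the powers of the matrix. *)
Record convfun (R : realType) (G : zmodType) :=
  Conv { cval :> G -> \bar R ; cval_ge0 : forall x, (0 <= cval x)%E }.

HB.instance Definition _ (R : realType) (G : zmodType) := gen_eqMixin (convfun R G).
HB.instance Definition _ (R : realType) (G : zmodType) := gen_choiceMixin (convfun R G).

Section ConvRing.
Variables (R : realType) (G : zmodType).
Implicit Types f g h : convfun R G.
Local Open Scope ereal_scope.

Lemma convP f g : (forall x, f x = g x) -> f = g.
Proof.
case: f g => [f f0] [g g0] /= fg.
have E : f = g by apply/funext.
by subst g; congr Conv; exact: Prop_irrelevance.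
Qed.

Fact conv0_ge0 (x : G) : (0 : \bar R) <= 0. Proof. by []. Qed.
Definition conv0 : convfun R G := Conv conv0_ge0.

(** A point mass [c] at [x0]; the truncation at 0 makes it nonnegative for every real [c], so that
    no proof is carried in the arguments. *)
Definition single_fun (c : R) (x0 : G) (x : G) : \bar R :=
  if x == x0 then (Num.max c 0)%:E else 0.
Fact single_ge0 c x0 x : 0 <= single_fun c x0 x.
Proof. by rewrite /single_fun; case: ifP => // _; rewrite lee_fin le_max lexx orbT. Qed.
Definition single c x0 : convfun R G := Conv (single_ge0 c x0).

Fact convD_ge0 f g x : 0 <= f x + g x.
Proof. by rewrite adde_ge0 ?cval_ge0. Qed.
Definition convD f g : convfun R G := Conv (convD_ge0 f g).

Fact convM_ge0 f g z : 0 <= \esum_(x in [set: G]) (f x * g (z - x)%R).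
Proof. by apply: esum_ge0 => x _; rewrite mule_ge0 ?cval_ge0. Qed.
Definition convM f g : convfun R G := Conv (convM_ge0 f g).

Lemma convDA : associative convD.
Proof. by move=> f g h; apply: convP => x /=; rewrite addeA. Qed.
Lemma convDC : commutative convD.
Proof. by move=> f g; apply: convP => x /=; rewrite addeC. Qed.
Lemma conv0D : left_id conv0 convD.
Proof. by move=> f; apply: convP => x /=; rewrite add0e. Qed.

Lemma convMC : commutative convM.
Proof.
move=> f g; apply: convP => z /=.
rewrite (@reindex_esumT _ _ _ (fun x => z - x)%R (fun x => z - x)%R) => [|x|x].
- by apply: eq_esum => x _; rewrite subKr muleC.
- by rewrite subKr.
- by rewrite subKr.
Qed.

Lemma convMA : associative convM.
Proof.
move=> f g h; apply: convP => z /=.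
transitivity (\esum_(x in [set: G]) \esum_(y in [set: G])
    (f x * (g y * h (z - x - y)%R))).
  apply: eq_esum => x _; rewrite esumZ ?cval_ge0// => y.
  by rewrite mule_ge0 ?cval_ge0.
transitivity (\esum_(y in [set: G]) \esum_(x in [set: G])
    (h (z - y)%R * (f x * g (y - x)%R))); last first.
  apply: eq_esum => y _; rewrite [RHS]muleC esumZ ?cval_ge0// => x.
  by rewrite mule_ge0 ?cval_ge0.
rewrite [RHS]exchange_esum; last by move=> x y; rewrite !mule_ge0 ?cval_ge0.
apply: eq_esum => x _.
rewrite [RHS](@reindex_esumT _ _ _ (fun y => y + x)%R (fun y => y - x)%R).
- apply: eq_esum => y _; rewrite addrK [RHS]muleC -muleA.
  by congr (_ * (_ * h _)); rewrite opprD addrA addrAC.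
- by move=> y; rewrite addrK.
- by move=> y; rewrite subrK.
Qed.

Lemma conv1M : left_id (single 1 0%R) convM.
Proof.
move=> f; apply: convP => z /=.
rewrite (@esum_single _ _ _ 0%R).
- by rewrite /single_fun eqxx max_l// mul1e subr0.
- by rewrite mule_ge0 ?cval_ge0// single_ge0.
- by move=> y /negPf y0; rewrite /single_fun y0 mul0e.
Qed.

Lemma convMDl : left_distributive convM convD.
Proof.
move=> f g h; apply: convP => z /=; rewrite -esumD.
- by apply: eq_esum => x _; rewrite ge0_muleDl ?cval_ge0.
- by move=> x _; rewrite mule_ge0 ?cval_ge0.
- by move=> x _; rewrite mule_ge0 ?cval_ge0.
Qed.

Lemma conv0M : left_zero conv0 convM.
Proof. by move=> f; apply: convP => z /=; rewrite esum1// => x _; rewrite mul0e. Qed.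

HB.instance Definition _ := GRing.isNmodule.Build (convfun R G) convDA convDC conv0D.
HB.instance Definition _ := GRing.Nmodule_isComPzSemiRing.Build (convfun R G)
  convMA convMC conv1M convMDl conv0M.

Lemma conv1E x : (1%R : convfun R G) x = single_fun 1 0%R x. Proof. by []. Qed.
Lemma convDE f g x : (f + g)%R x = f x + g x. Proof. by []. Qed.
Lemma convME f g z : (f * g)%R z = \esum_(x in [set: G]) (f x * g (z - x)%R).
Proof. by []. Qed.

Lemma convfun_sumE (I : Type) (r : seq I) (P : pred I) (F : I -> convfun R G) x :
  (\sum_(i <- r | P i) F i)%R x = \sum_(i <- r | P i) (F i x).
Proof. by elim/big_ind2: _ => // f a g b <- <-. Qed.

Lemma singleM c x0 f z : (0 <= c)%R -> (single c x0 * f)%R z = c%:E * f (z - x0)%R.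
Proof.
move=> c0; rewrite convME (@esum_single _ _ _ x0).
- by rewrite /= /single_fun eqxx max_l.
- by rewrite mule_ge0 ?cval_ge0.
- by move=> y /negPf y0; rewrite /= /single_fun y0 mul0e.
Qed.

Lemma le_convM f g x y : f x * g y <= (f * g)%R (x + y)%R.
Proof.
rewrite convME; have := @esum_ge1 _ _ (fun z => f z * g (x + y - z)%R) x.
by rewrite addrAC subrr add0r; apply => z; rewrite mule_ge0 ?cval_ge0.
Qed.

Lemma mulmx_convfunE n1 n2 n3 (A : 'M[convfun R G]_(n1, n2)) (B : 'M[convfun R G]_(n2, n3)) i j z :
  (A *m B)%R i j z = \sum_k (A i k * B k j)%R z.
Proof. by rewrite mxE convfun_sumE. Qed.

Lemma le_mulmx_convfun n1 n2 n3 (A : 'M[convfun R G]_(n1, n2)) (B : 'M[convfun R G]_(n2, n3)) i k j x y :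
  A i k x * B k j y <= (A *m B)%R i j (x + y)%R.
Proof.
rewrite mulmx_convfunE (bigD1 k)//=; apply: le_trans (le_convM _ _ _ _) _.
by rewrite leeDl// sume_ge0// => l _; exact: (cval_ge0 (A i l * B l j)%R).
Qed.

End ConvRing.

Section KernelConv.
Variables (R : realType) (d N : nat) (p : kernel_on R d N).
Hypothesis pK : invariant_kernel p.
Local Open Scope ereal_scope.

Fact kernel_conv_ge0 k j x : 0 <= (p k j 0%R x)%:E.
Proof. by rewrite lee_fin; case: pK. Qed.

Definition kernel_mx : 'M[convfun R 'rV[int]_d]_N :=
  \matrix_(k, j) Conv (kernel_conv_ge0 k j).

Lemma kernel_powE n k j x y :
  kernel_pow p n k j x y = (kernel_mx ^+ n)%R k j (y - x)%R.
Proof.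
elim: n k j x y => [|n IH] k j x y.
  rewrite expr0 mxE /=; case: (k == j); rewrite ?andbF ?mulr0n ?andbT//.
  rewrite mulr1n conv1E /single_fun subr_eq0 eq_sym.
  by case: (y == x); rewrite ?max_l.
rewrite exprS -mulmxE mulmx_convfunE /=; apply: eq_bigr => i _.
rewrite [LHS](@reindex_esumT _ _ _ (fun z => z + x)%R (fun z => z - x)%R).
- apply: eq_esum => z _; rewrite IH mxE /= (kernel_invariant pK) addrK.
  by rewrite opprD addrA addrAC.
- by move=> z; rewrite addrK.
- by move=> z; rewrite subrK.
Qed.

End KernelConv.

Section LaplaceConv.
Variables (R : realType) (d : nat).
Local Notation CV := (convfun R 'rV[int]_d).
Implicit Types (f g : CV) (w : 'rV[R]_d).
Local Open Scope ereal_scope.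

Definition laplace w f : \bar R :=
  \esum_(x in [set: 'rV[int]_d]) (f x * (expR (dot w (of_lattice R x)))%:E).

Lemma EFin_expR_ge0 (x : R) : 0 <= (expR x)%:E. Proof. by rewrite lee_fin expR_ge0. Qed.

Lemma laplace_ge0 w f : 0 <= laplace w f.
Proof. by apply: esum_ge0 => x _; rewrite mule_ge0 ?cval_ge0 ?EFin_expR_ge0. Qed.

Lemma le_laplace w f x : f x * (expR (dot w (of_lattice R x)))%:E <= laplace w f.
Proof.
apply: (@esum_ge1 _ _ (fun x => f x * (expR (dot w (of_lattice R x)))%:E)) => y.
by rewrite mule_ge0 ?cval_ge0 ?EFin_expR_ge0.
Qed.

Lemma laplaceD w f g : laplace w (f + g)%R = laplace w f + laplace w g.
Proof.
rewrite -esumD => [|x _|x _]; try by rewrite mule_ge0 ?cval_ge0 ?EFin_expR_ge0.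
by apply: eq_esum => x _; rewrite ge0_muleDl ?cval_ge0.
Qed.

Lemma laplace0 w : laplace w 0%R = 0.
Proof. by apply: esum1 => x _; rewrite mul0e. Qed.

Lemma laplace_single w (c : R) x0 : (0 <= c)%R ->
  laplace w (single c x0) = (c * expR (dot w (of_lattice R x0)))%:E.
Proof.
move=> c0; rewrite /laplace (@esum_single _ _ _ x0).
- by rewrite /= /single_fun eqxx max_l.
- by rewrite mule_ge0 ?cval_ge0 ?EFin_expR_ge0.
- by move=> y /negPf y0; rewrite /= /single_fun y0 mul0e.
Qed.

Lemma laplace1 w : laplace w 1%R = 1.
Proof. by rewrite laplace_single// of_lattice0 dot0r expR0 mulr1. Qed.

Lemma laplaceM w f g : laplace w (f * g)%R = laplace w f * laplace w g.
Proof.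
have h0 x y : 0 <= f x * (expR (dot w (of_lattice R x)))%:E *
      (g (y - x)%R * (expR (dot w (of_lattice R (y - x))))%:E).
  by rewrite !mule_ge0 ?cval_ge0 ?EFin_expR_ge0.
transitivity (\esum_(y in [set: 'rV[int]_d]) \esum_(x in [set: 'rV[int]_d])
   (f x * (expR (dot w (of_lattice R x)))%:E *
      (g (y - x)%R * (expR (dot w (of_lattice R (y - x))))%:E))).
  apply: eq_esum => y _; rewrite convME muleC -esumZ ?EFin_expR_ge0//; last first.
    by move=> x; rewrite mule_ge0 ?cval_ge0.
  apply: eq_esum => x _.
  have -> : (expR (dot w (of_lattice R y)))%:E =
     (expR (dot w (of_lattice R x)))%:E * (expR (dot w (of_lattice R (y - x))))%:E.
    by rewrite -EFinM -expRD -dotDr -of_latticeD addrC subrK.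
  by rewrite muleC muleACA.
rewrite exchange_esum; last by move=> x y; exact: h0.
rewrite /laplace [RHS]muleC -esumZ; last 2 first.
- exact: laplace_ge0.
- by move=> x; rewrite mule_ge0 ?cval_ge0 ?EFin_expR_ge0.
apply: eq_esum => x _; rewrite [RHS]muleC -esumZ; last 2 first.
- by rewrite mule_ge0 ?cval_ge0 ?EFin_expR_ge0.
- by move=> y; rewrite mule_ge0 ?cval_ge0 ?EFin_expR_ge0.
rewrite [LHS](@reindex_esumT _ _ _ (fun y => y + x)%R (fun y => y - x)%R).
- by apply: eq_esum => y _; rewrite addrK.
- by move=> y; rewrite addrK.
- by move=> y; rewrite subrK.
Qed.

Lemma laplace_sum w (I : Type) (r : seq I) (F : I -> CV) :
  laplace w (\sum_(i <- r) F i)%R = \sum_(i <- r) laplace w (F i).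
Proof.
by elim/big_ind2: _ => //; [exact: laplace0|move=> f a g b; rewrite laplaceD => -> ->].
Qed.

(** A relation with a real matrix rather than a function, so that it also records the finiteness of
    all entries. *)
Definition laplace_mx N w (M : 'M[CV]_N) (F : 'M[R]_N) :=
  forall i j, laplace w (M i j) = (F i j)%:E.

Lemma laplace_mx1 N w : laplace_mx w (1%R : 'M[CV]_N) (1%R : 'M[R]_N).
Proof.
by move=> i j; rewrite !mxE; case: (i == j); rewrite ?laplace1 ?laplace0.
Qed.

Lemma laplace_mxM N w (M M' : 'M[CV]_N) (F F' : 'M[R]_N) :
  laplace_mx w M F -> laplace_mx w M' F' -> laplace_mx w (M * M')%R (F * F')%R.
Proof.
move=> MF MF' i j; rewrite -!mulmxE !mxE laplace_sum -sumEFin.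
by apply: eq_bigr => k _; rewrite laplaceM MF MF'.
Qed.

Lemma laplace_mxD N w (M M' : 'M[CV]_N) (F F' : 'M[R]_N) :
  laplace_mx w M F -> laplace_mx w M' F' -> laplace_mx w (M + M')%R (F + F')%R.
Proof. by move=> MF MF' i j; rewrite !mxE laplaceD MF MF'. Qed.

Lemma laplace_mxX N w (M : 'M[CV]_N) (F : 'M[R]_N) n :
  laplace_mx w M F -> laplace_mx w (M ^+ n)%R (F ^+ n)%R.
Proof.
move=> MF; elim: n => [|n IH]; first by rewrite !expr0; exact: laplace_mx1.
by rewrite !exprS; exact: laplace_mxM.
Qed.

End LaplaceConv.

(** * The dominant eigenvalue *)

Section Lambda.
Variables (R : realType) (d N : nat) (p : kernel_on R d N).
Hypothesis N0 : (0 < N)%N.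
Hypothesis pK : invariant_kernel p.
Hypothesis pI : strongly_irreducible p.
Implicit Types (u v w : 'rV[R]_d) (C : 'cV[R]_N) (pi : 'rV[R]_N).

Local Notation P := (kernel_mx pK).
Let p0 : forall k j x y, 0 <= p k j x y := kernel_ge0 pK.

Lemma laplace_Fmx u : Fdom p u -> laplace_mx u P (Fmx p u).
Proof.
move=> uF k j.
have -> : (Fmx p u k j)%:E = psum (Fterm p u k j).
  by rewrite mxE -psum_fin ?Fdom_fin// => x; exact: Fterm_ge0.
by apply: eq_esum => x _; rewrite mxE /= -EFinM.
Qed.

Lemma irr_conv k j x : exists n0 : nat, forall n, (n0 <= n)%N ->
  (0 < (P ^+ n)%R k j x)%E.
Proof.
have [n0 h] := pI k j 0 x; exists n0 => n /h.
by rewrite (kernel_powE pK) subr0.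
Qed.

Lemma laplace_mx_gt0 u (M : 'M[convfun R 'rV[int]_d]_N) (F : 'M[R]_N) k j x :
  laplace_mx u M F -> (0 < M k j x)%E -> 0 < F k j.
Proof.
move=> MF Mx; rewrite -lte_fin -MF; apply: lt_le_trans (le_laplace _ _ x).
by rewrite mule_gt0// lte_fin expR_gt0.
Qed.

(** Only the increment 0 is tested: one positive value of a power of the kernel makes the whole
    transform positive, and finitely many thresholds have a maximum. *)
Lemma Fmx_primitive u : Fdom p u -> primitive_mx (Fmx p u).
Proof.
move=> uF; pose n k j := sval (cid (irr_conv k j 0)).
have hn k j : forall m, (n k j <= m)%N -> (0 < (P ^+ m)%R k j 0%R)%E.
  exact: svalP (cid (irr_conv k j 0)).
exists (\max_k \max_j n k j)%N => k j.
apply: (laplace_mx_gt0 (x := 0) (laplace_mxX _ (laplace_Fmx uF))).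
apply: hn; apply: leqW.
by rewrite (leq_trans _ (leq_bigmax k))// (leq_trans _ (leq_bigmax j)).
Qed.

Lemma lambda_eigen u (l : R) pi C : Fdom p u -> 0 < l ->
  (forall i, 0 < pi 0 i) -> (forall i, 0 < C i 0) ->
  pi *m Fmx p u = l *: pi -> Fmx p u *m C = l *: C -> lambda p u = l.
Proof.
move=> uF l0 pi0 C0 piF FC.
have dom := PF_dominant N0 (Fmx_ge0 p0 u) (Fmx_primitive uF) l0 pi0 C0 piF FC.
apply: (dominant_unique (A := Fmx p u)) => //.
by rewrite /lambda; case: xgetP => [? _ //|/(_ l)].
Qed.

Lemma lambda_PF u : Fdom p u -> exists pi C, [/\ 0 < lambda p u,
  forall i, 0 < pi 0 i, forall i, 0 < C i 0,
  pi *m Fmx p u = lambda p u *: pi & Fmx p u *m C = lambda p u *: C].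
Proof.
move=> uF.
have [l [pi [C [l0 pi0 C0 piF FC]]]] :=
  Perron_Frobenius N0 (Fmx_ge0 p0 u) (Fmx_primitive uF).
by exists pi, C; rewrite (lambda_eigen uF l0 pi0 C0 piF FC).
Qed.

Lemma lambda_le u rho C : Fdom p u -> (forall i, 0 < C i 0) ->
  (forall i, (Fmx p u *m C) i 0 <= rho * C i 0) -> lambda p u <= rho.
Proof.
move=> uF C0; have [pi [_ [_ pi0 _ piF _]]] := lambda_PF uF.
exact: Collatz_Wielandt_le piF C0.
Qed.

Lemma lambda_ge u rho C : Fdom p u -> (forall i, 0 < C i 0) ->
  (forall i, rho * C i 0 <= (Fmx p u *m C) i 0) -> rho <= lambda p u.
Proof.
move=> uF C0; have [pi [_ [_ pi0 _ piF _]]] := lambda_PF uF.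
exact: Collatz_Wielandt_ge piF C0.
Qed.

Lemma normalized_left u C : Hset p u -> (forall i, 0 < C i 0) ->
  exists pi, [/\ forall i, 0 < pi 0 i, pi *m Fmx p u = pi & (pi *m C) 0 0 = 1].
Proof.
move=> [uF u1] C0; have [pi [_ [_ pi0 _ piF _]]] := lambda_PF uF.
have h := dot_gt0 N0 pi0 C0.
exists (((pi *m C) 0 0)^-1 *: pi); split => [i||].
- by rewrite mxE mulr_gt0// invr_gt0.
- by rewrite -scalemxAl piF u1 scale1r.
- by rewrite -scalemxAl mxE mulVf// gt_eqF.
Qed.

Section AtH.
Variables (u : 'rV[R]_d) (pi : 'rV[R]_N) (C : 'cV[R]_N).
Hypotheses (uF : Fdom p u) (pi0 : forall i, 0 < pi 0 i)
  (C0 : forall i, 0 < C i 0) (piF : pi *m Fmx p u = pi)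
  (FC : Fmx p u *m C = C) (piC : (pi *m C) 0 0 = 1).

(** Uniqueness for all powers is what allows [eigen_perturb] to be applied to F(u)^m, the transform
    of the marked factor. *)
Lemma Fmx_exp_unique m r : (0 < m)%N -> r *m Fmx p u ^+ m = r ->
  exists c, r = c *: pi.
Proof.
move=> m0 rF; apply: (left_eigen_unique (l := 1) N0 _ pi0 _ _).
- exact: primitive_exp (Fmx_primitive uF) m0.
- by rewrite (@eigen_exp _ _ _ 1) ?scale1r// expr1n scale1r.
- by rewrite scale1r.
Qed.

(** The mean of w.x over one step of the Doob transform, a Markov kernel with weights p_ab(x)
    e^(u.x) C_b / C_a and stationary law pi_a C_a. *)
Definition drift w : R := (pi *m dF p u w *m C) 0 0.
Definition drift_row : 'rV[R]_d := \row_i drift (delta_mx 0 i).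

Lemma drift_dot w : drift w = dot drift_row w.
Proof.
rewrite /drift dF_linear// mulmx_sumr mulmx_suml summxE /dot.
by apply: eq_bigr => i _; rewrite -scalemxAr -scalemxAl mxE mulrC [in RHS]mxE.
Qed.

Lemma Fmx_perturb w : exists g : 'cV[R]_N, forall e, 0 < e ->
  exists2 del, 0 < del & forall t : R, `|t| <= del ->
    [/\ Fdom p (u + t *: w), forall i, 0 < (C + t *: g) i 0 &
     forall i, (1 + t * drift w - e * `|t|) * (C + t *: g) i 0 <=
      (Fmx p (u + t *: w) *m (C + t *: g)) i 0 <=
      (1 + t * drift w + e * `|t|) * (C + t *: g) i 0].
Proof.
have uniq r : r *m Fmx p u = r -> exists c, r = c *: pi.
  by move=> rF; apply: (Fmx_exp_unique (m := 1)); rewrite ?expr1.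
have [g hg] := eigen_perturb (dF p u w) N0 uniq FC C0 piC.
exists g => e /hg[del del0 {}hg].
have [r [K [r0 K0 tay]]] := Fmx_taylor p0 w uF.
(* The last bound turns the quadratic error K t^2 into at most del |t|. *)
exists (Order.min del (Order.min r (del / (K + 1)))).
  by rewrite !lt_min del0 r0 divr_gt0// ltr_wpDl.
move=> t; rewrite !le_min => /and3P[t1 t2 t3].
have [tF ht] := tay _ t2.
have [i j|v0 b] := hg (Fmx p (u + t *: w)) t t1; last by split.
apply: le_trans (ht i j) _; rewrite -real_normK ?num_real// expr2 mulrA.
rewrite ler_wpM2r//.
move: t3; rewrite ler_pdivlMr; last by rewrite ltr_wpDl.
by have := normr_ge0 t; nra.
Qed.

(** The corrected vector C + t g is both a subsolution and a supersolution up to e |t|, so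
    Collatz-Wielandt encloses the eigenvalue. *)
Lemma lambda_expand w e : 0 < e -> exists2 del, 0 < del & forall t : R,
  `|t| <= del -> Fdom p (u + t *: w) /\
    `|lambda p (u + t *: w) - 1 - t * drift w| <= e * `|t|.
Proof.
have [g hg] := Fmx_perturb w => /hg[del del0 {}hg].
exists del => // t /hg[tF v0 b]; split => //.
have h1 := lambda_le tF v0 (fun i => proj2 (andP (b i))).
have h2 := lambda_ge tF v0 (fun i => proj1 (andP (b i))).
by rewrite ler_norml; apply/andP; split; lra.
Qed.

Lemma lambda1 : lambda p u = 1.
Proof. by apply: (lambda_eigen (pi := pi) (C := C)) => //; rewrite scale1r. Qed.

Lemma derive_lambda w : derive (lambda p) u w = drift w.
Proof.
apply: cvg_lim => //; apply/cvgrPdist_le => e /(lambda_expand w)[del del0 h].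
apply/nbhs_ballP; exists del => //= t.
rewrite /ball/= sub0r normrN => /ltW/h[_ ht] t0.
rewrite lambda1 [t *: w + u]addrC -(ler_pM2r (_ : 0 < `|t|)) ?normr_gt0//.
apply: le_trans ht; rewrite -normrM -normrN le_eqVlt; apply/orP; left; apply/eqP.
congr `|_|; rewrite -[t^-1 *: _]/(t^-1 * _); move: (lambda p _) => l.
by field.
Qed.

Lemma grad_lambda : grad (lambda p) u = drift_row.
Proof. by apply/rowP => i; rewrite !mxE derive_lambda. Qed.

(* Jensen's inequality for [exp], against the stationary weights
   [pi_a p_ab(x) e^(u.x) C_b]. *)
Lemma drift_le u0 : Fdom p u0 -> drift (u0 - u) <= lambda p u0 - 1.
Proof.
move=> u0F; have [_ [C' [_ _ C'0 _ FC']]] := lambda_PF u0F.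
(* The logarithmic change of eigenvector from [u] to [u0]: with the factor e^(h b - h a), the
   stationary average of F(u0) is exactly lambda(u0). *)
pose h b := ln (C' b 0 / C b 0).
have key a b : dF p u (u0 - u) a b + (1 + h b - h a) * Fmx p u a b <=
    expR (h b - h a) * Fmx p u0 a b.
  have ab v : Fdom p v -> absum (Fterm p v a b).
    by move=> vF; rewrite absum_ge0 ?Fdom_fin// => x; exact: Fterm_ge0.
  have FE v : Fdom p v -> Fmx p v a b = rsum (Fterm p v a b).
    by move=> vF; rewrite mxE rsum_ge0E ?Fdom_fin// => x; exact: Fterm_ge0.
  have aD := absum_dF p0 (u0 - u) a b uF.
  rewrite (FE _ uF) (FE _ u0F) mxE -!rsumZ; try exact: ab.
  rewrite -rsumD//; last by apply: absumZ; exact: ab.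
  apply: le_rsum => [||x].
  - by apply: absumD => //; apply: absumZ; exact: ab.
  - by apply: absumZ; exact: ab.
  rewrite /Fterm; set y := of_lattice R x.
  have -> : dot u0 y = dot u y + dot (u0 - u) y by rewrite -dotDl addrC subrK.
  rewrite (expRD (dot u y)); set z := dot (u0 - u) y; set k := h b - h a.
  have le1 : 1 + (z + k) <= expR z * expR k by rewrite -expRD expR_ge1Dx.
  have q0 := p0 a b 0 x; have E0 := expR_gt0 (dot u y); rewrite -subr_ge0.
  rewrite (_ : _ - _ = (p a b 0 x * expR (dot u y)) *
    (expR z * expR k - (1 + (z + k)))); last by rewrite /k; ring.
  by rewrite mulr_ge0 ?subr_ge0// mulr_ge0// ltW.
have piFC : \sum_a \sum_b pi 0 a * C b 0 * Fmx p u a b = 1.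
  rewrite -piC -{2}FC mxE; apply: eq_bigr => a _; rewrite mxE mulr_sumr.
  by apply: eq_bigr => b _; ring.
(* The coboundary h b - h a averages to zero by stationarity, so the change of eigenvector costs
   nothing at first order. *)
have bal : \sum_a \sum_b pi 0 a * C b 0 * ((h b - h a) * Fmx p u a b) = 0.
  under eq_bigr do under eq_bigr do rewrite mulrBl mulrBr.
  under eq_bigr do rewrite sumrB.
  rewrite sumrB exchange_big/=; apply/eqP; rewrite subr_eq0; apply/eqP.
  apply: eq_bigr => a _.
  transitivity (pi 0 a * C a 0 * h a).
    rewrite -{2}piF mxE !mulr_suml; apply: eq_bigr => b _; ring.
  rewrite -{1}FC mxE mulr_sumr mulr_suml; apply: eq_bigr => b _; ring.
have rhs : \sum_a \sum_b pi 0 a * C b 0 * (expR (h b - h a) * Fmx p u0 a b) =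
    lambda p u0.
  have -> : lambda p u0 = \sum_a lambda p u0 * (pi 0 a * C a 0).
    by rewrite -mulr_sumr; move: piC; rewrite mxE => ->; rewrite mulr1.
  apply: eq_bigr => a _.
  transitivity (pi 0 a * C a 0 / C' a 0 * (Fmx p u0 *m C') a 0); last first.
    by rewrite FC' mxE; field; rewrite gt_eqF.
  rewrite mxE mulr_sumr; apply: eq_bigr => b _.
  rewrite expRD expRN /h !lnK ?posrE ?divr_gt0//.
  by field; rewrite !gt_eqF.
have lhs : drift (u0 - u) = \sum_a \sum_b pi 0 a * C b 0 * dF p u (u0 - u) a b.
  rewrite /drift -mulmxA mxE; apply: eq_bigr => a _; rewrite mxE mulr_sumr.
  by apply: eq_bigr => b _; ring.
have : drift (u0 - u) + 1 + 0 <= lambda p u0.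
  have -> : drift (u0 - u) + 1 + 0 =
      \sum_a \sum_b pi 0 a * C b 0 * dF p u (u0 - u) a b +
      \sum_a \sum_b pi 0 a * C b 0 * Fmx p u a b +
      \sum_a \sum_b pi 0 a * C b 0 * ((h b - h a) * Fmx p u a b).
    by rewrite lhs piFC bal.
  rewrite -rhs -!big_split/=; apply: ler_sum => a _.
  rewrite -!big_split/=; apply: ler_sum => b _.
  rewrite -!mulrDr ler_wpM2l//; first by rewrite ltW// mulr_gt0.
  by apply: le_trans (key a b); rewrite le_eqVlt; apply/orP; left; apply/eqP; ring.
by lra.
Qed.

End AtH.
End Lambda.

(** * Euclidean geometry and the point of H with a prescribed gradient direction *)

Section Euclid.
Variables (R : realType) (d : nat).
Implicit Types u v w : 'rV[R]_d.

Lemma dot_ge0 u : 0 <= dot u u.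
Proof. by apply: sumr_ge0 => i _; rewrite -expr2 sqr_ge0. Qed.

Lemma enorm_ge0 u : 0 <= enorm u. Proof. exact: sqrtr_ge0. Qed.

Lemma enorm_sqr u : enorm u ^+ 2 = dot u u.
Proof. by rewrite sqr_sqrtr// dot_ge0. Qed.

Lemma dot_eq0 u : dot u u = 0 -> u = 0.
Proof.
move=> u0; apply/rowP => i; rewrite mxE; apply/eqP.
have /psumr_eq0P : forall i : 'I_d, true -> 0 <= u 0 i * u 0 i.
  by move=> j _; rewrite -expr2 sqr_ge0.
by move=> /(_ u0 i isT)/eqP; rewrite mulf_eq0 orbb.
Qed.

Lemma enorm_gt0 u : u != 0 -> 0 < enorm u.
Proof.
move=> un0; rewrite lt_def enorm_ge0 andbT; apply: contra un0 => /eqP e0.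
by apply/eqP/dot_eq0; rewrite -enorm_sqr e0 expr0n.
Qed.

Lemma dot_direction u : u != 0 -> dot (direction u) (direction u) = 1.
Proof.
move=> /enorm_gt0 u0; rewrite dotZl dotZr -enorm_sqr; field.
by rewrite gt_eqF.
Qed.

Lemma directionK u : u != 0 -> u = enorm u *: direction u.
Proof. by move=> /enorm_gt0 u0; rewrite scalerA divff ?scale1r// gt_eqF. Qed.

Lemma continuous_dot v : continuous (fun u => dot u v).
Proof.
have c i : continuous (fun u : 'rV[R]_d => u 0 i) by exact: coord_continuous.
move=> u; apply: (@cvg_big _ _ _ _ _ _ _ (nbhs u)) => [|i _].
  exact: add_continuous.
by apply: cvgM; [exact: c|exact: cvg_cst].
Qed.

Lemma coord_le_enorm u i : `|u 0 i| <= enorm u.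
Proof.
rewrite -(@ler_pXn2r _ 2) ?nnegrE ?enorm_ge0// enorm_sqr real_normK ?num_real//.
rewrite /dot (bigD1 i)//= expr2 lerDl; apply: sumr_ge0 => j _.
by rewrite -expr2 sqr_ge0.
Qed.

(** For distinct unit vectors, v - u makes an acute angle with [v] and an obtuse one with [u]: an
    ascent direction for the one that is a descent direction for the other. *)
Lemma dot_sub_unit u v : dot u u = 1 -> dot v v = 1 ->
  dot (v - u) (v - u) = 2 * dot (v - u) v /\ dot u (v - u) = - dot (v - u) v.
Proof.
move=> uu vv; rewrite !dotBl !dotBr uu vv [dot v u]dotC.
by move: (dot u v) => z; split; ring.
Qed.

End Euclid.

Section Phi.
Variables (R : realType) (d N : nat) (p : kernel_on R d N).
Hypothesis N0 : (0 < N)%N.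
Hypothesis pK : invariant_kernel p.
Hypothesis pI : strongly_irreducible p.
Implicit Types (u v w : 'rV[R]_d) (C : 'cV[R]_N) (pi : 'rV[R]_N).

Let p0 : forall k j x y, 0 <= p k j x y := kernel_ge0 pK.

(** The bound is multiplicative, so that it passes to products with positive vectors and to powers
    of F. *)
Lemma Fmx_upper u w e : Fdom p u -> 0 < e -> exists2 del, 0 < del &
  forall t, `|t| <= del -> Fdom p (u + t *: w) /\
    forall k j, Fmx p (u + t *: w) k j <= (1 + e) * Fmx p u k j.
Proof.
move=> uF e0.
have [r [K [r0 K0 tay]]] := Fmx_taylor p0 w uF.
(* Zero entries are replaced by 1, so [c] bounds the nonzero ones from below. An entry that vanishes
   at [u] has all its coefficients zero and vanishes everywhere. *)
pose f (z : 'I_N * 'I_N) := if Fmx p u z.1 z.2 == 0 then 1 else Fmx p u z.1 z.2.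
have [c c0 cle] : exists2 c, 0 < c & forall z, c <= f z.
  apply: pos_lower_bound => z; rewrite /f; case: eqVneq => // h.
  by rewrite lt_def h Fmx_ge0.
pose S := \sum_k \sum_j `|dF p u w k j|.
have S0 : 0 <= S by apply: sumr_ge0 => k _; apply: sumr_ge0.
have SK : 0 < S + K + 1 by rewrite ltr_wpDl// addr_ge0.
exists (Order.min 1 (Order.min r (e * c / (S + K + 1)))).
  by rewrite !lt_min ltr01 r0 divr_gt0// mulr_gt0.
move=> t; rewrite !le_min => /and3P[t1 t2 t3].
have [tF ht] := tay _ t2; split => // k j.
have [Fz|Fn] := eqVneq (Fmx p u k j) 0.
  have pz x : p k j 0 x = 0.
    have : ((Fterm p u k j x)%:E <= psum (Fterm p u k j))%E.
      by apply: (@esum_ge1 _ _ (fun x => (Fterm p u k j x)%:E)) => y; rewrite lee_fin Fterm_ge0.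
    rewrite psum_fin ?Fdom_fin//; last by move=> y; exact: Fterm_ge0.
    move: Fz; rewrite mxE => ->; rewrite lee_fin => h.
    have /eqP : Fterm p u k j x == 0 by rewrite eq_le h Fterm_ge0.
    by rewrite /Fterm => /eqP; rewrite mulf_eq0 (gt_eqF (expR_gt0 _)) orbF => /eqP.
  rewrite Fz mulr0 mxE (_ : Fent _ _ _ _ = 0%E)//.
  by apply: esum1 => x _; rewrite pz mul0r.
have cF : c <= Fmx p u k j by have := cle (k, j); rewrite /f/= (negPf Fn).
have dS : `|dF p u w k j| <= S.
  rewrite /S (bigD1 k)//= (bigD1 j)//= -addrA lerDl addr_ge0 ?sumr_ge0// => i _.
  exact: sumr_ge0.
have := ht k j; rewrite ler_norml => /andP[_ h].
have h2 : t * dF p u w k j <= `|t| * S.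
  by rewrite (le_trans (ler_norm _))// normrM ler_wpM2l.
have h3 : K * t ^+ 2 <= K * `|t|.
  rewrite ler_wpM2l// -real_normK ?num_real// expr2 ler_piMl//.
have h4 : `|t| * (S + K) <= e * c.
  move: t3; rewrite ler_pdivlMr//; apply: le_trans.
  by rewrite ler_wpM2l// lerDl.
have h5 : e * c <= e * Fmx p u k j by rewrite ler_wpM2l// ltW.
lra.
Qed.

Local Opaque lambda phi drift Fdom.

(** A maximiser of u.v on the compact set D solves the problem: it lies on the level set 1,
    otherwise it could move along [v]; and a gradient not directed by [v] would leave room to
    increase u.v while decreasing lambda. *)
Theorem phi_spec v : compact (Dset p) ->
  (exists u0, Fdom p u0 /\ lambda p u0 < 1) -> enorm v = 1 ->
  Hset p (phi p v) /\ direction (grad (lambda p) (phi p v)) = v.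
Proof.
have aux (l a b : R) : l - 1 - a * b <= - b * a -> l <= 1 by lra.
move=> cD [u0 [u0F u01]] v1.
suff [u hu] : exists u, Hset p u /\ direction (grad (lambda p) u) = v.
  pose S := [set u | Hset p u /\ direction (grad (lambda p) u) = v].
  have h : S (phi p v) by apply: (@xgetPex _ 0 S); exists u.
  exact h.
have vv : dot v v = 1 by rewrite -enorm_sqr v1 expr1n.
have D0 : Dset p !=set0 by exists u0; split => //; exact: ltW.
have [|u /set_mem[uF ule] umax] := compact_EVT_max (f := fun u => dot u v) D0 cD.
  by apply: continuous_subspaceT; exact: continuous_dot.
have better t w : 0 < t -> 0 < dot w v -> Dset p (u + t *: w) -> False.
  move=> t0 wv /mem_set/umax; rewrite dotDl dotZl leNgt ltrDl.
  by rewrite mulr_gt0.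
have [pi' [C [l0 _ C0 _ FC]]] := lambda_PF N0 pK pI uF.
have u1 : lambda p u = 1.
  apply/eqP; rewrite eq_le ule/= leNgt; apply/negP => ult.
  (* With this tolerance the factor 1 + e equals 1 / lambda(u), so the old eigenvector is a
     supersolution at level 1 after the move. *)
  have e0 : 0 < (lambda p u)^-1 - 1 by rewrite subr_gt0 invf_gt1.
  have [del del0 h] := Fmx_upper v uF e0.
  have [|tF Fle] := h del; first by rewrite gtr0_norm.
  apply: (better del v); [exact: del0|by rewrite vv|split; first exact: tF].
  apply: (lambda_le N0 pK pI tF C0) => i.
  have <- : (lambda p u)^-1 * (Fmx p u *m C) i 0 = 1 * C i 0.
    by rewrite FC mxE mulrA mulVf ?gt_eqF.
  rewrite mxE [in leRHS]mxE mulr_sumr; apply: ler_sum => j _.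
  rewrite mulrA ler_wpM2r ?(ltW (C0 _))//.
  by apply: le_trans (Fle i j) _; rewrite addrC subrK.
have uH : Hset p u := conj uF u1.
have [pi [pi0 piF piC]] := normalized_left N0 pK pI uH C0.
rewrite u1 scale1r in FC.
exists u; split => //.
rewrite (grad_lambda N0 pK pI uF pi0 C0 piF FC piC).
have [M gE dE] : exists2 M, drift_row p u pi C = M &
    forall w, drift p u pi C w = dot M w.
  by exists (drift_row p u pi C) => [//|w]; exact: (drift_dot pK pi C uF).
rewrite gE.
(* By [drift_le] a zero gradient would give lambda(u0) >= 1. *)
have Mn0 : M != 0.
  apply/eqP => M0; have := drift_le N0 pK pI uF pi0 C0 piF FC piC u0F.
  rewrite dE M0 dotC dot0r subr_ge0 leNgt.
  by move/negP; apply; exact: u01.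
apply/eqP; rewrite -subr_eq0; apply/negPn/negP => ne.
pose w := v - direction M.
have MM := dot_direction Mn0.
have ww : 0 < dot w w.
  rewrite -enorm_sqr exprn_gt0// enorm_gt0//.
  by rewrite -oppr_eq0 opprB.
have [wwE Mw'] := dot_sub_unit MM vv.
rewrite -/w in wwE Mw'.
have wv : 0 < dot w v by move: ww; rewrite wwE pmulr_rgt0.
have Mw : drift p u pi C w < 0.
  rewrite dE (directionK Mn0) dotZl pmulr_rlt0 ?enorm_gt0//.
  rewrite Mw'.
  by rewrite oppr_lt0.
(* The error allowed equals the first-order decrease, which is just enough to stay at or below level
   1. *)
have e0 : 0 < - drift p u pi C w by rewrite oppr_gt0.
have [del del0 h] := lambda_expand N0 pK pI uF pi0 C0 piF FC piC w e0.
have [|tF] := h del; first by rewrite gtr0_norm.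
rewrite ler_norml gtr0_norm// => /andP[_ hl].
by apply: (better del w); [exact: del0|exact: wv|split; [exact: tF|exact: aux hl]].
Qed.

End Phi.

(** * Words and the trace identity *)

Section Words.
Variable T : pzSemiRingType.
Variables (a e : T).

(* The sum of all words of length [q] in [a] and [e] with [j] letters [e]. *)
Fixpoint words (q j : nat) : T :=
  if q is q'.+1 then
    words q' j * a + (if j is j'.+1 then words q' j' * e else 0)
  else (j == 0%N)%:R.

Lemma words_gt q j : (q < j)%N -> words q j = 0.
Proof.
elim: q j => [|q IH] [|j]//= qj.
by rewrite !IH ?mul0r ?addr0// ltnW.
Qed.

(** The generating polynomial of the number of letters [e]. Only [k] has to be central; it will be a
    scalar matrix, while [a] and [e] do not commute. *)
Lemma words_gen (k : T) q : (forall x, k * x = x * k) ->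
  \sum_(j < q.+1) k ^+ j * words q j = (a + k * e) ^+ q.
Proof.
move=> kC; elim: q => [|q IH].
  by rewrite big_ord_recl big_ord0 /= !expr0 mulr1 addr0.
rewrite exprSr -IH mulrDr /=; under eq_bigr do rewrite mulrDr.
rewrite big_split/=; congr (_ + _).
  rewrite big_ord_recr/= words_gt// mul0r mulr0 addr0 mulr_suml.
  by apply: eq_bigr => j _; rewrite mulrA.
rewrite big_ord_recl/= mulr0 add0r mulr_suml; apply: eq_bigr => j _.
rewrite /bump add0n add1n exprSr -!mulrA; congr (_ * _).
by rewrite mulrA kC mulrA.
Qed.

Lemma words_sum q : \sum_(j < q.+1) words q j = (a + e) ^+ q.
Proof.
rewrite -[in RHS](mul1r e) -words_gen => [|x]; last by rewrite mul1r mulr1.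
by apply: eq_bigr => j _; rewrite expr1n mul1r.
Qed.

(** The derivative at k = 1 of the polynomial of [words_gen]: each word counted with its number of
    letters [e]. *)
Definition weighted q := \sum_(j < q.+1) words q j *+ j.

(** Leibniz's rule: the distinguished letter lies in the prefix or is the last one. *)
Lemma weightedS q : weighted q.+1 = weighted q * (a + e) + (a + e) ^+ q * e.
Proof.
rewrite /weighted /=; under eq_bigr do rewrite mulrnDl.
rewrite big_split/= mulrDr -addrA; congr (_ + _).
  rewrite big_ord_recr/= words_gt// mul0r mul0rn addr0 mulr_suml.
  by apply: eq_bigr => j _; rewrite mulrnAl.
rewrite big_ord_recl/= mulr0n add0r -words_sum !mulr_suml -big_split/=.
by apply: eq_bigr => j _; rewrite mulrS addrC mulrnAl.
Qed.

End Words.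

Section TraceWords.
Variables (S : comPzSemiRingType) (N : nat).
Implicit Types A E Y : 'M[S]_N.

(* Cyclicity of the trace puts the distinguished factor [E] in front. *)
Lemma mxtrace_weighted A E q Y : (A + E) * Y = Y * (A + E) ->
  \tr (weighted A E q * Y) = \tr (E * (A + E) ^+ q.-1 * Y) *+ q.
Proof.
elim: q Y => [|q IH] Y YC.
  rewrite /weighted big_ord_recl big_ord0 mulr0n addr0 mul0r.
  by rewrite mxtrace0.
rewrite weightedS mulrDl mxtraceD -[weighted A E q * _ * Y]mulrA IH; last first.
  by rewrite -mulrA YC mulrA.
have -> : \tr ((A + E) ^+ q * E * Y) = \tr (E * (A + E) ^+ q * Y).
  have XC : (A + E) ^+ q * Y = Y * (A + E) ^+ q.
    exact/esym/(commrX q)/esym.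
  by rewrite -[in RHS]mulrA XC -mulrA -!mulmxE mxtrace_mulC mulmxE mulrA.
case: q {IH} => [|q]; first by rewrite mulr0n add0r mulr1n.
by rewrite [RHS]mulrSr /= exprSr !mulrA.
Qed.
End TraceWords.

(** * Marked steps *)

Section Marks.
Variables (R : realType) (d N : nat).
Local Notation CV := (convfun R 'rV[int]_d).
Implicit Types (M Y : 'M[CV]_N) (F : 'M[R]_N) (v : 'cV[R]_N) (w : 'rV[R]_d).

Lemma supersolution_exp F v (rho : R) q : nneg_mx F -> 0 <= rho ->
  (forall i, (F *m v) i 0 <= rho * v i 0) ->
  forall i, (F ^+ q *m v) i 0 <= rho ^+ q * v i 0.
Proof.
move=> F0 rho0 Fv; elim: q => [|q IH] i.
  by rewrite !expr0 mul1mx mul1r.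
rewrite exprS -mulmxE -mulmxA mxE.
apply: (@le_trans _ _ (\sum_j F i j * (rho ^+ q * v j 0))).
  by apply: ler_sum => j _; rewrite ler_wpM2l.
under eq_bigr do rewrite mulrCA; rewrite -mulr_sumr exprSr -mulrA.
by rewrite ler_wpM2l ?exprn_ge0//; have := Fv i; rewrite mxE.
Qed.

(** A single term of the Laplace transform is at most F_ij, and a single term of F v is at most c
    v_i. *)
Lemma kernel_upper w M F v (c : R) i j y : laplace_mx w M F -> nneg_mx F ->
  (forall i, 0 < v i 0) -> (forall i, (F *m v) i 0 <= c * v i 0) ->
  (M i j y <= (c * v i 0 / v j 0 * expR (- dot w (of_lattice R y)))%:E)%E.
Proof.
move=> MF F0 v0 Fv.
have h : F i j <= c * v i 0 / v j 0.
  rewrite ler_pdivlMr//; apply: le_trans (Fv i).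
  rewrite mxE (bigD1 j)//= lerDl; apply: sumr_ge0 => k _.
  by rewrite mulr_ge0// ltW.
apply: (@le_trans _ _ ((F i j * expR (- dot w (of_lattice R y)))%:E)); last first.
  by rewrite lee_fin ler_wpM2r ?expR_ge0.
rewrite EFinM -MF expRN.
have /(lee_wpmul2r (_ : 0 <= (expR (dot w (of_lattice R y)))^-1%:E)%E) := le_laplace w (M i j) y.
rewrite lee_fin invr_ge0 expR_ge0 => /(_ isT); apply: le_trans.
by rewrite -muleA -EFinM divff ?mule1// gt_eqF ?expR_gt0.
Qed.

Lemma mxtraceE M y : (\tr M) y = (\sum_i M i i y)%E.
Proof. exact: convfun_sumE. Qed.

Lemma trace_upper w M F v (c : R) y : laplace_mx w M F -> nneg_mx F ->
  (forall i, 0 < v i 0) -> (forall i, (F *m v) i 0 <= c * v i 0) ->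
  ((\tr M) y <= (N%:R * c * expR (- dot w (of_lattice R y)))%:E)%E.
Proof.
move=> MF F0 v0 Fv; rewrite mxtraceE.
apply: le_trans (lee_sum _ (fun i _ => kernel_upper i i y MF F0 v0 Fv)) _.
rewrite sumEFin lee_fin.
under eq_bigr do rewrite mulfK ?gt_eqF//.
by rewrite sumr_const card_ord -mulrnAl mulr_natl.
Qed.

Definition mark (a b : 'I_N) (x : 'rV[int]_d) (c : R) : 'M[CV]_N :=
  \matrix_(i, j) if (i == a) && (j == b) then single c x else 0.

Section Unmark.
Variables (M : 'M[CV]_N) (a b : 'I_N) (x : 'rV[int]_d).

Fact unmark_ge0 i j z :
  (0 <= if [&& i == a, j == b & z == x] then 0 else M i j z)%E.
Proof. by case: ifP => // _; exact: cval_ge0. Qed.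

(** The marked mass is deleted, since the semiring has no subtraction. [mark] restores it when [c]
    is the whole mass of the entry at [x]. *)
Definition unmark : 'M[CV]_N := \matrix_(i, j) Conv (unmark_ge0 i j).

Lemma unmarkD c : 0 <= c -> M a b x = c%:E -> unmark + mark a b x c = M.
Proof.
move=> c0 Mc; apply/matrixP => i j; apply: convP => z.
rewrite mxE convDE !mxE /=.
have [->|] := eqVneq i a; last by rewrite /= adde0.
have [->|] := eqVneq j b; last by rewrite /= adde0.
by rewrite /= /single_fun; case: eqVneq => [->|]; rewrite ?add0e ?adde0// Mc max_l.
Qed.
End Unmark.

(** A real scalar is represented inside the semiring by a mass at the origin, which is central. *)
Definition scalar_single (c : R) : 'M[CV]_N := (single c 0)%:M.

Lemma scalar_singleC c M : scalar_single c * M = M * scalar_single c.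
Proof. by rewrite -!mulmxE /scalar_single scalar_mxC. Qed.

Lemma mxtrace_scalar_single c M y : 0 <= c -> (\tr (scalar_single c * M)) y = (c%:E * (\tr M) y)%E.
Proof. by move=> c0; rewrite -mulmxE mul_scalar_mx mxtraceZ singleM// subr0. Qed.

Lemma mxtrace_scalar_singleX c j M y : 0 <= c ->
  (\tr (scalar_single c ^+ j * M)) y = ((c ^+ j)%:E * (\tr M) y)%E.
Proof.
move=> c0; elim: j => [|j IH]; first by rewrite !expr0 mul1r mul1e.
by rewrite exprS -mulrA mxtrace_scalar_single// IH muleA -EFinM exprS.
Qed.

Lemma convfun_mulrn (f : CV) n y : (f *+ n) y = (n%:R%:E * f y)%E.
Proof.
elim: n => [|n IH]; first by rewrite mulr0n mul0e.
rewrite mulrS convDE IH -{1}[f y]mul1e -ge0_muleDl ?lee_fin//.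
by rewrite -EFinD -nat1r.
Qed.

(** Closing a path through a marked step from [a] to [b] leaves a path from [b] back to [a]: this
    produces the order of the indices and the shift by [x]. *)
Lemma mark_trace a b x c M y : 0 <= c ->
  (\tr (mark a b x c * M)) y = (c%:E * M b a (y - x)%R)%E.
Proof.
move=> c0; rewrite -singleM// -mulmxE /mxtrace (bigD1 a)//= big1 => [|i /negPf ia].
  rewrite addr0 mxE (bigD1 b)//= big1 => [|j /negPf jb].
    by rewrite addr0 mxE !eqxx.
  by rewrite mxE jb andbF mul0r.
by rewrite mxE big1// => j _; rewrite mxE ia mul0r.
Qed.

Section Count.
Variables (M Y : 'M[CV]_N) (a b : 'I_N) (x y : 'rV[int]_d) (c : R) (q : nat).
Hypotheses (c0 : 0 <= c) (Mc : M a b x = c%:E) (MY : M * Y = Y * M).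

Let U := unmark M a b x.
Let E := mark a b x c.
(** The weight at [y] of the closed paths of M^q Y with [j] marked factors. Its mass, first moment
    and generating function are [count0], [count1] and [countX]. *)
Let om j := (\tr (words U E q j * Y)) y.

Lemma om_ge0 j : (0 <= om j)%E. Proof. exact: cval_ge0. Qed.

Let UE : U + E = M. Proof. exact: unmarkD. Qed.

Lemma count0 : (\tr (M ^+ q * Y)) y = (\sum_(j < q.+1) om j)%E.
Proof.
rewrite -UE -words_sum mulr_suml raddf_sum convfun_sumE.
by [].
Qed.

Lemma count1 : ((q%:R * c)%:E * (M ^+ q.-1 * Y)%R b a (y - x)%R =
  \sum_(j < q.+1) j%:R%:E * om j)%E.
Proof.
have H := @mxtrace_weighted _ _ U E q Y; rewrite UE in H.
have H1 := congr1 (fun f : CV => f y) (H MY).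
rewrite convfun_mulrn in H1.
have H2 : E * M ^+ q.-1 * Y = E * (M ^+ q.-1 * Y). by rewrite mulrA.
rewrite H2 in H1. 
rewrite (mark_trace a b x (M ^+ q.-1 * Y) y c0) in H1.
rewrite EFinM.
rewrite -muleA.
rewrite -H1.
rewrite /weighted mulr_suml raddf_sum convfun_sumE.
by apply: eq_bigr => j _; rewrite mulrnAl raddfMn convfun_mulrn.
Qed.

Lemma countX k : 0 <= k -> (\tr ((U + scalar_single k * E) ^+ q * Y)) y =
  (\sum_(j < q.+1) (k ^+ j)%:E * om j)%E.
Proof.
move=> k0; rewrite -words_gen; last exact: scalar_singleC.
rewrite mulr_suml raddf_sum convfun_sumE.
by apply: eq_bigr => j _; rewrite -mulrA mxtrace_scalar_singleX.
Qed.

(* Chernoff's inequality for the number of marked steps, from [z <= exp z]. *)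
Lemma count_upper A s : 0 <= A -> 0 < s ->
  ((q%:R * c)%:E * (M ^+ q.-1 * Y)%R b a (y - x)%R <=
   A%:E * (\tr (M ^+ q * Y)) y +
   (s^-1 * expR (- (s * A)))%:E * (\tr ((U + scalar_single (expR s) * E) ^+ q * Y)) y)%E.
Proof.
move=> A0 s0; rewrite count1 count0 countX ?expR_ge0//.
have ce : 0 <= s^-1 * expR (- (s * A)) by rewrite mulr_ge0 ?expR_ge0// invr_ge0 ltW.
rewrite ge0_sume_distrr => [|i _]; last exact: om_ge0.
rewrite ge0_sume_distrr => [|i _]; last by rewrite mule_ge0 ?om_ge0// lee_fin exprn_ge0 ?expR_ge0.
rewrite -big_split/=; apply: lee_sum => j _.
rewrite muleA -EFinM -ge0_muleDl ?lee_fin// ?mulr_ge0 ?exprn_ge0 ?expR_ge0 ?invr_ge0 ?(ltW s0)//.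
rewrite lee_wpmul2r ?om_ge0// -EFinD lee_fin -expRM_natl -mulrA -expRD.
have := expR_ge1Dx (- (s * A) + j%:R * s); set z := expR _ => h.
rewrite -(ler_pM2l s0) mulrDr mulrA divff ?gt_eqF// mul1r; nra.
Qed.

(** The deficit A - j is bounded by s^-1 e^(s (A - j)); the marks are therefore discounted by
    e^(-s). *)
Lemma count_lower A s : 0 <= A -> 0 < s ->
  (A%:E * (\tr (M ^+ q * Y)) y <=
   (q%:R * c)%:E * (M ^+ q.-1 * Y)%R b a (y - x)%R +
   (s^-1 * expR (s * A))%:E * (\tr ((U + scalar_single (expR (- s)) * E) ^+ q * Y)) y)%E.
Proof.
move=> A0 s0; rewrite count1 count0 countX ?expR_ge0//.
have ce : 0 <= s^-1 * expR (s * A) by rewrite mulr_ge0 ?expR_ge0// invr_ge0 ltW.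
rewrite ge0_sume_distrr => [|i _]; last exact: om_ge0.
rewrite ge0_sume_distrr => [|i _]; last by rewrite mule_ge0 ?om_ge0// lee_fin exprn_ge0 ?expR_ge0.
rewrite -big_split/=; apply: lee_sum => j _.
rewrite muleA -EFinM -ge0_muleDl ?lee_fin// ?mulr_ge0 ?exprn_ge0 ?expR_ge0 ?invr_ge0 ?(ltW s0)//.
rewrite lee_wpmul2r ?om_ge0// -EFinD lee_fin -expRM_natl -mulrA -expRD.
have := expR_ge1Dx (s * A + j%:R * - s); set z := expR _ => h.
rewrite -(ler_pM2l s0) mulrDr mulrA divff ?gt_eqF// mul1r; nra.
Qed.

End Count.

Lemma laplace_mark w a b x c : 0 <= c ->
  laplace_mx w (mark a b x c) ((c * expR (dot w (of_lattice R x))) *: delta_mx a b).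
Proof.
move=> c0 i j; rewrite !mxE; case: ifP => _; last by rewrite laplace0 mulr0.
by rewrite laplace_single// mulr1.
Qed.

Lemma laplace_scalar_single w k : 0 <= k -> laplace_mx w (scalar_single k) k%:M.
Proof.
move=> k0 i j; rewrite !mxE; case: eqP => _; last by rewrite !mulr0n laplace0.
by rewrite !mulr1n laplace_single// of_lattice0 dot0r expR0 mulr1.
Qed.

(** Reweighting the marks changes the transform in one entry only, which makes it a perturbation in
    a fixed direction. *)
Lemma laplace_marked w M F a b x c k : 0 <= c -> 0 <= k -> M a b x = c%:E ->
  laplace_mx w M F -> laplace_mx w (unmark M a b x + scalar_single k * mark a b x c)
    (F + ((k - 1) * (c * expR (dot w (of_lattice R x)))) *: delta_mx a b).
Proof.
move=> c0 k0 Mc MF; set E := mark _ _ _ _; set U := unmark _ _ _ _.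
pose D : 'M[R]_N := (c * expR (dot w (of_lattice R x))) *: delta_mx a b.
have ED : laplace_mx w E D by exact: laplace_mark.
(* The transform of the mark is finite, so it can be cancelled from that of [M]. *)
have UD : laplace_mx w U (F - D).
  move=> i j.
  have h : (laplace w (U i j) + (D i j)%:E)%E = (F i j)%:E.
    by rewrite -ED -laplaceD -MF -[in RHS](unmarkD c0 Mc) [in RHS]mxE.
  have -> : (F - D) i j = F i j - D i j by rewrite mxE [X in _ + X]mxE.
  by rewrite EFinB -h addeK.
have -> : F + ((k - 1) * (c * expR (dot w (of_lattice R x)))) *: delta_mx a b =
    (F - D) + k%:M * D.
  by rewrite -mulmxE mul_scalar_mx -scalerA -/D scalerBl scale1r addrAC addrA.
by apply: laplace_mxD => //; apply: laplace_mxM => //; exact: laplace_scalar_single.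
Qed.

Lemma laplace_nneg w M F : laplace_mx w M F -> nneg_mx F.
Proof. by move=> MF i j; rewrite -lee_fin -MF laplace_ge0. Qed.

End Marks.

(** * Exponential rates of the marked kernel *)

Section RealFacts.
Variable R : realType.

Lemma expR_sub1_le (z : R) : `|z| <= 1 -> `|expR z - 1| <= `|z| * (1 + expR 1).
Proof.
move=> z1; have /andP[h1 h2] := expR_taylor1 z.
have h3 : z ^+ 2 * expR `|z| <= `|z| * expR 1.
  rewrite -real_normK ?num_real// expr2 -mulrA ler_wpM2l// -[leRHS]mul1r.
  by rewrite ler_pM ?expR_ge0// ler_expR.
have -> : expR z - 1 = (expR z - 1 - z) + z by rewrite subrK.
rewrite (le_trans (ler_normD _ _))// ger0_norm// mulrDr mulr1 addrC lerD2l.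
exact: le_trans h2 h3.
Qed.

(** Turns decay per block of length [m] into decay per step. Bernoulli's inequality gives th^m >=
    theta for th = 1 - (1 - theta) / m, and n steps fit into (n + m) %/ m blocks. *)
Lemma pow_root_bound (theta : R) m : (0 < m)%N -> 0 <= theta < 1 ->
  exists2 th : R, 0 <= th < 1 & forall n, theta ^+ ((n + m) %/ m) <= th ^+ n.
Proof.
move=> m0 /andP[t0 t1].
have m0' : 0 < m%:R :> R by rewrite ltr0n.
have m1 : 1 <= m%:R :> R by rewrite ler1n.
pose th := 1 - (1 - theta) / m%:R.
have d0 : 0 < (1 - theta) / m%:R by rewrite divr_gt0// subr_gt0.
have d1 : (1 - theta) / m%:R <= 1 by rewrite ler_pdivrMr//; lra.
have th01 : 0 <= th < 1 by rewrite /th; apply/andP; split; lra.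
exists th => // n.
have bern k : 1 - (1 - theta) / m%:R * k%:R <= th ^+ k.
  elim: k => [|k IH]; first by rewrite mulr0 subr0 expr0.
  rewrite exprS; case/andP: th01 => th0 _.
  apply: le_trans (ler_wpM2l th0 IH); rewrite /th -natr1.
  move: ((1 - theta) / m%:R) d0 => D d0; rewrite -subr_ge0.
  have -> : (1 - D) * (1 - D * k%:R) - (1 - D * (k%:R + 1)) = D * D * k%:R by ring.
  by rewrite !mulr_ge0// ltW.
have thm : theta <= th ^+ m.
  by apply: le_trans (bern m); rewrite divfK ?gt_eqF//; lra.
apply: (@le_trans _ _ ((th ^+ m) ^+ ((n + m) %/ m))).
  by rewrite lerXn2r ?nnegrE// exprn_ge0//; case/andP: th01.
rewrite -exprM; case/andP: th01 => th0 /ltW th1.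
apply: ler_wiXn2l => //.
by rewrite divnDr// divnn m0 addn1 mulnC ltnW// ltn_ceil.
Qed.

Lemma expmx_le N (F G : 'M[R]_N) (c : R) m : nneg_mx F -> nneg_mx G -> 0 <= c ->
  (forall i j, G i j <= c * F i j) ->
  forall i j, (G ^+ m) i j <= c ^+ m * (F ^+ m) i j.
Proof.
move=> F0 G0 c0 GF; elim: m => [|m IH] i j; first by rewrite !expr0 mul1r.
rewrite !exprS -!mulmxE !mxE mulr_sumr; apply: ler_sum => k _.
rewrite mulrACA ler_pM ?G0//; exact: exp_nneg.
Qed.

End RealFacts.

Section Rates.
Variables (R : realType) (d N : nat) (p : kernel_on R d N).
Hypothesis N0 : (0 < N)%N.
Hypothesis pK : invariant_kernel p.
Hypothesis pI : strongly_irreducible p.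
Implicit Types (w : 'rV[R]_d).
Variables (u : 'rV[R]_d) (pi : 'rV[R]_N) (C : 'cV[R]_N).
Hypotheses (uF : Fdom p u) (pi0 : forall i, 0 < pi 0 i)
  (C0 : forall i, 0 < C i 0) (piF : pi *m Fmx p u = pi)
  (FC : Fmx p u *m C = C) (piC : (pi *m C) 0 0 = 1).

Local Notation P := (kernel_mx pK).
Let p0 : forall k j x y, 0 <= p k j x y := kernel_ge0 pK.

Lemma Fmx_exp_tilt m w e : 0 < e -> exists2 del, 0 < del & forall t,
  `|t| <= del -> Fdom p (u + t *: w) /\
  forall i j, (Fmx p (u + t *: w) ^+ m) i j <= (Fmx p u ^+ m) i j + e.
Proof.
move=> e0; pose S := \sum_i \sum_j (Fmx p u ^+ m) i j.
have Fm0 : nneg_mx (Fmx p u ^+ m) by apply: exp_nneg; exact: Fmx_ge0.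
have S0 : 0 <= S by apply: sumr_ge0 => i _; apply: sumr_ge0 => j _; exact: Fm0.
pose eta := e / (S + 1).
have eta0 : 0 < eta by rewrite divr_gt0// ltr_wpDl.
(* Chosen so that (1 + e1)^m <= e^(m e1) <= 1 + eta; the successor avoids dividing by zero. *)
pose e1 := ln (1 + eta) / m.+1%:R.
have l0 : 0 < ln (1 + eta) by rewrite ln_gt0// ltrDl.
have e10 : 0 < e1 by rewrite divr_gt0.
have [del del0 h] := Fmx_upper pK w uF e10.
exists del => // t /h[tF Fle]; split => // i j.
have e1' : 0 <= 1 + e1 by rewrite addr_ge0// ltW.
apply: le_trans (expmx_le m (Fmx_ge0 p0 u) (Fmx_ge0 p0 _) e1' Fle i j) _.
have b : (1 + e1) ^+ m <= 1 + eta.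
  apply: (@le_trans _ _ (expR e1 ^+ m)).
    by rewrite lerXn2r ?nnegrE ?expR_ge0// expR_ge1Dx.
  have -> : 1 + eta = expR (ln (1 + eta)) by rewrite lnK// posrE ltr_wpDr// ltW.
  rewrite -expRM_natl ler_expR /e1 mulrA ler_pdivrMr// mulrC ler_wpM2l ?(ltW l0)//.
  by rewrite ler_nat.
have FS : (Fmx p u ^+ m) i j <= S.
  rewrite /S (bigD1 i)//= (bigD1 j)//= -addrA lerDl addr_ge0 ?sumr_ge0// => k _.
  by apply: sumr_ge0.
have h1 : (1 + e1) ^+ m * (Fmx p u ^+ m) i j <= (1 + eta) * (Fmx p u ^+ m) i j.
  by rewrite ler_wpM2r.
have h2 : eta * (Fmx p u ^+ m) i j <= e.
  apply: (@le_trans _ _ (eta * (S + 1))); last by rewrite divfK// gt_eqF// ltr_wpDl.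
  by rewrite ler_wpM2l ?(ltW eta0)//; lra.
lra.
Qed.

(** Reweighting the marks by e^(sg s) moves the eigenvalue 1 of F(u)^m with derivative [mu]. The
    level mu + sg eps then leaves a gap of order s eps, part of which is spent on tilting [u] by k
    w. The sign [sg] treats both tails at once. *)
Lemma chernoff_rate m a b (x : 'rV[int]_d) c (sg eps : R) w : (0 < m)%N -> 0 <= c ->
  `|sg| = 1 -> 0 < eps ->
  let mu := c * expR (dot u (of_lattice R x)) * (pi 0 a * C b 0) in
  exists s k (v : 'cV[R]_N) rho, [/\ 0 < s, 0 < k, forall i, 0 < v i 0,
     rho * expR (- (sg * s * (mu + sg * eps))) < 1 &
     Fdom p (u + k *: w) /\
    forall i, ((Fmx p (u + k *: w) ^+ m + ((expR (sg * s) - 1) *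
      (c * expR (dot (u + k *: w) (of_lattice R x)))) *: delta_mx a b) *m v) i 0
      <= rho * v i 0].
Proof.
have aux0 (r s e : R) : 0 <= e -> r <= s + e -> r + 0 <= s + 0 + 2 * e by lra.
have aux1 (r s r' s' e : R) : r <= s + e -> r' - s' <= e -> r + r' <= s + s' + 2 * e.
  by lra.
move=> m0 c0 sg1 eps0 mu.
pose beta := c * expR (dot u (of_lattice R x)).
have beta0 : 0 <= beta by rewrite mulr_ge0// expR_ge0.
pose A := Fmx p u ^+ m; pose B : 'M[R]_N := beta *: delta_mx a b.
have uniq r : r *m A = r -> exists c, r = c *: pi.
  by apply: (Fmx_exp_unique N0 pK pI uF pi0 piF).
have AC : A *m C = C.
  rewrite /A; elim: m {m0 A uniq} => [|m IH]; first by rewrite expr0 mul1mx.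
  by rewrite exprSr -mulmxE -mulmxA FC.
have muE : (pi *m B *m C) 0 0 = mu.
  rewrite /B -scalemxAr -scalemxAl mxE /mu -/beta; congr (_ * _).
  rewrite -mulmxA -(mul_delta_mx (0 : 'I_1)) -!mulmxA !mulmxA -colE -mulmxA -rowE.
  by rewrite mxE big_ord1 !mxE.
have [g hg] := eigen_perturb B N0 uniq AC C0 piC.
have eps4 : 0 < eps / 4 by rewrite divr_gt0.
have [del del0 {}hg] := hg _ eps4; rewrite muE in hg.
pose E1 : R := expR 1.
have E10 : 0 < E1 by exact: expR_gt0.
have Eb : 0 < E1 * beta + 1 by rewrite ltr_wpDl// mulr_ge0// ltW.
pose s := Order.min 1 (Order.min del (del / (E1 * beta + 1))).
have s0 : 0 < s by rewrite !lt_min ltr01 del0 divr_gt0.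
have [s1 s2 s3] : [/\ s <= 1, s <= del & s <= del / (E1 * beta + 1)].
  by have : s <= s by []; rewrite {2}/s !le_min => /and3P[].
pose t := sg * s.
have tn : `|t| = s by rewrite normrM sg1 mul1r gtr0_norm.
have [|i j|v0 vb] := hg (A + (expR t - 1) *: B) t; first by rewrite tn.
  have -> : (A + (expR t - 1) *: B) i j = A i j + (expR t - 1) * B i j.
    by rewrite mxE [X in _ + X]mxE.
  have -> : A i j + (expR t - 1) * B i j - A i j - t * B i j =
    (expR t - 1 - t) * B i j by ring.
  have /andP[e1 e2] := expR_taylor1 t.
  rewrite normrM ger0_norm//.
  have Bb : `|B i j| <= beta.
    by rewrite !mxE; case: (_ && _); rewrite ?mulr1 ?mulr0 ?normr0 ?ger0_norm.
  have e3 : t ^+ 2 * expR `|t| <= s * s * E1.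
    rewrite -real_normK ?num_real// tn expr2 ler_wpM2l ?mulr_ge0 ?(ltW s0)//.
    by rewrite ler_expR.
  have e4 : s * (E1 * beta) <= del.
    by move: s3; rewrite ler_pdivlMr//; lra.
  rewrite tn; apply: (@le_trans _ _ (s * s * E1 * beta)).
    by rewrite ler_pM// (le_trans e2).
  rewrite (_ : _ * beta = s * (E1 * beta) * s); last by ring.
  by rewrite ler_wpM2r// ltW.
set v := C + t *: g in v0 vb.
have [vm vm0 vmle] := pos_lower_bound v0.
pose Sv := \sum_i v i 0.
have Sv0 : 0 <= Sv by apply: sumr_ge0 => i _; rewrite ltW.
(* Of the margin eps s, one quarter went to the expansion above and this second quarter is reserved
   for the tilt. *)
pose gap := eps / 4 * s * vm.
have gap0 : 0 < gap by rewrite !mulr_gt0.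
pose e2 := gap / (2 * (Sv + 1)).
have Sv1 : 0 < 2 * (Sv + 1) by rewrite mulr_gt0// ltr_wpDl.
have e20 : 0 < e2 by rewrite divr_gt0.
have [del2 del20 htilt] := Fmx_exp_tilt m w e20.
pose om := dot w (of_lattice R x).
have om1 : 0 < `|om| + 1 by rewrite ltr_wpDl.
pose Q := `|expR t - 1| * beta.
have Q0 : 0 <= Q by rewrite mulr_ge0.
have Q1 : 0 < (Q + 1) * ((`|om| + 1) * (1 + E1)).
  by rewrite !mulr_gt0// ltr_wpDl// ltW.
(* The three bounds control the powers of the tilted F, keep k w.x in [-1, 1], and limit the change
   of the marked entry to [e2]. *)
pose k := Order.min del2 (Order.min (1 / (`|om| + 1)) (e2 / ((Q + 1) * ((`|om| + 1) * (1 + E1))))).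
have k0 : 0 < k by rewrite !lt_min del20 !divr_gt0.
have [k1 k2 k3] : [/\ k <= del2, k <= 1 / (`|om| + 1) &
    k <= e2 / ((Q + 1) * ((`|om| + 1) * (1 + E1)))].
  by have : k <= k by []; rewrite {2}/k !le_min => /and3P[].
have [|kF Fk] := htilt k; first by rewrite gtr0_norm.
have om2 : k * `|om| <= 1.
  move: k2; rewrite ler_pdivlMr// mulrDr mulr1; have := ltW k0; lra.
have hQ : Q * `|expR (k * om) - 1| <= e2.
  have z1 : `|k * om| <= 1 by rewrite normrM gtr0_norm.
  have h1 := expR_sub1_le z1.
  have h2 : `|k * om| * (1 + expR 1) <= k * ((`|om| + 1) * (1 + E1)).
    rewrite normrM (gtr0_norm k0) -mulrA ler_wpM2l ?(ltW k0)//.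
    by apply: ler_wpM2r; [rewrite addr_ge0// ltW|rewrite lerDl].
  have h3 : k * ((Q + 1) * ((`|om| + 1) * (1 + E1))) <= e2 by rewrite -ler_pdivlMr.
  apply: (@le_trans _ _ ((Q + 1) * (k * ((`|om| + 1) * (1 + E1))))).
    by apply: ler_pM => //; [rewrite lerDl|exact: le_trans h1 h2].
  by rewrite mulrCA.
(* This [rho] stays below 1 + t mu + s eps, hence below e^(t (mu + sg eps)). *)
exists s, k, v, (1 + t * mu + eps / 2 * s); split => //.
  rewrite expRN -/t ltr_pdivrMr ?expR_gt0// mul1r.
  apply: lt_le_trans (expR_ge1Dx _).
  have -> : t * (mu + sg * eps) = t * mu + s * eps.
    have sg2 : sg * sg = 1 by rewrite -expr2 -real_normK ?num_real// sg1 expr1n.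
    rewrite mulrDr; congr (_ + _); rewrite /t.
    by transitivity (sg * sg * (s * eps)); [ring|rewrite sg2 mul1r].
  have : 0 < s * eps by rewrite mulr_gt0.
  by lra.
split => // i; rewrite -/t.
set G := (X in X *m v).
have GA j : G i j <= (A + (expR t - 1) *: B) i j + 2 * e2.
  pose D : R := (delta_mx a b : 'M[R]_N) i j.
  have -> : G i j = (Fmx p (u + k *: w) ^+ m) i j + (expR t - 1) *
      (c * expR (dot (u + k *: w) (of_lattice R x))) * D.
    by rewrite /G mxE [X in _ + X]mxE.
  have -> : (A + (expR t - 1) *: B) i j = A i j + (expR t - 1) * (beta * D).
    by rewrite mxE [X in _ + X]mxE /B [X in _ * X]mxE.
  have h1 := Fk i j; rewrite dotDl dotZl -/om expRD.
  have h2 : (expR t - 1) * (c * (expR (dot u (of_lattice R x)) * expR (k * om))) -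
     (expR t - 1) * beta <= e2.
    apply: le_trans hQ; rewrite /Q; apply: le_trans (ler_norm _) _.
    rewrite -[beta in leRHS](ger0_norm beta0) -!normrM /beta.
    by rewrite le_eqVlt; apply/orP; left; apply/eqP; congr `|_|; ring.
  have -> : D = ((i == a) && (j == b))%:R by rewrite /D mxE.
  by case: (_ && _); rewrite ?mulr1 ?mulr0;
    [exact: aux1 h1 h2|exact: aux0 (ltW e20) h1].
have := vb i => /andP[_]; rewrite tn => hv.
have hG : (G *m v) i 0 <= ((A + (expR t - 1) *: B) *m v) i 0 + 2 * e2 * Sv.
  rewrite mxE [X in _ <= X + _]mxE mulr_sumr -big_split/=; apply: ler_sum => j _.
  by rewrite -mulrDl ler_wpM2r ?(ltW (v0 _)).
have hgap : 2 * e2 * Sv <= gap.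
  rewrite -[leRHS](divfK (_ : 2 * (Sv + 1) != 0)) ?gt_eqF// -/e2.
  have := ltW e20; clear -Sv0; nra.
have hvm : gap <= eps / 4 * s * v i 0.
  by apply: ler_wpM2l (vmle i); rewrite mulr_ge0// ltW.
apply: le_trans hG _; apply: le_trans (lerD hv hgap) _.
apply: le_trans (lerD (lexx _) hvm) _.
rewrite -mulrDl ler_wpM2r ?(ltW (v0 i))//; lra.
Qed.

End Rates.

(** * Two-sided bounds on the Green function *)

Section Green.
Variables (R : realType) (d N : nat) (p : kernel_on R d N).
Hypothesis N0 : (0 < N)%N.
Hypothesis pK : invariant_kernel p.
Hypothesis pI : strongly_irreducible p.
Implicit Types (w : 'rV[R]_d).

Local Notation P := (kernel_mx pK).
Let p0 : forall k j x y, 0 <= p k j x y := kernel_ge0 pK.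

Definition gsum (i j : 'I_N) (y : 'rV[int]_d) : \bar R :=
  (\sum_(0 <= n <oo) (P ^+ n)%R i j y)%E.
Definition tsum (y : 'rV[int]_d) : \bar R :=
  (\sum_(0 <= n <oo) (\tr (P ^+ n))%R y)%E.

Lemma gsum_ge0 i j y : (0 <= gsum i j y)%E.
Proof. by apply: nneseries_ge0 => n _; rewrite cval_ge0. Qed.

Lemma tsum_ge0 y : (0 <= tsum y)%E.
Proof. by apply: nneseries_ge0 => n _; rewrite cval_ge0. Qed.

Lemma greenE k j x y : green p k j x y = gsum k j (y - x).
Proof. by apply: eq_eseriesr => n _; rewrite (kernel_powE pK). Qed.

Variables (u : 'rV[R]_d) (pi : 'rV[R]_N) (C : 'cV[R]_N).
Hypotheses (uF : Fdom p u) (pi0 : forall i, 0 < pi 0 i)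
  (C0 : forall i, 0 < C i 0) (piF : pi *m Fmx p u = pi)
  (FC : Fmx p u *m C = C) (piC : (pi *m C) 0 0 = 1).

Section Decay.
Variables (m : nat) (a b : 'I_N) (x : 'rV[int]_d) (c : R).
Hypotheses (m0 : (0 < m)%N) (c0 : 0 <= c) (Pc : (P ^+ m) a b x = c%:E).

Let mu := c * expR (dot u (of_lattice R x)) * (pi 0 a * C b 0).
Let marked k := unmark (P ^+ m) a b x + scalar_single d N k * mark a b x c.

(** The error terms of [count_upper] and [count_lower], summable in n and gaining the tilt in y. The
    second clause, with the same [k] and [K], is for the first [m] terms of [tsum], which the
    shifted exponents n + m do not reach. *)
Lemma marked_decay (sg eps : R) w : `|sg| = 1 -> 0 < eps ->
  exists s k K th, [/\ 0 < s, 0 < k, 0 <= K, 0 <= th < 1 &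
    (forall n y, (expR (- (sg * s * (((n + m) %/ m)%:R * (mu + sg * eps)))))%:E *
      (\tr (marked (expR (sg * s)) ^+ ((n + m) %/ m) * P ^+ ((n + m) %% m)))%R y <=
       (K * th ^+ n * expR (- dot (u + k *: w) (of_lattice R y)))%:E)%E /\
    (forall n y, (n < m)%N -> (\tr (P ^+ n))%R y <=
       (K * expR (- dot (u + k *: w) (of_lattice R y)))%:E)%E].
Proof.
move=> sg1 eps0.
have [s [k [v [rho [s0 k0 v0 rhoe [kF hv]]]]]] :=
  chernoff_rate N0 pK pI uF pi0 C0 piF FC piC a b x w m0 c0 sg1 eps0.
rewrite -/mu in rhoe.
set F' := Fmx p (u + k *: w) in hv.
set G' := (X in X *m v) in hv.
have LF : laplace_mx (u + k *: w) P F' by exact: laplace_Fmx.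
have LG : laplace_mx (u + k *: w) (marked (expR (sg * s))) G'.
  by apply: laplace_marked => //; exact: laplace_mxX.
have G0 := laplace_nneg LG; have F0 := laplace_nneg LF.
have rho0 : 0 <= rho.
  pose i0 := Ordinal N0.
  have : 0 <= rho * v i0 0.
    apply: le_trans (hv i0); rewrite mxE; apply: sumr_ge0 => j _.
    by rewrite mulr_ge0 ?G0// ltW.
  by rewrite pmulr_lge0.
(* A crude growth rate of the tilted F; it is raised only to exponents at most [m]. *)
pose K0 := 1 + \sum_i (F' *m v) i 0 / v i 0.
have q0 i : 0 <= (F' *m v) i 0 / v i 0.
  rewrite divr_ge0 ?(ltW (v0 _))// mxE; apply: sumr_ge0 => j _.
  by rewrite mulr_ge0 ?F0// ltW.
have K01 : 1 <= K0 by rewrite lerDl; apply: sumr_ge0.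
have FK i : (F' *m v) i 0 <= K0 * v i 0.
  rewrite -ler_pdivrMr// /K0 (bigD1 i)//= addrCA lerDl addr_ge0//.
  by apply: sumr_ge0.
have K00 : 0 <= K0 by apply: le_trans K01.
have Kt t : (t <= m)%N -> K0 ^+ t <= K0 ^+ m by move=> tm; apply: ler_weXn2l.
pose theta := rho * expR (- (sg * s * (mu + sg * eps))).
have theta01 : 0 <= theta < 1 by rewrite rhoe andbT mulr_ge0 ?expR_ge0.
have [th th01 hth] := pow_root_bound m0 theta01.
have NK : 0 <= N%:R * K0 ^+ m by rewrite mulr_ge0// exprn_ge0.
exists s, k, (N%:R * K0 ^+ m), th; split => //; split => [n y|n y nm]; last first.
  apply: le_trans (trace_upper y (laplace_mxX n LF) (exp_nneg n F0) v0 (supersolution_exp n F0 K00 FK)) _.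
  by rewrite lee_fin ler_wpM2r ?expR_ge0// ler_wpM2l// Kt// ltnW.
set q := ((n + m) %/ m)%N; set t := ((n + m) %% m)%N.
have LX := laplace_mxM (laplace_mxX q LG) (laplace_mxX t LF).
have sup i : ((G' ^+ q * F' ^+ t) *m v) i 0 <= (rho ^+ q * K0 ^+ t) * v i 0.
  rewrite -mulmxE -mulmxA mxE.
  apply: (@le_trans _ _ (\sum_j (G' ^+ q) i j * (K0 ^+ t * v j 0))).
    apply: ler_sum => j _; rewrite ler_wpM2l ?exp_nneg//.
    exact: supersolution_exp.
  under eq_bigr do rewrite mulrCA; rewrite -mulr_sumr mulrAC -mulrA [leRHS]mulrCA.
  rewrite [leRHS]mulrC -[leRHS]mulrA [leRHS]mulrCA.
  rewrite ler_wpM2l ?exprn_ge0//.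
  by have := supersolution_exp q G0 rho0 hv i; rewrite mxE mulrC.
apply: le_trans (lee_wpmul2l _ (trace_upper y LX (laplace_nneg LX) v0 sup)) _.
  by rewrite lee_fin expR_ge0.
rewrite -EFinM lee_fin [leLHS]mulrA ler_wpM2r ?expR_ge0//.
have -> : expR (- (sg * s * (q%:R * (mu + sg * eps)))) =
    expR (- (sg * s * (mu + sg * eps))) ^+ q.
  by rewrite -expRM_natl; congr expR; ring.
rewrite [leLHS](_ : _ = N%:R * K0 ^+ t * theta ^+ q); last first.
  by rewrite /theta exprMn; ring.
apply: ler_pM => //.
- by rewrite mulr_ge0// exprn_ge0.
- by rewrite exprn_ge0//; case/andP: theta01.
- by rewrite ler_wpM2l// Kt// ltnW// ltn_pmod.
- exact: hth.
Qed.

Lemma geometric_le (th : R) : 0 <= th < 1 ->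
  (\sum_(0 <= n <oo) (th ^+ n)%:E <= ((1 - th)^-1)%:E)%E.
Proof.
move=> /andP[th0 th1]; apply: lime_le.
  by apply: is_cvg_nneseries => n _; rewrite lee_fin exprn_ge0.
apply: nearW => n; rewrite sumEFin lee_fin big_mkord.
have h : (1 - th) * \sum_(i < n) th ^+ i = 1 - th ^+ n.
  by have := subrX1 th n; rewrite mulrBl => e1; rewrite mulrBl mul1r; lra.
rewrite -div1r ler_pdivlMr ?subr_gt0// mulrC h.
by rewrite lerBlDr lerDl exprn_ge0.
Qed.

(** The quotient of n + m rather than of n guarantees a factor to mark: removing one block gives
    P^n, keeping all gives P^(n + m). *)
Let step n : (P ^+ m) ^+ ((n + m) %/ m).-1 * P ^+ ((n + m) %% m) = P ^+ n.
Proof.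
rewrite -exprM -exprD; congr (_ ^+ _).
by rewrite divnDr// divnn m0 addn1/= modnDr mulnC -divn_eq.
Qed.

Let step' n : (P ^+ m) ^+ ((n + m) %/ m) * P ^+ ((n + m) %% m) = P ^+ (n + m).
Proof. by rewrite -exprM -exprD mulnC -divn_eq. Qed.

Let comm n : P ^+ m * P ^+ n = P ^+ n * P ^+ m.
Proof. by rewrite -!exprD addnC. Qed.

Let qpos n : (0 < (n + m) %/ m)%N.
Proof. by rewrite divn_gt0// leq_addl. Qed.

Lemma tsum_split y : tsum y = (\sum_(0 <= n < m) (\tr (P ^+ n))%R y +
  \sum_(0 <= n <oo) (\tr (P ^+ (n + m)))%R y)%E.
Proof.
rewrite (@nneseries_addn _ (fun n => (\tr (P ^+ n))%R y)); last first.
  by move=> n; rewrite cval_ge0.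
by rewrite /tsum (nneseries_split 0%N m) ?add0n// => n _; rewrite cval_ge0.
Qed.

Lemma tail_tsum y : (\sum_(0 <= n <oo) (\tr (P ^+ (n + m)))%R y <= tsum y)%E.
Proof.
by rewrite tsum_split leeDr// sume_ge0// => n _; rewrite cval_ge0.
Qed.

(** [count_upper] at level q (mu + eps), divided by q and summed over n; the traces on the right
    form a tail of [tsum]. *)
Lemma green_upper eps w : 0 < eps -> exists k B, [/\ 0 < k, 0 <= B &
  forall y, (c%:E * gsum b a (y - x)%R <= (mu + eps)%:E * tsum y +
    (B * expR (- dot (u + k *: w) (of_lattice R y)))%:E)%E].
Proof.
move=> eps0; have [|s [k [K [th [s0 k0 K0 th01 [hd _]]]]]] := @marked_decay 1 eps w _ eps0.
  by rewrite normr1.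
case/andP: (th01) => th0 th1.
have mu0 : 0 <= mu.
  by rewrite mulr_ge0 ?mulr_ge0 ?expR_ge0// ltW.
have al0 : 0 <= mu + eps by rewrite addr_ge0// ltW.
exists k, (s^-1 * K * (1 - th)^-1); split => // [|y].
  by rewrite mulr_ge0 ?invr_ge0 ?subr_ge0 ?(ltW th1)// mulr_ge0// invr_ge0 ltW.
set Ey := expR _; have Ey0 : 0 <= Ey by exact: expR_ge0.
have pt n : (c%:E * (P ^+ n)%R b a (y - x)%R <=
    (mu + eps)%:E * (\tr (P ^+ (n + m)))%R y + (s^-1 * K * Ey)%:E * (th ^+ n)%:E)%E.
  set q := ((n + m) %/ m)%N.
  have q0 : 0 < q%:R :> R by rewrite ltr0n qpos.
  have A0 : 0 <= q%:R * (mu + eps) by rewrite mulr_ge0// ltW.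
  have := count_upper y q c0 Pc (comm ((n + m) %% m)) A0 s0.
  rewrite step step' => h.
  have hd' := hd n y; rewrite !mul1r in hd'.
  rewrite -(@lee_pmul2l _ q%:R%:E)%E ?lte_fin// muleA -EFinM.
  apply: le_trans h _; rewrite ge0_muleDr; last 2 first.
  - by rewrite mule_ge0 ?cval_ge0.
  - by rewrite mule_ge0// lee_fin ?exprn_ge0// !mulr_ge0 ?invr_ge0 ?(ltW s0).
  rewrite muleA -EFinM leeD2l// EFinM -muleA.
  apply: le_trans (lee_wpmul2l _ hd') _; first by rewrite lee_fin invr_ge0 ltW.
  rewrite -!EFinM lee_fin.
  rewrite [leLHS](_ : _ = s^-1 * K * Ey * th ^+ n); last by rewrite /Ey; ring.
  (* The error carries no factor q, so dividing by q >= 1 only improves it. *)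
  rewrite ler_peMl ?ler1n ?qpos//.
  by rewrite !mulr_ge0 ?invr_ge0 ?(ltW s0)// exprn_ge0.
rewrite /gsum -nneseriesZl; last by move=> n _; rewrite cval_ge0.
apply: le_trans (lee_nneseries _ (fun n _ => pt n)) _.
  by move=> n _; rewrite mule_ge0 ?cval_ge0.
have sK0 : 0 <= s^-1 * K * Ey by rewrite !mulr_ge0 ?invr_ge0 ?(ltW s0).
rewrite nneseriesD; last 2 first.
- by move=> n _; rewrite mule_ge0 ?cval_ge0.
- by move=> n _; rewrite mule_ge0 ?lee_fin ?exprn_ge0.
rewrite !nneseriesZl; last 2 first.
- by move=> n _; rewrite lee_fin exprn_ge0.
- by move=> n _; rewrite cval_ge0.
apply: leeD; first by apply: lee_wpmul2l; [rewrite lee_fin|exact: tail_tsum].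
apply: le_trans (lee_wpmul2l _ (geometric_le th01)) _; first by rewrite lee_fin.
by rewrite -EFinM lee_fin mulrAC.
Qed.

(** The assumption on [eps] keeps the level q (mu - eps) nonnegative. Here the first [m] terms of
    [tsum] are on the side to be bounded, whence the second summand of the constant. *)
Lemma green_lower eps w : 0 < eps -> eps <= mu -> exists k B, [/\ 0 < k, 0 <= B &
  forall y, ((mu - eps)%:E * tsum y <= c%:E * gsum b a (y - x)%R +
    (B * expR (- dot (u + k *: w) (of_lattice R y)))%:E)%E].
Proof.
move=> eps0 epsmu.
have [|s [k [K [th [s0 k0 K0 th01 [hd hm]]]]]] := @marked_decay (-1) eps w _ eps0.
  by rewrite normrN1.
case/andP: (th01) => th0 th1.
have al0 : 0 <= mu - eps by rewrite subr_ge0.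
exists k, (s^-1 * K * (1 - th)^-1 + (mu - eps) * (m%:R * K)); split => // [|y].
  rewrite addr_ge0// ?mulr_ge0 ?invr_ge0 ?subr_ge0 ?(ltW th1)//.
  by rewrite ltW.
set Ey := expR _; have Ey0 : 0 <= Ey by exact: expR_ge0.
have pt n : ((mu - eps)%:E * (\tr (P ^+ (n + m)))%R y <= 
    c%:E * (P ^+ n)%R b a (y - x)%R + (s^-1 * K * Ey)%:E * (th ^+ n)%:E)%E.
  set q := ((n + m) %/ m)%N.
  have q0 : 0 < q%:R :> R by rewrite ltr0n qpos.
  have A0 : 0 <= q%:R * (mu - eps) by rewrite mulr_ge0// ltW.
  have := count_lower y q c0 Pc (comm ((n + m) %% m)) A0 s0.
  rewrite step step' => h.
  have hd' := hd n y; rewrite !mulN1r !mulNr opprK in hd'.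
  rewrite -(@lee_pmul2l _ q%:R%:E)%E ?lte_fin// muleA -EFinM.
  apply: le_trans h _; rewrite ge0_muleDr; last 2 first.
  - by rewrite mule_ge0 ?cval_ge0.
  - by rewrite mule_ge0// lee_fin ?exprn_ge0// !mulr_ge0 ?invr_ge0 ?(ltW s0).
  rewrite muleA -EFinM leeD2l// EFinM -muleA.
  apply: le_trans (lee_wpmul2l _ hd') _; first by rewrite lee_fin invr_ge0 ltW.
  rewrite -!EFinM lee_fin.
  rewrite [leLHS](_ : _ = s^-1 * K * Ey * th ^+ n); last by rewrite /Ey; ring.
  rewrite ler_peMl ?ler1n ?qpos//.
  by rewrite !mulr_ge0 ?invr_ge0 ?(ltW s0)// exprn_ge0.
have sK0 : 0 <= s^-1 * K * Ey by rewrite !mulr_ge0 ?invr_ge0 ?(ltW s0).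
have tail : ((mu - eps)%:E * \sum_(0 <= n <oo) (\tr (P ^+ (n + m)))%R y <=
   c%:E * gsum b a (y - x)%R + (s^-1 * K * Ey * (1 - th)^-1)%:E)%E.
  rewrite -nneseriesZl; last by move=> n _; rewrite cval_ge0.
  apply: le_trans (lee_nneseries _ (fun n _ => pt n)) _.
    by move=> n _; rewrite mule_ge0 ?cval_ge0.
  rewrite nneseriesD; last 2 first.
  - by move=> n _; rewrite mule_ge0 ?cval_ge0.
  - by move=> n _; rewrite mule_ge0 ?lee_fin ?exprn_ge0.
  rewrite !nneseriesZl; last 2 first.
  - by move=> n _; rewrite lee_fin exprn_ge0.
  - by move=> n _; rewrite cval_ge0.
  apply: leeD2l.
  apply: le_trans (lee_wpmul2l _ (geometric_le th01)) _; first by rewrite lee_fin.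
  by rewrite -EFinM lee_fin.
have head : (\sum_(0 <= n < m) (\tr (P ^+ n))%R y <= (m%:R * K * Ey)%:E)%E.
  rewrite big_mkord; apply: le_trans (lee_sum _ (fun (n : 'I_m) _ => hm n y (ltn_ord n))) _.
  by rewrite sumEFin lee_fin sumr_const card_ord -/Ey -[leLHS]mulr_natl mulrA.
rewrite tsum_split.
rewrite ge0_muleDr; last 2 first.
- by apply: sume_ge0 => n _; rewrite cval_ge0.
- by apply: nneseries_ge0 => n _; rewrite cval_ge0.
apply: le_trans (leeD (lee_wpmul2l _ head) tail) _; first by rewrite lee_fin.
rewrite addeC -addeA leeD2l// -EFinM -EFinD lee_fin.
by rewrite le_eqVlt; apply/orP; left; apply/eqP; ring.
Qed.

End Decay.
End Green.

(** * Lower bound on the Green function *)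

Section Lower.
Variables (R : realType) (d N : nat) (p : kernel_on R d N).
Hypothesis N0 : (0 < N)%N.
Hypothesis pK : invariant_kernel p.
Hypothesis pI : strongly_irreducible p.
Implicit Types (w : 'rV[R]_d).

Local Notation P := (kernel_mx pK).
Let p0 : forall k j x y, 0 <= p k j x y := kernel_ge0 pK.

Lemma gsum_ge n i k j x y :
  ((P ^+ n)%R i k x * gsum pK k j y <= gsum pK i j (x + y)%R)%E.
Proof.
rewrite /gsum nneseries_esumT => [|l]; last by rewrite cval_ge0.
rewrite -esumZ ?cval_ge0// => [|l]; last by rewrite cval_ge0.
rewrite -nneseries_esumT => [|l]; last by rewrite mule_ge0 ?cval_ge0.
rewrite [leRHS](nneseries_split 0%N n) ?add0n => [|l _]; last by rewrite cval_ge0.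
rewrite -(@nneseries_addn _ (fun l => (P ^+ l)%R i j (x + y)%R)) => [|l]; last first.
  by rewrite cval_ge0.
apply: (@le_trans _ _ (\sum_(0 <= l <oo) (P ^+ (l + n))%R i j (x + y)%R)%E).
  apply: lee_nneseries => [l _ _|l _]; first by rewrite mule_ge0 ?cval_ge0.
  by rewrite addnC exprD; exact: le_mulmx_convfun.
by rewrite leeDr// sume_ge0// => l _; rewrite cval_ge0.
Qed.

Lemma ereal_gt0_lower (z : \bar R) : (0 < z)%E -> exists2 r : R, 0 < r & (r%:E <= z)%E.
Proof.
case: z => [r| |]//; first by rewrite lte_fin => r0; exists r.
by move=> _; exists 1; rewrite ?leey.
Qed.

Definition lnorm1 (y : 'rV[int]_d) : nat := (\sum_i `|y 0%R i|)%N.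

(** For each state and each signed unit vector, irreducibility provides a path of positive weight
    returning to the state; walking to [y] coordinate by coordinate uses [lnorm1 y] of them. *)
Lemma gsum_lower : exists k0 k : R, [/\ 0 < k0, 0 < k & forall i j y,
  ((k0 * k ^+ lnorm1 y)%:E <= gsum pK i j y)%E].
Proof.
pose es (l : 'I_d) (sg : bool) : 'rV[int]_d := (-1) ^+ sg *: delta_mx 0 l.
have hk (z : 'I_N * 'I_d * bool) : exists r : R, 0 < r /\ exists n,
    (r%:E <= (P ^+ n)%R z.1.1 z.1.1 (es z.1.2 z.2))%E.
  have [n hn] := irr_conv pK pI z.1.1 z.1.1 (es z.1.2 z.2).
  have [r r0 hr] := ereal_gt0_lower (hn n (leqnn n)).
  by exists r; split => //; exists n.
pose r z := sval (cid (hk z)).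
have r0 z : 0 < r z by rewrite /r; case: cid => ? [].
have rP z : exists n, ((r z)%:E <= (P ^+ n)%R z.1.1 z.1.1 (es z.1.2 z.2))%E.
  by rewrite /r; case: cid => ? [].
have [k k0 kle] := pos_lower_bound r0.
have hk0 (z : 'I_N * 'I_N) : exists r : R, 0 < r /\
    (r%:E <= gsum pK z.1 z.2 0%R)%E.
  have [n hn] := irr_conv pK pI z.1 z.2 0.
  have [s s0 hs] := ereal_gt0_lower (hn n (leqnn n)).
  exists s; split => //; apply: le_trans hs _.
  rewrite /gsum (nneseries_split 0%N n.+1) => [|l _]; last by rewrite cval_ge0.
  rewrite add0n big_nat_recr//= -addeA addeCA leeDl// adde_ge0//.
    by apply: sume_ge0 => l _; rewrite cval_ge0.
  by apply: nneseries_ge0 => l _; rewrite cval_ge0.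
pose r' z := sval (cid (hk0 z)).
have r'0 z : 0 < r' z by rewrite /r'; case: cid => ? [].
have r'P z : ((r' z)%:E <= gsum pK z.1 z.2 0%R)%E by rewrite /r'; case: cid => ? [].
have [k' k'0 k'le] := pos_lower_bound r'0.
exists k', k; split => // i j y.
have [n] := ubnP (lnorm1 y); elim: n y => // n IH y yn.
have [y0|/rV0Pn[l yl]] := eqVneq y 0.
  rewrite y0 /lnorm1 big1 ?expr0 ?mulr1 => [|l _]; last by rewrite mxE.
  by apply: le_trans (r'P (i, j)); rewrite lee_fin.
pose sg := y 0 l < 0.
pose y' := y - es l sg.
have y'E : y = es l sg + y' by rewrite addrC subrK.
have ln : lnorm1 y = (lnorm1 y').+1.
  rewrite /lnorm1 (bigD1 l)//= [in RHS](bigD1 l)//= -addSn; congr (_ + _)%N.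
    rewrite !mxE !eqxx mulr1 /sg; case: ltrP => h; rewrite ?expr0 ?expr1.
      by move: (y 0 l) h => z h; lia.
    by move: (y 0 l) h yl => z h yl; lia.
  apply: eq_bigr => t /negPf tl; congr (absz _).
  by rewrite !mxE tl andbF mulr0 subr0.
rewrite ln exprS mulrCA EFinM y'E.
have [m hm] := rP (i, l, sg).
apply: le_trans (gsum_ge m i i j (es l sg) y').
apply: lee_pmul; rewrite ?lee_fin ?(ltW k0) ?mulr_ge0 ?(ltW k'0) ?exprn_ge0 ?(ltW k0)//.
- by apply: le_trans hm; rewrite lee_fin.
- by apply: IH; rewrite -ltnS -ln.
Qed.

End Lower.

(** * Law of large numbers for the Doob transform *)

Section LLN.
Variables (R : realType) (d N : nat) (p : kernel_on R d N).
Hypothesis N0 : (0 < N)%N.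
Hypothesis pK : invariant_kernel p.
Hypothesis pI : strongly_irreducible p.
Implicit Types (w : 'rV[R]_d).

Local Notation P := (kernel_mx pK).
Let p0 : forall k j x y, 0 <= p k j x y := kernel_ge0 pK.

(** Decomposition at the position after [n] steps; the paths shorter than [n] account for the
    inequality. *)
Lemma gsum_chain n i j y :
  (\sum_k \esum_(z in [set: 'rV[int]_d]) ((P ^+ n)%R i k z * gsum pK k j (y - z)%R)
     <= gsum pK i j y)%E.
Proof.
have E k : (\esum_(z in [set: 'rV[int]_d]) ((P ^+ n)%R i k z * gsum pK k j (y - z)%R) =
    \sum_(0 <= l <oo) ((P ^+ n)%R i k * (P ^+ l)%R k j)%R y)%E.
  rewrite nneseries_esumT => [|l]; last by rewrite cval_ge0.
  rewrite exchange_esum => [|l z]; last by rewrite mule_ge0 ?cval_ge0.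
  apply: eq_esum => z _; rewrite /gsum nneseries_esumT => [|l]; last by rewrite cval_ge0.
  by rewrite esumZ ?cval_ge0// => l; rewrite cval_ge0.
under eq_bigr do rewrite E.
rewrite -nneseries_sum => [|k l _]; last by rewrite cval_ge0.
rewrite /gsum [leRHS](nneseries_split 0%N n) ?add0n => [|l _]; last by rewrite cval_ge0.
rewrite -(@nneseries_addn _ (fun l => (P ^+ l)%R i j y)) => [|l]; last by rewrite cval_ge0.
apply: (@le_trans _ _ (\sum_(0 <= l <oo) (P ^+ (l + n))%R i j y)%E).
  apply: lee_nneseries => [l _ _|l _].
    by apply: sume_ge0 => k _; rewrite cval_ge0.
  by rewrite addnC exprD -mulmxE mulmx_convfunE.
by rewrite leeDr// sume_ge0// => l _; rewrite cval_ge0.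
Qed.

Lemma gsum_le_tsum i y : (gsum pK i i y <= tsum pK y)%E.
Proof.
apply: lee_nneseries => [n _ _|n _]; first by rewrite cval_ge0.
by rewrite mxtraceE (bigD1 i)//= leeDl// sume_ge0// => k _; rewrite cval_ge0.
Qed.

Lemma exp_decay (K r e : R) : 0 <= K -> 0 < r -> 0 < e ->
  exists n0 : nat, forall n, (n0 <= n)%N -> K * expR (- (r * n%:R)) <= e.
Proof.
move=> K0 r0 e0; exists (Num.bound (K / (e * r))) => n hn.
rewrite expRN ler_pdivrMr ?expR_gt0//.
have h : K / (e * r) <= n%:R.
  apply: le_trans (_ : (Num.bound (K / (e * r)))%:R <= _); last by rewrite ler_nat.
  by rewrite ltW// archi_boundP// divr_ge0// mulr_ge0// ltW.
rewrite ler_pdivrMr ?mulr_gt0// in h.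
have := expR_ge1Dx (r * n%:R); nra.
Qed.

Variables (u : 'rV[R]_d) (pi : 'rV[R]_N) (C : 'cV[R]_N).
Hypotheses (uF : Fdom p u) (pi0 : forall i, 0 < pi 0 i)
  (C0 : forall i, 0 < C i 0) (piF : pi *m Fmx p u = pi)
  (FC : Fmx p u *m C = C) (piC : (pi *m C) 0 0 = 1).

Local Notation M := (drift_row p u pi C).
Local Notation L := (of_lattice R).

(** Chernoff's bound for the displacement along [w]: tilting by s w costs 1 + s M.w + s eps / 2 per
    step against a gain of e^(s (M.w + eps)), which leaves the rate s eps / 2. *)
Lemma tail_bound w eps : 0 < eps -> exists K r, [/\ 0 <= K, 0 < r &
  forall a n, (\sum_b \esum_(z in [set: 'rV[int]_d]) ((P ^+ n)%R a b z *
    (if eps * n%:R < dot w (L z) - n%:R * dot M w then expR (dot u (L z)) else 0)%:E)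
    <= (K * expR (- (r * n%:R)))%:E)%E].
Proof.
move=> eps0.
have [g hg] := Fmx_perturb N0 pK pI uF pi0 C0 piF FC piC w.
have e20 : 0 < eps / 2 by rewrite divr_gt0.
have [s s0 hs] := hg _ e20.
have [|sF v0 hv] := hs s; first by rewrite gtr0_norm.
rewrite (drift_dot pK pi C uF) gtr0_norm// in hv.
set v := C + s *: g in v0 hv; set F' := Fmx p (u + s *: w) in hv.
pose rho := 1 + s * dot M w + eps / 2 * s.
have hv' i : (F' *m v) i 0 <= rho * v i 0 by case/andP: (hv i).
have LF : laplace_mx (u + s *: w) P F' by exact: laplace_Fmx.
have F0 := laplace_nneg LF.
have rho0 : 0 <= rho.
  pose i0 := Ordinal N0.
  have : 0 <= rho * v i0 0.
    apply: le_trans (hv' i0); rewrite mxE; apply: sumr_ge0 => j _.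
    by rewrite mulr_ge0 ?F0// ltW.
  by rewrite pmulr_lge0.
have [vm vm0 vmle] := pos_lower_bound v0.
pose K := (\sum_i v i 0) / vm.
have K0 : 0 <= K by rewrite divr_ge0 ?(ltW vm0)// sumr_ge0// => i _; rewrite ltW.
exists K, (s * (eps / 2)); split => //; first by rewrite mulr_gt0.
move=> a n.
have Fn b : laplace (u + s *: w) ((P ^+ n) a b) = ((F' ^+ n) a b)%:E.
  exact: (laplace_mxX n LF).
pose ee := expR (- (s * (n%:R * (dot M w + eps)))).
have ee0 : 0 <= ee by exact: expR_ge0.
apply: (@le_trans _ _ (\sum_b (ee%:E * laplace (u + s *: w) ((P ^+ n)%R a b)))%E).
  apply: lee_sum => b _; rewrite /laplace -esumZ ?lee_fin// => [|z]; last first.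
    by rewrite mule_ge0 ?cval_ge0 ?EFin_expR_ge0.
  apply: le_esum => z _; rewrite muleCA; apply: lee_wpmul2l; first exact: cval_ge0.
  rewrite -EFinM lee_fin /ee -expRD dotDl dotZl; case: ifP => [h|_]; last exact: expR_ge0.
  rewrite ler_expR; have : 0 < s * (dot w (L z) - n%:R * dot M w - eps * n%:R).
    by rewrite mulr_gt0// subr_gt0.
  by lra.
under eq_bigr do rewrite Fn -EFinM.
rewrite sumEFin lee_fin -mulr_sumr.
have h1 : \sum_b (F' ^+ n) a b <= K * rho ^+ n.
  rewrite /K mulrAC ler_pdivlMr// mulr_suml.
  apply: (@le_trans _ _ ((F' ^+ n *m v) a 0)).
    rewrite mxE; apply: ler_sum => b _; rewrite ler_wpM2l//.
    exact: exp_nneg.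
  apply: le_trans (supersolution_exp n F0 rho0 hv' a) _.
  rewrite mulrC ler_wpM2r ?exprn_ge0// (bigD1 a)//= lerDl.
  by apply: sumr_ge0 => i _; rewrite ltW.
apply: le_trans (ler_wpM2l ee0 h1) _.
rewrite mulrCA ler_wpM2l//.
have h2 : rho ^+ n <= expR (n%:R * (s * dot M w + eps / 2 * s)).
  rewrite expRM_natl lerXn2r ?nnegrE ?expR_ge0// /rho -addrA.
  exact: expR_ge1Dx.
apply: le_trans (ler_wpM2l ee0 h2) _.
by rewrite /ee -expRD ler_expR le_eqVlt; apply/orP; left; apply/eqP; field.
Qed.

Definition near_drift (eps : R) (n : nat) (z : 'rV[int]_d) : bool :=
  [forall i, `|(z 0 i)%:~R - n%:R * M 0 i| <= eps * n%:R].

(** The total mass is C_a because F(u)^n C = C. A union bound over the signed coordinate directions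
    removes at most half of it. *)
Lemma good_mass eps : 0 < eps -> exists n0 : nat, forall n, (n0 <= n)%N -> forall a,
  ((C a 0 / 2)%:E <= \sum_b \esum_(z in [set: 'rV[int]_d]) ((P ^+ n)%R a b z *
    (if near_drift eps n z then expR (dot u (L z)) * C b 0 else 0)%:E))%E.
Proof.
move=> eps0.
pose ww (t : 'I_d * bool) : 'rV[R]_d := (-1) ^+ t.2 *: delta_mx 0 t.1.
have wdot t (y : 'rV[R]_d) : dot (ww t) y = (-1) ^+ t.2 * y 0 t.1.
  rewrite dotZl; congr (_ * _); rewrite /dot (bigD1 t.1)//= big1 => [|j /negPf jt].
    by rewrite mxE !eqxx mul1r addr0.
  by rewrite mxE jt andbF mul0r.
have hK t : exists Kr : R * R, [/\ 0 <= Kr.1, 0 < Kr.2 &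
  forall a n, (\sum_b \esum_(z in [set: 'rV[int]_d]) ((P ^+ n)%R a b z *
    (if (eps * n%:R < dot (ww t) (L z) - n%:R * dot M (ww t))%R then expR (dot u (L z)) else 0)%:E)
    <= (Kr.1 * expR (- (Kr.2 * n%:R)))%:E)%E].
  by have [K [r [h1 h2 h3]]] := tail_bound (ww t) eps0; exists (K, r).
pose Cmax := \sum_b C b 0.
have Cle b : C b 0 <= Cmax.
  by rewrite /Cmax (bigD1 b)//= lerDl sumr_ge0// => k _; rewrite ltW.
have Cmax0 : 0 <= Cmax by rewrite /Cmax sumr_ge0// => k _; rewrite ltW.
have [c c0 cle] := pos_lower_bound C0.
(* Each direction gets the budget c / (2 D), so that together they cost at most c / 2 <= C_a / 2. *)
pose D : R := #|{: 'I_d * bool}|%:R + 1.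
have D0 : 0 < D by rewrite ltr_wpDl.
have hn t : exists n0 : nat, forall n, (n0 <= n)%N ->
   Cmax * (sval (cid (hK t))).1 * expR (- ((sval (cid (hK t))).2 * n%:R)) <= c / (2 * D).
  case: cid => -[K r] /= [K0 r0 _]; apply: exp_decay => //; first by rewrite mulr_ge0.
  by rewrite divr_gt0// mulr_gt0.
pose n0 t := sval (cid (hn t)).
have n0P t n : (n0 t <= n)%N ->
   Cmax * (sval (cid (hK t))).1 * expR (- ((sval (cid (hK t))).2 * n%:R)) <= c / (2 * D).
  exact: (svalP (cid (hn t))).
exists (\max_t n0 t)%N => n nn a.
pose bad t z : R := if eps * n%:R < dot (ww t) (L z) - n%:R * dot M (ww t)
  then expR (dot u (L z)) else 0.
have bad0 t z : 0 <= bad t z by rewrite /bad; case: ifP => _ //; exact: expR_ge0.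
pose Bt t := (\sum_b \esum_(z in [set: 'rV[int]_d]) ((P ^+ n)%R a b z * (bad t z)%:E))%E.
have BtP t : (Cmax%:E * Bt t <= (c / (2 * D))%:E)%E.
  have [K0 r0 h] := svalP (cid (hK t)).
  apply: le_trans (lee_wpmul2l _ (h a n)) _; first by rewrite lee_fin.
  rewrite -EFinM lee_fin mulrA; apply: n0P.
  by apply: leq_trans nn; exact: leq_bigmax.
set Gd := (X in (_ <= X)%E).
have tot : ((C a 0)%:E <= Gd + \sum_t Cmax%:E * Bt t)%E.
  have -> : (C a 0)%:E = (\sum_b \esum_(z in [set: 'rV[int]_d])
      ((P ^+ n)%R a b z * (expR (dot u (L z)) * C b 0)%:E))%E.
    have FCn : Fmx p u ^+ n *m C = C.
      by elim: n {nn bad bad0 Bt BtP Gd} => [|k IH]; rewrite ?expr0 ?mul1mx// exprSr -mulmxE -mulmxA FC.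
    rewrite -{1}FCn mxE -sumEFin; apply: eq_bigr => b _.
    rewrite EFinM -(laplace_mxX n (laplace_Fmx pK uF)) muleC -esumZ; last 2 first.
    - by rewrite lee_fin ltW.
    - by move=> z; rewrite mule_ge0 ?cval_ge0 ?EFin_expR_ge0.
    by apply: eq_esum => z _; rewrite muleCA -EFinM mulrC.
  have -> : (\sum_t Cmax%:E * Bt t = \sum_b \esum_(z in [set: 'rV[int]_d])
      \sum_t ((P ^+ n)%R a b z * (Cmax * bad t z)%:E))%E.
    transitivity (\sum_t \sum_b \esum_(z in [set: 'rV[int]_d])
         ((P ^+ n)%R a b z * (Cmax * bad t z)%:E))%E.
      apply: eq_bigr => t _; rewrite /Bt ge0_sume_distrr => [|b _]; last first.
        by apply: esum_ge0 => z _; rewrite mule_ge0 ?cval_ge0 ?lee_fin.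
      apply: eq_bigr => b _; rewrite -esumZ ?lee_fin//; last first.
        by move=> z; rewrite mule_ge0 ?cval_ge0 ?lee_fin.
      by apply: eq_esum => z _; rewrite muleCA -EFinM.
    rewrite exchange_big/=; apply: eq_bigr => b _; rewrite esum_sum// => z t _ _.
    by rewrite mule_ge0 ?cval_ge0// lee_fin mulr_ge0.
  rewrite /Gd -big_split/=; apply: lee_sum => b _.
  rewrite -esumD; last 2 first.
  - move=> z _; rewrite mule_ge0 ?cval_ge0// lee_fin; case: ifP => _ //.
    by rewrite mulr_ge0 ?expR_ge0// ltW.
  - move=> z _; apply: sume_ge0 => t _; rewrite mule_ge0 ?cval_ge0// lee_fin.
    by rewrite mulr_ge0.
  apply: le_esum => z _; case: ifPn => [_|].
    rewrite leeDl// sume_ge0// => t _; rewrite mule_ge0 ?cval_ge0// lee_fin.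
    by rewrite mulr_ge0.
  rewrite /near_drift => /forallPn[ i ]; rewrite -ltNge => hi; rewrite mule0 add0e.
  (* The sign of the deviation selects the direction whose tail contains this [z]. *)
  pose sb : bool := (z 0 i)%:~R - n%:R * M 0 i < 0.
  pose t := (i, sb).
  rewrite (bigD1 t)//= -[leLHS]adde0; apply: leeD; last first.
    by apply: sume_ge0 => l _; rewrite mule_ge0 ?cval_ge0// lee_fin mulr_ge0.
  apply: lee_wpmul2l; first exact: cval_ge0.
  rewrite lee_fin mulrC /bad [dot M _]dotC !wdot /t /=.
  rewrite mulrCA -mulrBr [(L z) 0 i]mxE.
  have -> : (-1) ^+ sb * ((z 0 i)%:~R - n%:R * M 0 i) =
     `|(z 0 i)%:~R - n%:R * M 0 i|.
    rewrite /sb; move: (_ - _) => r.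
    have [h|h] := ltP r 0; first by rewrite expr1 mulN1r ltr0_norm.
    by rewrite expr0 mul1r ger0_norm.
  by rewrite hi ler_wpM2r ?expR_ge0.
have sb : (\sum_t Cmax%:E * Bt t <= (C a 0 / 2)%:E)%E.
  apply: le_trans (lee_sum _ (fun t _ => BtP t)) _.
  rewrite sumEFin lee_fin sumr_const -[_ *+ _]mulr_natl.
  have h : c / (2 * D) * D = c / 2 by field; rewrite gt_eqF.
  have h2 : 0 <= c / (2 * D) by rewrite divr_ge0 ?(ltW c0)// mulr_ge0// ltW.
  have h3 := cle a; rewrite /D in h *; nra.
have := le_trans tot (leeD2l Gd sb).
rewrite -leeBlDr// -EFinB; apply: le_trans; rewrite lee_fin; lra.
Qed.

(** A path goes to some z near n M and is completed from z to [y] by [gsum_lower], at a cost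
    exponential in the distance. *)
Lemma tsum_lower : exists A B, [/\ 0 < A, 0 <= B & forall eps, 0 < eps ->
  exists n0 : nat, forall n, (n0 <= n)%N -> forall y : 'rV[int]_d,
  ((A * expR (- dot u (L y) - B * (\sum_i `|(y 0 i)%:~R - n%:R * M 0 i| + d%:R * (eps * n%:R))))%:E
   <= tsum pK y)%E].
Proof.
have [k0 [k [k00 kpos hk]]] := gsum_lower N0 pK pI.
pose a := Ordinal N0.
pose Cmax := \sum_b C b 0.
have Cle b : C b 0 <= Cmax.
  by rewrite /Cmax (bigD1 b)//= lerDl sumr_ge0// => l _; rewrite ltW.
have Cmax0 : 0 < Cmax by apply: lt_le_trans (Cle a).
(* Per unit of lattice distance, [K] is the cost of the completing path and [U] that of replacing
   u.z by u.y. *)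
pose K := `|ln k|; pose U := \sum_i `|u 0 i|.
have U0 : 0 <= U by apply: sumr_ge0.
have K0 : 0 <= K by exact: normr_ge0.
exists (C a 0 / 2 * (k0 / Cmax)), (K + U); split.
- by rewrite !mulr_gt0 ?invr_gt0.
- by rewrite addr_ge0.
move=> eps eps0; have [n0 hn0] := good_mass eps0; exists n0 => n nn y.
set Del := (X in _ - _ * X).
apply: le_trans (gsum_le_tsum a y); apply: le_trans (gsum_chain n a a y).
pose f := k0 / Cmax * expR (- dot u (L y) - (K + U) * Del).
have f0 : 0 <= f by rewrite mulr_ge0 ?expR_ge0// divr_ge0 ?ltW.
rewrite (_ : _ * expR _ = f * (C a 0 / 2)) ?EFinM; last by rewrite /f; ring.
apply: le_trans (lee_wpmul2l _ (hn0 n nn a)) _; first by rewrite lee_fin.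
rewrite ge0_sume_distrr => [|b _]; last first.
  apply: esum_ge0 => z _; rewrite mule_ge0 ?cval_ge0// lee_fin; case: ifP => _ //.
  by rewrite mulr_ge0 ?expR_ge0// ltW.
apply: lee_sum => b _; rewrite -esumZ ?lee_fin//; last first.
  move=> z; rewrite mule_ge0 ?cval_ge0// lee_fin; case: ifP => _ //.
  by rewrite mulr_ge0 ?expR_ge0// ltW.
apply: le_esum => z _; rewrite muleCA; apply: lee_wpmul2l; first exact: cval_ge0.
case: ifPn => [|_]; last by rewrite mule0 gsum_ge0.
rewrite /near_drift => /forallP good.
apply: le_trans (hk b a (y - z)); rewrite -EFinM lee_fin.
pose del : R := \sum_i `|(y 0 i)%:~R - (z 0 i)%:~R|.
have lnE : (lnorm1 (y - z))%:R = del.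
  rewrite /lnorm1 natr_sum; apply: eq_bigr => i _.
  by rewrite natr_absz !mxE -rmorphB intr_norm.
have delD : del <= Del.
  have -> : Del = \sum_i (`|(y 0 i)%:~R - n%:R * M 0 i| + eps * n%:R).
    by rewrite big_split/= sumr_const card_ord -[_ *+ d]mulr_natl.
  apply: ler_sum => i _.
  rewrite (le_trans (ler_distD (n%:R * M 0 i) _ _))// lerD2l distrC.
  exact: good.
have del0 : 0 <= del by apply: sumr_ge0.
have uz : dot u (L z) <= dot u (L y) + U * del.
  rewrite -lerBlDl -dotBr -of_latticeB; apply: le_trans (ler_norm _) _.
  rewrite /dot mulr_sumr; apply: le_trans (ler_norm_sum _ _ _) _.
  apply: ler_sum => i _; rewrite normrM.
  apply: ler_pM => //; first by rewrite /U (bigD1 i)//= lerDl sumr_ge0.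
  by rewrite !mxE rmorphB distrC.
have kn : expR (- (K * del)) <= k ^+ lnorm1 (y - z).
  have -> : k ^+ lnorm1 (y - z) = expR (ln k * del).
    by rewrite -lnE mulrC expRM_natl lnK.
  rewrite ler_expR -mulNr ler_wpM2r// lerNl.
  by apply: le_trans (ler_norm _) _; rewrite normrN.
apply: (@le_trans _ _ (k0 * expR (- (K * del)))); last by rewrite ler_wpM2l// ltW.
have cC : C b 0 / Cmax <= 1 by rewrite ler_pdivrMr// mul1r.
have ex : expR (- dot u (L y) - (K + U) * Del) * expR (dot u (L z)) <= expR (- (K * del)).
  rewrite -expRD ler_expR.
  have KU : 0 <= K + U by rewrite addr_ge0.
  have := ler_wpM2l KU delD; lra.
have -> : f * (expR (dot u (L z)) * C b 0) = k0 * ((C b 0 / Cmax) *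
   (expR (- dot u (L y) - (K + U) * Del) * expR (dot u (L z)))).
  by rewrite /f; ring.
rewrite ler_wpM2l ?(ltW k00)// -[leRHS]mul1r.
apply: ler_pM => //; first by rewrite divr_ge0 ?ltW.
Qed.

End LLN.

(** * Asymptotics of the Green function *)

Section GreenFinite.
Variables (R : realType) (d N : nat) (p : kernel_on R d N).
Hypothesis N0 : (0 < N)%N.
Hypothesis pK : invariant_kernel p.
Hypothesis pI : strongly_irreducible p.
Variable u0 : 'rV[R]_d.
Hypotheses (u0F : Fdom p u0) (u01 : lambda p u0 < 1).

(** At [u0] the transform of P^n has growth rate lambda(u0)^n with lambda(u0) < 1, so the series is
    geometric. *)
Lemma gsum_fin i j y : (gsum pK i j y < +oo)%E.
Proof.
have [_ [v [l0 _ v0 _ Fv]]] := lambda_PF N0 pK pI u0F.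
have F0 : nneg_mx (Fmx p u0) by apply: Fmx_ge0; exact: kernel_ge0 pK.
have Fv' t : (Fmx p u0 *m v) t 0 <= lambda p u0 * v t 0 by rewrite Fv mxE.
pose c := v i 0 / v j 0 * expR (- dot u0 (of_lattice R y)).
have c0 : 0 <= c by rewrite mulr_ge0 ?expR_ge0// divr_ge0// ltW.
have l01 : 0 <= lambda p u0 < 1 by rewrite (ltW l0).
apply: (@le_lt_trans _ _ (c%:E * \sum_(0 <= n <oo) (lambda p u0 ^+ n)%:E)%E).
  rewrite -nneseriesZl => [|n _]; last by rewrite lee_fin exprn_ge0// ltW.
  apply: lee_nneseries => [n _ _|n _]; first exact: cval_ge0.
  apply: le_trans (kernel_upper i j y (laplace_mxX n (laplace_Fmx pK u0F))
    (exp_nneg n F0) v0 (supersolution_exp n F0 (ltW l0) Fv')) _.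
  by rewrite -EFinM lee_fin le_eqVlt; apply/orP; left; apply/eqP; rewrite /c; ring.
apply: (le_lt_trans (lee_wpmul2l _ (geometric_le l01))); first by rewrite lee_fin.
by rewrite -EFinM ltry.
Qed.

Lemma tsum_fin y : (tsum pK y < +oo)%E.
Proof.
rewrite /tsum (_ : (\sum_(0 <= n <oo) _)%E = (\sum_i gsum pK i i y)%E).
  by apply: lte_sum_pinfty => i _; exact: gsum_fin.
rewrite -nneseries_sum => [|i n _]; last exact: cval_ge0.
by apply: eq_eseriesr => n _; rewrite mxtraceE.
Qed.

End GreenFinite.

Section Asymptotics.
Variables (R : realType) (d N : nat) (p : kernel_on R d N).
Hypothesis N0 : (0 < N)%N.
Hypothesis pK : invariant_kernel p.
Hypothesis pI : strongly_irreducible p.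
Variable u0 : 'rV[R]_d.
Hypotheses (u0F : Fdom p u0) (u01 : lambda p u0 < 1).
Variables (u : 'rV[R]_d) (pi : 'rV[R]_N) (C : 'cV[R]_N).
Hypotheses (uF : Fdom p u) (pi0 : forall i, 0 < pi 0 i)
  (C0 : forall i, 0 < C i 0) (piF : pi *m Fmx p u = pi)
  (FC : Fmx p u *m C = C) (piC : (pi *m C) 0 0 = 1).
Variables (y : nat -> 'rV[int]_d) (v : 'rV[R]_d).
Hypothesis yv : cvg_to_boundary y v.
Hypothesis Mv : direction (drift_row p u pi C) = v.

Local Notation P := (kernel_mx pK).
Local Notation L := (of_lattice R).
Local Notation M := (drift_row p u pi C).
Let r n := enorm (L (y n)).

Lemma dot_boundary : dot v v = 1.
Proof. by case: yv => v1 _ _; rewrite -enorm_sqr v1 expr1n. Qed.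

Lemma enorm_large (A : R) : \forall n \near \oo, A <= r n.
Proof. by case: yv => _ /cvgryPge + _; exact. Qed.

Lemma y_polar n : 0 < r n -> L (y n) = r n *: direction (L (y n)).
Proof.
move=> rn; apply: directionK; apply/eqP => h; move: rn.
by rewrite /r h /enorm dot0r sqrtr0 ltxx.
Qed.

Lemma dot_dir_near : \forall n \near \oo, r n / 2 <= dot v (L (y n)).
Proof.
case: yv => _ _ dv.
have : dot (direction (L (y n))) v @[n --> \oo] --> dot v v.
  exact: (cvg_comp _ _ dv (@continuous_dot R d v v)).
rewrite dot_boundary => /cvgr_ge/(_ (1 / 2)) h.
near=> n.
have rn : 0 < r n by apply: (@lt_le_trans _ _ 1) => //; near: n; exact: enorm_large.
rewrite (y_polar rn) dotZr [dot v _]dotC ler_pM2l//.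
rewrite -[2^-1]mul1r; near: n; apply: h; lra.
Unshelve. all: by end_near. Qed.

Lemma norm1_dir_near (e : R) : 0 < e -> \forall n \near \oo,
  \sum_i `|direction (L (y n)) 0 i - v 0 i| <= e.
Proof.
move=> e0; case: yv => _ _ dv.
pose f (z : 'rV[R]_d) := \sum_i `|z 0 i - v 0 i|.
have cf : {for v, continuous f}.
  have c i : continuous (fun z : 'rV[R]_d => z 0 i) by exact: coord_continuous.
  apply: (@cvg_big _ _ _ _ _ _ _ (nbhs v)) => [|i _]; first exact: add_continuous.
  by apply: cvg_norm; apply: cvgB; [exact: c|exact: cvg_cst].
have : f (direction (L (y n))) @[n --> \oo] --> f v.
  exact: (cvg_comp _ _ dv cf).
have -> : f v = 0 by rewrite /f big1// => i _; rewrite subrr normr0.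
by move=> /cvgr_le; apply.
Qed.

(** [tsum_lower] is used at about |y_n| / |M| steps: the drift then arrives within o(|y_n|) of y_n,
    since [M] and y_n have asymptotically the same direction. *)
Lemma tsum_near : exists2 A, 0 < A & forall del, 0 < del -> \forall n \near \oo,
  ((A * expR (- dot u (L (y n)) - del * r n))%:E <= tsum pK (y n))%E.
Proof.
have [A [B [A0 B0 hAB]]] := tsum_lower N0 pK pI uF pi0 C0 piF FC piC.
exists A => // del del0.
pose c := enorm M.
have Mn0 : M != 0.
  apply/eqP => M0; have := dot_boundary; rewrite -Mv M0 /direction scaler0 dot0r => /eqP.
  by rewrite eq_sym oner_eq0.
have c0 : 0 < c by exact: enorm_gt0.
have McE : M = c *: v by rewrite -Mv; exact: directionK.
(* Three errors share [del]: that of the direction, that of rounding the number of steps, and that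
   of the fluctuations. *)
pose eta := del / (3 * (B + 1)).
have B1 : 0 < 3 * (B + 1) by rewrite mulr_gt0// ltr_wpDl.
have eta0 : 0 < eta by rewrite divr_gt0.
have d1 : 0 < d%:R + 1 :> R by rewrite ltr_wpDl.
pose eps := eta * c / (d%:R + 1).
have eps0 : 0 < eps by rewrite divr_gt0// mulr_gt0.
have [n0 hn0] := hAB _ eps0.
have Beta : B * eta <= del / 3.
  rewrite /eta mulrA ler_pdivrMr// mulrC; have := mulr_gt0 del0 B1.
  by rewrite (_ : del / 3 * (3 * (B + 1)) = del * (B + 1)); [lra|field].
near=> n.
have rn : 0 < r n by apply: (@lt_le_trans _ _ 1) => //; near: n; exact: enorm_large.
(* The number of steps that the drift, of length [c], takes to cover the distance; rounding moves
   the endpoint by at most [c]. *)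
pose k := Num.truncn (r n / c).
have rc0 : 0 <= r n / c by rewrite divr_ge0// ltW.
have /andP[k1 k2] := truncn_itv rc0.
have kn : (n0 <= k)%N.
  rewrite truncn_ge_nat// ler_pdivlMr//.
  by near: n; exact: enorm_large.
apply: le_trans (hn0 k kn (y n)); rewrite lee_fin ler_wpM2l ?(ltW A0)//.
rewrite ler_expR lerD2l lerN2.
have s1 : \sum_i `|direction (L (y n)) 0 i - v 0 i| <= eta.
  by near: n; exact: norm1_dir_near.
have k1' : k%:R * c <= r n by rewrite -ler_pdivlMr.
have k2' : r n <= k%:R * c + c.
  by move: k2; rewrite -natr1 => /ltW; rewrite ler_pdivrMr// mulrDl mul1r.
have vi i : `|v 0 i| <= 1 by case: yv => <- _ _; exact: coord_le_enorm.
have s2 : \sum_i `|(y n 0 i)%:~R - k%:R * M 0 i| <= r n * eta + d%:R * c.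
  apply: (@le_trans _ _ (\sum_i (r n * `|direction (L (y n)) 0 i - v 0 i| + c))).
    apply: ler_sum => i _.
    have -> : (y n 0 i)%:~R = r n * direction (L (y n)) 0 i.
      by have := congr1 (fun z : 'rV[R]_d => z 0 i) (y_polar rn); rewrite mxE => ->; rewrite mxE.
    have -> : M 0 i = c * v 0 i by rewrite McE mxE.
    have -> : r n * direction (L (y n)) 0 i - k%:R * (c * v 0 i) =
      r n * (direction (L (y n)) 0 i - v 0 i) + (r n - k%:R * c) * v 0 i by ring.
    rewrite (le_trans (ler_normD _ _))// lerD//; first by rewrite normrM gtr0_norm.
    rewrite normrM ger0_norm ?subr_ge0// -[leRHS]mulr1 ler_pM// ?subr_ge0//.
    by rewrite lerBlDl.
  rewrite big_split/= -mulr_sumr sumr_const card_ord -[c *+ d]mulr_natl lerD2r.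
  by rewrite ler_wpM2l// ltW.
have s3 : d%:R * (eps * k%:R) <= eta * r n.
  have -> : d%:R * (eps * k%:R) = (d%:R / (d%:R + 1)) * (eta * (k%:R * c)).
    by rewrite /eps; field; rewrite gt_eqF.
  rewrite -[leRHS]mul1r; apply: ler_pM.
  - by rewrite divr_ge0// ltW.
  - by rewrite mulr_ge0 ?(ltW eta0)// mulr_ge0// ltW.
  - by rewrite ler_pdivrMr// mul1r lerDl.
  - by rewrite ler_wpM2l// ltW.
have s4 : B * (d%:R * c) <= del / 3 * r n.
  rewrite -ler_pdivrMl ?divr_gt0//.
  by near: n; exact: enorm_large.
have s5 : B * eta * r n <= del / 3 * r n by rewrite ler_wpM2r// ltW.
have := ler_wpM2l B0 (lerD s2 s3).
move: s4 s5; lra.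
Unshelve. all: by end_near. Qed.

(** Since v.y_n >= |y_n| / 2 eventually, the error has the extra factor e^(-k |y_n| / 2), while
    [tsum] loses only e^(-k |y_n| / 4). *)
Lemma error_near k B e : 0 < k -> 0 <= B -> 0 < e -> \forall n \near \oo,
  ((B * expR (- dot (u + k *: v) (L (y n))))%:E <= e%:E * tsum pK (y n))%E.
Proof.
move=> k0 B0 e0; have [A A0 hA] := tsum_near.
have k4 : 0 < k / 4 by rewrite divr_gt0.
near=> n.
have h1 : ((A * expR (- dot u (L (y n)) - k / 4 * r n))%:E <= tsum pK (y n))%E.
  by near: n; exact: hA.
apply: (@le_trans _ _ (e%:E * (A * expR (- dot u (L (y n)) - k / 4 * r n))%:E)%E).
  rewrite -EFinM lee_fin dotDl dotZl.
  have h2 : r n / 2 <= dot v (L (y n)) by near: n; exact: dot_dir_near.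
  have h3 : B / (e * A) <= k / 4 * r n.
    by rewrite -ler_pdivrMl//; near: n; exact: enorm_large.
  have h4 : B <= e * A * expR (k / 4 * r n).
    rewrite -ler_pdivrMl ?mulr_gt0// mulrC.
    by apply: le_trans h3 _; apply: le_trans (expR_ge1Dx _); rewrite lerDr.
  apply: (@le_trans _ _ (e * A * expR (k / 4 * r n) *
      expR (- (dot u (L (y n)) + k * (r n / 2))))).
    apply: ler_pM => //.
    by rewrite ler_expR lerN2 lerD2l ler_wpM2l// ltW.
  rewrite -[leLHS]mulrA -expRD [leRHS]mulrA ler_wpM2l ?(ltW (mulr_gt0 e0 A0))// ler_expR.
  by rewrite le_eqVlt; apply/orP; left; apply/eqP; field.
by apply: lee_wpmul2l; rewrite ?lee_fin// ltW.
Unshelve. all: by end_near. Qed.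

Lemma green_ratio a b x :
  fine (gsum pK b a (y n - x)) / fine (tsum pK (y n)) @[n --> \oo] -->
    expR (dot u (L x)) * (pi 0 a * C b 0).
Proof.
set q := expR _ * _.
have q0 : 0 < q by rewrite mulr_gt0 ?expR_gt0// mulr_gt0.
have gF z : (gsum pK b a z < +oo)%E by apply: gsum_fin u0F u01 _ _ _.
have tF z : (tsum pK z < +oo)%E by apply: tsum_fin u0F u01 _.
have gE z : gsum pK b a z = (fine (gsum pK b a z))%:E.
  by rewrite fineK// ge0_fin_numE// gsum_ge0.
have tE z : tsum pK z = (fine (tsum pK z))%:E.
  by rewrite fineK// ge0_fin_numE// tsum_ge0.
have [m0 hm] := irr_conv pK pI a b x.
pose m := m0.+1.
have Pm0 : (0 < (P ^+ m)%R a b x)%E by apply: hm; exact: leqnSn.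
(* One term of the finite Green function, so the weight of the mark is a real number. *)
have Pmf : ((P ^+ m)%R a b x < +oo)%E.
  apply: le_lt_trans (gsum_fin N0 pK pI u0F u01 a b x).
  rewrite /gsum (nneseries_split 0%N m.+1) => [|l _]; last exact: cval_ge0.
  rewrite add0n big_nat_recr//= -addeA addeCA leeDl// adde_ge0//.
    by apply: sume_ge0 => l _; exact: cval_ge0.
  by apply: nneseries_ge0 => l _; rewrite cval_ge0.
pose c := fine ((P ^+ m)%R a b x).
have Pc : (P ^+ m)%R a b x = c%:E by rewrite fineK// ge0_fin_numE// ltW.
have c0 : 0 < c by rewrite -lte_fin -Pc.
pose mu := c * expR (dot u (L x)) * (pi 0 a * C b 0).
have muE : mu = c * q by rewrite /mu /q -mulrA.
have mu0 : 0 < mu by rewrite muE mulr_gt0.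
have [A A0 hA] := tsum_near.
apply/cvgrPdist_le => e e0.
have ce : 0 < c * e / 2 by rewrite divr_gt0// mulr_gt0.
(* Half of the tolerance c e is for [eps], half for the exponential error; the bound by [mu] is what
   [green_lower] asks for. *)
pose eps := Order.min mu (c * e / 2).
have eps0 : 0 < eps by rewrite lt_min mu0.
have epsmu : eps <= mu by rewrite ge_min lexx.
have epse : eps <= c * e / 2 by rewrite ge_min lexx orbT.
have [k1 [B1 [k10 B10 up]]] := green_upper N0 pI uF pi0 C0 piF FC piC
  (ltn0Sn m0) (ltW c0) Pc v eps0.
have [k2 [B2 [k20 B20 lo]]] := green_lower N0 pI uF pi0 C0 piF FC piC
  (ltn0Sn m0) (ltW c0) Pc v eps0 epsmu.
rewrite -/mu in up lo.
near=> n.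
have h0 : ((A * expR (- dot u (L (y n)) - 1 * r n))%:E <= tsum pK (y n))%E.
  by near: n; exact: hA.
have e1 : ((B1 * expR (- dot (u + k1 *: v) (L (y n))))%:E <= (c * e / 2)%:E * tsum pK (y n))%E.
  by near: n; exact: (error_near k10 B10 ce).
have e2 : ((B2 * expR (- dot (u + k2 *: v) (L (y n))))%:E <= (c * e / 2)%:E * tsum pK (y n))%E.
  by near: n; exact: (error_near k20 B20 ce).
have h1 := le_trans (up (y n)) (leeD2l _ e1).
have h2 := le_trans (lo (y n)) (leeD2l _ e2).
move: h0 h1 h2; rewrite (gE (y n - x)) (tE (y n)); set g := fine (gsum _ _ _ _); set t := fine _.
rewrite -!EFinM -!EFinD !lee_fin => h0 h1 h2.
have t0 : 0 < t by apply: lt_le_trans h0; rewrite mulr_gt0 ?expR_gt0.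
have i1 : eps * t <= c * e / 2 * t by rewrite ler_wpM2r// ltW.
have j1 : g <= (q + e) * t.
  rewrite -(ler_pM2l c0) mulrA; move: h1 i1; rewrite muE; nra.
have j2 : (q - e) * t <= g.
  rewrite -(ler_pM2l c0) mulrA; move: h2 i1; rewrite muE; nra.
rewrite ler_norml; apply/andP; split.
  by rewrite lerBrDl -lerBrDr opprK ler_pdivrMr.
by rewrite lerBlDl -lerBlDr ler_pdivlMr.
Unshelve. all: by end_near. Qed.

End Asymptotics.

(** * The Martin kernel as a quotient of two Green asymptotics *)

Unset Implicit Arguments.

Theorem proposition3p17 (R : realType) (d N : nat)
    (d_gt0 : (0 < d)%N) (N_gt0 : (0 < N)%N)
    (p : kernel_on R d N)
    (p_kernel : invariant_kernel p)
    (p_irr : strongly_irreducible p)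
    (D_compact : compact (Dset p))
    (min_lt1 : exists u0 : 'rV[R]_d,
        [/\ Fdom p u0,
            forall u : 'rV[R]_d, Fdom p u -> lambda p u0 <= lambda p u &
            lambda p u0 < 1])
    (x0 : 'rV[int]_d) (k0 : 'I_N)
    (y : nat -> 'rV[int]_d) (ytilde : 'rV[R]_d)
    (y_cvg : cvg_to_boundary y ytilde)
    (u : 'rV[R]_d) (u_def : u = phi p ytilde)
    (C : 'cV[R]_N) (C_eigen : positive_right_eigenvector p u C)
    (x : 'rV[int]_d) (k j : 'I_N) :
  martin p x0 k0 k j x (y n) @[n --> \oo] -->
    C k 0 / C k0 0 * expR (dot u (of_lattice R (x - x0))).
Proof.
have [u0 [u0F _ u01]] := min_lt1.
have yt1 : enorm ytilde = 1 by case: y_cvg.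
have [uH ud] := phi_spec N_gt0 p_kernel p_irr D_compact
  (ex_intro _ u0 (conj u0F u01)) yt1.
rewrite -u_def in uH ud.
have [FC C0] := C_eigen.
have [uF u1] := uH.
rewrite u1 scale1r in FC.
have [pi [pi0 piF piC]] := normalized_left N_gt0 p_kernel p_irr uH C0.
rewrite (grad_lambda N_gt0 p_kernel p_irr uF pi0 C0 piF FC piC) in ud.
have lim a b z := @green_ratio _ _ _ _ N_gt0 p_kernel p_irr u0 u0F u01
  u pi C uF pi0 C0 piF FC piC y ytilde y_cvg ud a b z.
have [A A0 hA] := @tsum_near _ _ _ _ N_gt0 p_kernel p_irr
  u pi C uF pi0 C0 piF FC piC y ytilde y_cvg ud.
have ne0 : expR (dot u (of_lattice R x0)) * (pi 0 j * C k0 0) != 0.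
  by rewrite gt_eqF// mulr_gt0 ?expR_gt0// mulr_gt0.
(* Both limits have the terminal state [j] in the role of [a] and the same normalisation, so
   [pi 0 j] cancels and only the ratio of [C] and the exponentials remain. *)
have cv : fine (gsum p_kernel k j (y n - x)) / fine (tsum p_kernel (y n)) *
    (fine (gsum p_kernel k0 j (y n - x0)) / fine (tsum p_kernel (y n)))^-1
    @[n --> \oo] --> expR (dot u (of_lattice R x)) * (pi 0 j * C k 0) *
    (expR (dot u (of_lattice R x0)) * (pi 0 j * C k0 0))^-1.
  by apply: cvgM (lim j k x) _; apply: cvgV ne0 (lim j k0 x0).
set l := (X in _ --> X).
have lE : expR (dot u (of_lattice R x)) * (pi 0 j * C k 0) *
    (expR (dot u (of_lattice R x0)) * (pi 0 j * C k0 0))^-1 =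
    l.
  rewrite /l of_latticeB dotBr expRD expRN; field.
  by rewrite !gt_eqF ?expR_gt0.
rewrite lE in cv.
(* The normalisation cancels where [tsum] is positive and finite; the lower bound of [tsum_near]
   gives positivity for large n. *)
suff E : \forall n \near \oo,
    fine (gsum p_kernel k j (y n - x)) / fine (tsum p_kernel (y n)) *
    (fine (gsum p_kernel k0 j (y n - x0)) / fine (tsum p_kernel (y n)))^-1 =
    martin p x0 k0 k j x (y n).
  exact: (cvg_trans (near_eq_cvg E) cv).
near=> n.
have h0 : ((A * expR (- dot u (of_lattice R (y n)) - 1 * enorm (of_lattice R (y n))))%:E
    <= tsum p_kernel (y n))%E.
  by near: n; exact: hA.
have tF := tsum_fin N_gt0 p_kernel p_irr u0F u01 (y n).
have t0 : 0 < fine (tsum p_kernel (y n)).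
  rewrite fine_gt0// tF andbT; apply: lt_le_trans h0.
  by rewrite lte_fin mulr_gt0 ?expR_gt0.
rewrite /martin !(greenE p_kernel) /= invf_div mulrA divfK// gt_eqF//.
Unshelve. all: by end_near. Qed.
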